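(* For every $n\ge 3$, every simple connected $n$-vertex bipartite fan-crossing graph has at most $4n-10$ edges.
   Context: A drawing of a graph on the sphere maps vertices to pairwise distinct points and each edge to a simple Jordan arc joining its endpoints, such that no edge passes through a vertex, any two edges have finitely many common points, every common interior point of two edges is a proper crossing, and no three edges pass through the same crossing. It is simple if any two edges have at most one point in common. It is fan-crossing if for every edge $e$, the edges crossing $e$ all share a common endpoint (form a star). A simple fan-crossing graph is a graph admitting a drawing that is simple and fan-crossing. *)

(* Defs.v *)
From HB Require Import structures.
From mathcomp Require Import all_boot all_order all_algebra.
From mathcomp Require Import all_classical all_reals all_analysis.

Set Implicit Arguments.
Unset Strict Implicit.
Unset Printing Implicit Defensive.

Import Order.TTheory GRing.Theory Num.Theory.
Import numFieldNormedType.Exports.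
Local Open Scope classical_set_scope.
Local Open Scope ring_scope.

(* Finite simple graphs: a symmetric irreflexive relation on a finType.    *)

Section Graph.
Variables (V : finType) (adj : rel V).

Definition graph_conn : Prop := forall x y : V, connect adj x y.

Definition bipartite : Prop :=
  exists c : V -> bool, forall x y, adj x y -> c x != c y.

Definition edge_set : {set {set V}} :=
  [set E : {set V} | [exists x, [exists y, adj x y && (E == [set x; y]%SET)]]].

Definition num_edges : nat := #|edge_set|.

End Graph.

Section Drawing.
Variable R : realType.

Local Notation point := (R * R * R)%type.

Definition sphere : set point :=
  [set p | p.1.1 ^+ 2 + p.1.2 ^+ 2 + p.2 ^+ 2 = 1].

Definition unit_seg : set R := [set t | 0 <= t <= 1].
Definition open_seg : set R := [set t | 0 < t < 1].

Definition jordan_arc (g : R -> point) : Prop :=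
  [/\ {within unit_seg, continuous g},
      (forall s t, unit_seg s -> unit_seg t -> g s = g t -> s = t)
    & g @` unit_seg `<=` sphere].

Definition open_disk : set (R * R) := [set q | q.1 ^+ 2 + q.2 ^+ 2 < 1].

(* p is a proper crossing of the point sets A and B: some neighbourhood of
   p in the sphere is homeomorphic to the open unit disk via a map sending
   p to the origin, A to the horizontal diameter and B to the vertical one. *)
Definition proper_crossing (A B : set point) (p : point) : Prop :=
  exists (O : set point) (h : point -> R * R) (g : R * R -> point),
    [/\ open O /\ O p,
        {within sphere `&` O, continuous h} /\ {within open_disk, continuous g},
        h @` (sphere `&` O) `<=` open_disk /\ g @` open_disk `<=` sphere `&` O,
        (forall x, (sphere `&` O) x -> g (h x) = x) /\
        (forall q, open_disk q -> h (g q) = q) &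
        [/\ h p = (0, 0),
             h @` (A `&` O) = open_disk `&` [set q | q.2 = 0] &
             h @` (B `&` O) = open_disk `&` [set q | q.1 = 0]]].

Variables (V : finType) (adj : rel V).
Variables (pos : V -> point) (arc : V -> V -> R -> point).

Definition edge_pts (u v : V) : set point := arc u v @` unit_seg.
Definition edge_int (u v : V) : set point := arc u v @` open_seg.

Definition same_edge (u v x y : V) : bool := ([set u; v]%SET == [set x; y]%SET)%SET.

Definition is_drawing : Prop :=
  [/\ injective pos /\ (forall v, sphere (pos v)),
      (forall u v, adj u v ->
         [/\ jordan_arc (arc u v), arc u v 0 = pos u, arc u v 1 = pos v
           & forall t, arc v u t = arc u v (1 - t)]),
      (forall u v w, adj u v -> edge_pts u v (pos w) -> w = u \/ w = v),
      (forall u v x y, adj u v -> adj x y -> ~~ same_edge u v x y ->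
         finite_set (edge_pts u v `&` edge_pts x y)) &
      (forall u v x y p, adj u v -> adj x y -> ~~ same_edge u v x y ->
         edge_int u v p -> edge_int x y p ->
         proper_crossing (edge_pts u v) (edge_pts x y) p) /\
      (forall u v x y a b p, adj u v -> adj x y -> adj a b ->
         ~~ same_edge u v x y -> ~~ same_edge u v a b -> ~~ same_edge x y a b ->
         edge_int u v p -> edge_int x y p -> ~ edge_pts a b p)].

Definition is_simple_drawing : Prop :=
  forall u v x y p q, adj u v -> adj x y -> ~~ same_edge u v x y ->
    edge_pts u v p -> edge_pts x y p ->
    edge_pts u v q -> edge_pts x y q -> p = q.

Definition crosses (u v x y : V) : Prop :=
  ~~ same_edge u v x y /\ exists p, edge_int u v p /\ edge_int x y p.

Definition is_fan_crossing : Prop :=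
  forall u v, adj u v ->
    exists w : V, forall x y, adj x y -> crosses u v x y -> w = x \/ w = y.

End Drawing.

Definition simple_fan_crossing (R : realType) (V : finType) (adj : rel V) : Prop :=
  exists (pos : V -> R * R * R) (arc : V -> V -> R -> R * R * R),
    [/\ is_drawing adj pos arc, is_simple_drawing adj arc
      & is_fan_crossing adj arc].

(* Main.v *)
Require Import Defs.
From HB Require Import structures.
From mathcomp Require Import all_boot all_order all_algebra.
From mathcomp Require Import all_classical all_reals all_analysis.
From mathcomp Require Import zify ring lra.

(* Orient every edge from one colour class to the other and cut it at its crossings.
   Forgetting the crossings at which the two edges only touch, the drawing becomes a
   combinatorial map whose faces are the orbits of a permutation phi of the darts (directed
   pieces of edges), and F - E + V >= 2 holds for its planarization.  No face has fewer than
   three sides.  After each crossing with e, the crossing edge runs towards one of the two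
   ends of e, by the fan condition; a piece of e at which this changes from the first to the
   last end (a "switch") never lies on a face with three or four sides, and an edge whose
   first and last pieces both lie on triangles has a switch.  Discharging along the edges
   gives 4F <= #darts + E, hence E <= 4n - 8.  If E >= 4n - 9, then almost every face is a
   triangle having exactly one vertex as a corner.  Every such corner vertex lies on an edge
   at which the discharging is not tight, so there are at most two of them in each class,
   and they are too few for the number of triangles.

   The Euler inequality is obtained by linear algebra over F_2: it suffices that every set
   of pieces that meets each node evenly is the boundary of a set of faces.  For arcs in the
   plane this is proved by replacing nodes by boxes and arcs by lattice paths of a fine grid,
   and counting modulo 2 the steps met by a vertical ray.  A sphere minus a point off the
   arcs embeds in the plane. *)

(** Touchings have to go because the discharging relies on [phi] turning onto the other edge at
    every crossing.

    The colours enter at the vertices: two sides of a face meeting at a vertex have opposite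
    directions, so exactly one of them has direction [s]. Each direction gives a discharging of its
    own, and both are kept to the end, because a triangle whose only vertex has colour [b] may leave
    its slack in either of them. If [E >= 4n - 9], the slack is at most 1 in each direction; the few
    triangles that this permits leave at most six vertices, and then there would be more edges than
    pairs of vertices of different colours.

    A point of the sphere off all arcs cannot be found by measure, as Jordan arcs may have positive
    area. It comes from injectivity instead: an arc cannot fill a disk.

    The grid model is built around nodes blown up to boxes, because curves that end in a common
    point have no positive distance; outside the boxes they have one, and a fine grid keeps their
    lattice paths apart. *)

Set Implicit Arguments.
Unset Strict Implicit.
Unset Printing Implicit Defensive.

(** * Darts *)

Section Darts.
Variables (Eg : finType) (cr : rel Eg) (tau : Eg -> Eg -> nat).
Hypothesis tau_inj : forall e f g, cr e f -> cr e g -> tau e f = tau e g -> f = g.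

(* (e, o, b) starts at an end of e when o = None and at the crossing of e with f when
   o = Some f, and runs along e in the direction b up to the next crossing or end. *)
Definition dart : Type := (Eg * option Eg * bool)%type.

Definition before (b : bool) (m n : nat) := if b then m < n else n < m.

Definition beyond (e : Eg) (o : option Eg) (b : bool) (f : Eg) :=
  cr e f && (if o is Some g then before b (tau e g) (tau e f) else true).

Definition nxt (d : dart) : option Eg :=
  let: (e, o, b) := d in
  [pick f | beyond e o b f &&
    [forall g, beyond e o b g ==> ~~ before b (tau e g) (tau e f)]].

Arguments nxt : simpl never.

Definition dart_rev (d : dart) : dart := (d.1.1, nxt d, ~~ d.2).

Definition valid (d : dart) := if d.1.2 is Some f then cr d.1.1 f else true.

Lemma before_total b m n : m <> n -> before b m n || before b n m.
Proof. by rewrite /before; case: b; lia. Qed.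

Lemma before_trans b m n p : before b m n -> before b n p -> before b m p.
Proof. by rewrite /before; case: b; lia. Qed.

Lemma before_irr b m : before b m m = false.
Proof. by rewrite /before; case: b; lia. Qed.

Lemma before_neg b m n : before (~~ b) m n = before b n m.
Proof. by rewrite /before; case: b. Qed.

Lemma before_asym b m n : before b m n -> before b n m -> False.
Proof. by rewrite /before; case: b; lia. Qed.

Variant nxt_spec (e : Eg) (o : option Eg) (b : bool) : option Eg -> Prop :=
| NxtSome f of beyond e o b f
    & (forall g, beyond e o b g -> f = g \/ before b (tau e f) (tau e g)) :
    nxt_spec e o b (Some f)
| NxtNone of (forall g, beyond e o b g = false) : nxt_spec e o b None.

Lemma nxtP e o b : nxt_spec e o b (nxt (e, o, b)).
Proof.
rewrite /nxt; case: pickP => [f /andP[fb /forallP fm]|nb].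
  constructor=> // g gb; have := implyP (fm g) gb => nfg.
  case: (altP (f =P g)) => [|fg]; [by left|right].
  have: tau e f <> tau e g.
    move: fb gb => /andP[cf _] /andP[cg _] /(tau_inj cf cg) E.
    by rewrite E eqxx in fg.
  by move/(before_total b); rewrite (negPf nfg) orbF.
constructor=> g; apply/negP => gb.
have [m mb _] : exists2 m, beyond e o b m &&
    [forall g, beyond e o b g ==> ~~ before b (tau e g) (tau e m)] & True.
  (* Subtracting from the maximum reverses the order, so that one minimum serves both directions. *)
  pose key f := if b then tau e f else \max_h tau e h - tau e f.
  case: (arg_minnP key gb) => m mb mm; exists m => //.
  rewrite mb; apply/forallP => h; apply/implyP => hb.
  have := mm h hb; rewrite /key /before.
  have := leq_bigmax (F := tau e) h; have := leq_bigmax (F := tau e) m.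
  by case: (b) => /=; lia.
by have /= := nb m; rewrite mb.
Qed.

Lemma nxt_beyond e o b f : nxt (e, o, b) = Some f -> beyond e o b f.
Proof. by case: nxtP => // g gb _ [<-]. Qed.

Lemma nxt_cr d f : nxt d = Some f -> cr d.1.1 f.
Proof. by case: d => -[e o] b /nxt_beyond/andP[]. Qed.

Lemma nxt_neq e f b : nxt (e, Some f, b) <> Some f.
Proof. by move/nxt_beyond/andP=> [_]; rewrite before_irr. Qed.

Lemma rev_valid d : valid d -> valid (dart_rev d).
Proof.
move=> _; rewrite /valid /=; case E: nxt => [f|//]; exact: nxt_cr E.
Qed.

(** A crossing met on the way back before [o] would lie strictly between, so it would have been met
    first on the way out. *)
Lemma nxt_rev e o b : valid (e, o, b) -> nxt (e, nxt (e, o, b), ~~ b) = o.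
Proof.
rewrite /valid /= => vo.
case: (nxtP e o b) => [f fb fm|nb]; last first.
  case: o vo nb => [g cg|_] nb.
    case: (nxtP e None (~~ b)) => [h /andP[ch _] hm|nb']; last first.
      by have := nb' g; rewrite /beyond cg.
    congr Some; have /hm [] : beyond e None (~~ b) g by rewrite /beyond cg.
      by [].
    by rewrite before_neg; have := nb h; rewrite /beyond ch /= => ->.
  case: (nxtP e None (~~ b)) => [h /andP[ch _] _|//].
  by have := nb h; rewrite /beyond ch.
case/andP: fb => cf bf; case: o vo bf fm => [g cg|_] bf fm.
  case: (nxtP e (Some f) (~~ b)) => [h /andP[ch bh] hm|nb']; last first.
    by have := nb' g; rewrite /beyond cg before_neg bf.
  have gb : beyond e (Some f) (~~ b) g by rewrite /beyond cg before_neg.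
  have [->//|] := hm g gb.
  rewrite before_neg in bh; rewrite before_neg => gh.
  have hb : beyond e (Some g) b h by rewrite /beyond ch gh.
  have [E|/(before_asym bh)//] := fm h hb.
  by rewrite E before_irr in bh.
case: nxtP => [h /andP[ch bh] hm|//].
have hb : beyond e None b h by rewrite /beyond ch.
rewrite before_neg in bh; have [E|/(before_asym bh)//] := fm h hb.
by rewrite E before_irr in bh.
Qed.

Lemma revK d : valid d -> dart_rev (dart_rev d) = d.
Proof. by case: d => -[e o] b v; rewrite /dart_rev /= nxt_rev // negbK. Qed.

Lemma nxt_None_cr e b f : nxt (e, None, b) = None -> cr e f = false.
Proof. by case: nxtP => // /(_ f); rewrite /beyond andbT. Qed.

Lemma nxt_None_neg e b : nxt (e, None, b) = None -> nxt (e, None, ~~ b) = None.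
Proof. by move=> E; have := @nxt_rev e None b isT; rewrite E. Qed.

Lemma last_uniq e b f g : cr e f -> cr e g ->
  nxt (e, Some f, b) = None -> nxt (e, Some g, b) = None -> f = g.
Proof.
move=> cf cg; case: nxtP => // /(_ g); case: nxtP => // /(_ f).
rewrite /beyond cf cg /= => nf ng _ _; apply: (tau_inj cf cg).
by case: (tau e f =P tau e g) => // /(before_total b); rewrite ng nf.
Qed.

(** Measure for inductions along an edge; its minimum also selects the last of several crossings. *)
Definition remaining e b f := #|[pred h | beyond e (Some f) b h]|.

Lemma remaining_lt e b f g :
  beyond e (Some f) b g -> remaining e b g < remaining e b f.
Proof.
move=> /andP[cg bg]; apply: proper_card; apply/properP; split.
  apply/fintype.subsetP=> h; rewrite !inE /beyond => /andP[-> /= bh].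
  exact: before_trans bg bh.
by exists g; rewrite !inE /beyond cg /= ?bg ?before_irr.
Qed.

End Darts.
#[global] Arguments nxt : simpl never.

(** * Counting faces by discharging *)

Lemma sum_orbits (T : finType) (f : T -> T) (A : pred T) (g : T -> nat) :
  injective f -> (forall x, A (f x) = A x) ->
  \sum_(x | A x) g x = \sum_(r | froots f r && A r) \sum_(x <- orbit f r) g x.
Proof.
move=> f_inj fA; have sc := fconnect_sym f_inj.
have fAn n x : A (iter n f x) = A x by elim: n => //= n IHn; rewrite fA.
have Ar x : A (froot f x) = A x.
  by have /iter_findex <- := connect_root (frel f) x; rewrite fAn.
rewrite (partition_big (froot f) (fun r => froots f r && A r)) /=; last first.
  by move=> d v; rewrite roots_root //= Ar.
apply: eq_bigr => r /andP[/eqP rr vr]; rewrite [RHS]big_uniq ?orbit_uniq //=.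
apply: eq_bigl => x; rewrite -fconnect_orbit -(root_connect sc) rr [r == _]eq_sym.
by case: eqP => [E|_]; rewrite ?andbF // andbT -Ar E.
Qed.

(* vtx e b is the end of e at which (e, None, b) starts, so it has colour b. *)
Section Counting.
Variables (V Eg : finType) (vtx : Eg -> bool -> V).
Variables (cr : rel Eg) (tau : Eg -> Eg -> nat).
Hypothesis cr_sym : symmetric cr.
Hypothesis tau_inj : forall e f g, cr e f -> cr e g -> tau e f = tau e g -> f = g.
Hypothesis vtx_col : forall e f b, vtx e b <> vtx f (~~ b).
Hypothesis vtx_inj : forall e f b,
  vtx e b = vtx f b -> vtx e (~~ b) = vtx f (~~ b) -> e = f.
Hypothesis cr_disj : forall e f b, cr e f -> vtx e b <> vtx f b.
Hypothesis fan : forall e f g b, cr e f -> cr e g ->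
  vtx f b = vtx g b \/ vtx f (~~ b) = vtx g (~~ b).
Hypothesis no_isolated : forall e, exists2 e', e' != e &
  exists b, vtx e' b = vtx e b.

Local Notation dart := (dart Eg).
Local Notation nxt := (nxt cr tau).
Local Notation rev := (dart_rev cr tau).
Local Notation valid := (@valid Eg cr).
Local Notation nxt_beyond := (nxt_beyond tau_inj).
Local Notation nxt_cr := (nxt_cr tau_inj).
Local Notation nxt_neq := (nxt_neq tau_inj).
Local Notation nxt_rev := (nxt_rev tau_inj).
Local Notation revK := (revK tau_inj).
Local Notation rev_valid := (rev_valid tau_inj).
Local Notation nxt_None_cr := (nxt_None_cr tau_inj).
Local Notation nxt_None_neg := (nxt_None_neg tau_inj).
Local Notation last_uniq := (last_uniq tau_inj).

Variable phi : dart -> dart.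
Hypothesis phi_inj : injective phi.
Hypothesis phi_valid : forall d, valid (phi d) = valid d.
Hypothesis phi_cross : forall e o b f, valid (e, o, b) ->
  nxt (e, o, b) = Some f -> exists b', phi (e, o, b) = (f, Some e, b').
Hypothesis phi_end : forall e o b, valid (e, o, b) -> nxt (e, o, b) = None ->
  exists2 e', phi (e, o, b) = (e', None, ~~ b) & vtx e' (~~ b) = vtx e (~~ b).
(** With [phi] as rotation after reversal, the left side rotates twice at the crossing. Opposite
    darts there thus belong to the same edge. *)
Hypothesis phi_alt : forall e o b f, valid (e, o, b) ->
  nxt (e, o, b) = Some f -> phi (rev (phi (e, o, b))) = (e, Some f, b).
Hypothesis phi_leaf : forall e b, nxt (e, None, b) = None ->
  phi (e, None, b) = (e, None, ~~ b) ->
  forall e', vtx e' (~~ b) = vtx e (~~ b) -> e' = e.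

(** * Faces with fewer than three sides *)

Lemma cr_neq e : cr e e = false.
Proof. by apply/negP => c; case: (cr_disj (b := true) c). Qed.

Variant step_spec (e : Eg) (o : option Eg) (b : bool) :
  option Eg -> dart -> Prop :=
| StepX f b' of cr e f & Some f <> o & nxt (e, o, b) = Some f
    & phi (e, o, b) = (f, Some e, b') : step_spec e o b (Some f) (f, Some e, b')
| StepV e' of vtx e' (~~ b) = vtx e (~~ b) & nxt (e, o, b) = None
    & phi (e, o, b) = (e', None, ~~ b) : step_spec e o b None (e', None, ~~ b).

Lemma stepP e o b : valid (e, o, b) ->
  step_spec e o b (nxt (e, o, b)) (phi (e, o, b)).
Proof.
move=> v; case E: (nxt (e, o, b)) => [f|].
  have [b' Ep] := phi_cross v E; rewrite Ep; constructor=> //; first exact: nxt_cr E.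
  by move=> Eo; rewrite -Eo in E; have := nxt_neq E.
by have [e' Ep ve'] := phi_end v E; rewrite Ep; constructor.
Qed.

Lemma valid_phi d : valid d -> valid (phi d). Proof. by rewrite phi_valid. Qed.

Lemma phi_neq1 d : valid d -> phi d <> d.
Proof.
case: d => -[e o] b v; case: (stepP v) => [f b' cef _ _ _ [E _ _]|e' _ _ _ [_ _]].
  by rewrite E cr_neq in cef.
by case: (b).
Qed.

(** A face with two sides would come from an edge crossing another twice in a row, from two crossing
    edges with a common end, from two parallel edges or from an isolated edge. *)
Lemma phi_neq2 d : valid d -> phi (phi d) <> d.
Proof.
case: d => -[e o] b v E.
have := valid_phi v; have v2 := valid_phi (valid_phi v).
move: E; case: (stepP v) => [f b' cef _|e' ve'] En Ep E v1; move: E.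
  case: (stepP v1) => [g b'' cfg neq _ _|e'' ve'' _ _] [E _ _].
    by case: neq; rewrite E.
  by rewrite E in ve''; case: (cr_disj cef ve'').
case: (stepP v1) => [g b'' cfg neq|e'' ve''] En1 Ep1.
  by case=> E _ _; rewrite E in cfg; case: (cr_disj cfg ve').
rewrite negbK in ve'' Ep1; rewrite negbK => -[Ee Eo]; subst e'' o.
have ? : e' = e by apply: (vtx_inj (b := b)).
subst e'.
have [e1 ne1 [b1 vb1]] := no_isolated e.
have [Eb|Eb] : b1 = ~~ b \/ b1 = b by case: (b1) (b) => -[]; auto.
  rewrite Eb in vb1; have := phi_leaf En Ep vb1.
  by move=> E1; rewrite E1 eqxx in ne1.
have := @phi_leaf e (~~ b) En1; rewrite negbK => /(_ Ep1 e1).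
by rewrite -Eb => /(_ vb1) E1; rewrite E1 eqxx in ne1.
Qed.

(* Let l continue an edge f after its crossing with e.  Either l reaches an end of f, or its
   next crossing is with an edge h that meets e at an end because both cross f.  In each case
   exactly one of toward true e l and toward false e l holds: the face containing the corner
   between e and l may close up as a triangle only at the end vtx e s of e. *)
Definition toward (s : bool) (e : Eg) (l : dart) :=
  if nxt l is Some h then vtx h s == vtx e s else l.2 == s.

Lemma toward_or s e f b : cr e f -> toward s e (f, Some e, b) || toward (~~ s) e (f, Some e, b).
Proof.
move=> cef; rewrite /toward; case E: nxt => [h|]; last by case: (b); case: (s).
have cfh := nxt_cr E; rewrite /= in cfh; have cfe : cr f e by rewrite cr_sym.
by case: (fan s cfh cfe) => ->; rewrite eqxx ?orbT.
Qed.

Lemma toward_excl s e f b : toward s e (f, Some e, b) -> toward (~~ s) e (f, Some e, b) -> False.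
Proof.
rewrite /toward; case E: nxt => [h|] /eqP E1 /eqP E2.
  have Eh : h = e by apply: (vtx_inj E1 E2).
  by rewrite Eh in E; case: (nxt_neq E).
by rewrite E1 in E2; case: (s) E2.
Qed.

(* A piece of e between two crossings such that the corners at its two ends point, one
   backwards to the end vtx e s, the other forwards to the end vtx e (~~ s). *)
Definition switch (s : bool) (d : dart) := let: (e, o, b) := d in
  [&& b == s, o != None, nxt d != None, valid d,
      toward s e (phi (rev (e, o, ~~ b))) & toward (~~ s) e (phi d)].

(** * Switches and the faces around them *)

Lemma switchE s d : switch s d -> exists e f g, [/\ d = (e, Some f, s), cr e f,
  nxt d = Some g & toward s e (phi (rev (e, Some f, ~~ s)))] /\ toward (~~ s) e (phi d).
Proof.
case: d => -[e [f|]] b; last by rewrite /= andbF.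
case/and5P=> /eqP -> _; case E: nxt => [g|//] _ v /andP[P1 P2].
by exists e, f, g.
Qed.

(** Follows the face backwards: by [phi_alt] and injectivity, [d0] is the reverse of the piece of
    [f] whose pointing is tested at the start of the switch. The last clause is this test,
    unfolded. *)
Lemma switch_pred s d0 : valid d0 -> switch s (phi d0) ->
  exists e f w0 b0, [/\ d0 = (f, w0, b0), phi d0 = (e, Some f, s),
    nxt d0 = Some e, cr e f &
    if w0 is Some h then vtx h s = vtx e s else b0 = ~~ s].
Proof.
move=> v /switchE[e [f [g [[Ed cef _ Pp _]]]]].
pose pd := rev (e, Some f, ~~ s).
have v1 : valid (e, Some f, ~~ s) by [].
have vpd : valid pd by apply: rev_valid.
have Epd : pd = (e, nxt (e, Some f, ~~ s), s) by rewrite /pd /rev /= negbK.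
have npd : nxt pd = Some f.
  by have := nxt_rev v1; rewrite negbK Epd.
have := phi_alt (e := e) (o := nxt (e, Some f, ~~ s)) (b := s) (f := f).
rewrite -Epd => /(_ vpd npd); rewrite -Ed => /phi_inj Ed0.
have := @phi_cross e (nxt (e, Some f, ~~ s)) s f.
rewrite -Epd => /(_ vpd npd) [b' Epp].
rewrite Epp /dart_rev /= in Ed0.
have vpp : valid (f, Some e, b') by rewrite /valid /= cr_sym.
exists e, f, (nxt (f, Some e, b')), (~~ b'); split=> //.
- by rewrite -Ed0 nxt_rev.
move: Pp; rewrite -/pd Epp /toward; case: nxt => [h|] /eqP //=.
by move=> ->.
Qed.

Lemma switch_succ s d : switch s d -> exists e f g b2, [/\ d = (e, Some f, s),
  nxt d = Some g, phi d = (g, Some e, b2), cr e f & cr e g /\ f <> g] /\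
  if nxt (phi d) is Some h then vtx h (~~ s) = vtx e (~~ s) else b2 = ~~ s.
Proof.
move=> /switchE[e [f [g [[-> cef En _] Pn]]]].
have v : valid (e, Some f, s) by [].
have [b2 Ep] := phi_cross v En; exists e, f, g, b2; split.
  split=> //; split; first exact: nxt_cr En.
  by move=> E; rewrite E in En; case: (nxt_neq En).
by move: Pn; rewrite Ep /toward; case: nxt => [h|] /eqP.
Qed.

Lemma switch_valid s d : switch s d -> valid d.
Proof. by move=> /switchE[e [f [g [[-> cef _ _] _]]]]. Qed.

(** The dart between the two switches leads from [e] to [e']. The first switch gives these edges a
    common end of colour [~~ s], the second one of colour [s]. So [e' = e], which cannot be crossed
    twice in a row. *)
Lemma switch_dist2 s d : switch s d -> switch s (phi (phi d)) -> False.
Proof.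
move=> c1 c2; have v := switch_valid c1.
have [e [f [g [b2 [[Ed En Ep cef [ceg nfg]]]]]]] := switch_succ c1.
have [e' [f' [w0 [b0 [E1 _ En1 ce' Eo]]]]] := switch_pred (valid_phi v) c2.
rewrite En1 => Ev; rewrite E1 in Ep; case: Ep => E2 E3 E4; subst f' w0 b0.
have Ee : e' = e by apply: (vtx_inj (b := s)).
by subst e'; rewrite E1 in En1; case: (nxt_neq En1).
Qed.

(** The two neighbours of the switch would meet. If they cross, one of them shares an end with [e]
    although it crosses [e]. If they meet in a vertex, the two corners of the switch give this
    vertex different colours. *)
Lemma switch_face3 s d : switch s d -> phi (phi (phi d)) = d -> False.
Proof.
move=> c1 E; have v := switch_valid c1.
have [e [f [g [b2 [[Ed En Ep cef [ceg nfg]]]]]]] := switch_succ c1.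
have v2 := valid_phi v; have v3 := valid_phi v2; have := c1.
rewrite -{1}E => /(switch_pred v3)[e1 [f1 [w0 [b0 [E1 Ebb En1 ce' Eo]]]]].
rewrite E Ed in Ebb; case: Ebb => ? ?; subst e1 f1.
rewrite Ep in v2 E1 *.
move: E1; case: (stepP v2) => [h b' cgh hne _ _ [? ? ?]|e' ve' _ _ [? ? ?]]; subst.
  by move=> _; apply: (cr_disj ceg (esym Eo)).
by move=> Eb; rewrite Eb in Eo; case: (s) Eo.
Qed.

(** Let [h] carry the side opposite to the switch. If it crosses both neighbours, it has both ends
    in common with [e]. If it crosses only one of them, an edge crossing [e] shares an end with [e].
    If it crosses neither, it is uncrossed; [f] and [g] share an end by [fan], so one of them is
    parallel to [h]. *)
Lemma switch_face4 s d : switch s d -> phi (phi (phi (phi d))) = d -> False.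
Proof.
move=> c1 E; have v := switch_valid c1.
have [e [f [g [b2 [[Ed En Ep cef [ceg nfg]]]]]]] := switch_succ c1.
have v2 := valid_phi v; have v3 := valid_phi v2; have v4 := valid_phi v3.
have := c1.
rewrite -{1}E => /(switch_pred v4)[e1 [f1 [w0 [b0 [E1 Ebb En1 ce' Eo]]]]].
rewrite E Ed in Ebb; case: Ebb => ? ?; subst e1 f1.
rewrite Ep in v2 v3 v4 E1 *.
move: v3 v4 E1; case: (stepP v2) => [h b' cgh hne _ _|h ve' _ _] v3 v4 E1 Ev.
  move: E1; case: (stepP v3) => [f1 b1 c1' hne' _ _ [? ? ?]|f1 ve'' _ _ [? ? ?]]; subst.
    have Eh : h = e by apply: (vtx_inj (b := s)).
    by subst h; case: hne.
  by apply: (cr_disj cef (b := ~~ s)); rewrite -Ev -Eo ve''.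
subst b2; move: v3 v4 E1 ve'; rewrite negbK => v3 v4 E1 ve'; move: E1.
case: (stepP v3) => [f1 b1 c1' hne' En2 _ [? ? ?]|f1 ve'' En2 _ [? ? ?]]; subst.
  by apply: (cr_disj ceg (b := s)); rewrite -Eo ve'.
have En3 : nxt (h, None, ~~ s) = None by apply: (nxt_None_neg).
have nh k : cr h k = false by apply: (nxt_None_cr k En2).
have [Es|Es] := fan s cef ceg.
  have Eh : f = h by apply: (vtx_inj (b := s)); rewrite ?ve' ?ve''.
  by have := nh e; rewrite -Eh cr_sym cef.
have Eh : g = h by apply: (vtx_inj (b := s)); rewrite ?ve' -?Es ?ve''.
by have := nh e; rewrite -Eh cr_sym ceg.
Qed.

Definition uncrossed (s : bool) (d : dart) := [&& d.2 == s, d.1.2 == None & nxt d == None].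

(** The sides lie on [e1], [e2], [e3], [e4], [e0], the first two being switches. The switch on [e1]
    gives [e1] and [e3] a common end of colour [~~ s], the one on [e2] gives [e0] and [e2] a common
    end of colour [s]. A crossing at either corner of the side on [e4] then contradicts [cr_disj] or
    [vtx_inj]. *)
Lemma switch_face5 s d : switch s d -> switch s (phi d) ->
  phi (phi (phi (phi (phi d)))) = d -> uncrossed s (phi (phi (phi d))).
Proof.
move=> c1 c2 E; have v := switch_valid c1.
have [e1 [e0 [e2 [b2 [[Ed En Ep c10 [c12 n02]]]]]]] := switch_succ c1.
have v2 := valid_phi v; have v3 := valid_phi v2; have v4 := valid_phi v3.
have v5 := valid_phi v4.
have := c1; rewrite -{1}E => /(switch_pred v5)[e1' [e0' [w0 [b0 [E1 Ebb En1 _ P0]]]]].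
rewrite E Ed in Ebb; case: Ebb => ? ?; subst e1' e0'.
have [e2' [e1' [e3 [b3 [[Ed2 En2 Ep2 c21 [c23 n13]]]]]]] := switch_succ c2.
rewrite Ep in Ed2; case: Ed2 => ? ? ?; subst e2' e1' b2.
have [e2' [e1' [w1 [b1 [E1' Ebb _ _ P1]]]]] := switch_pred v c2.
rewrite Ep in Ebb; case: Ebb => ? ?; subst e2' e1'.
rewrite Ed in E1'; case: E1' => ? ?; subst w1 b1.
rewrite En2 => Pm Pe; rewrite {}Ep2 in v3 v4 v5 E1 Pm *.
move: v4 v5 E1 Pm; case: (stepP v3) => [e4 b4 c34 n24 _ _|e4 ve4 _ _] v4 v5.
- case: (stepP v4)
     => [? b5 c40 n30 En4 _ [? ? ?] Pm|? ve5 En4 _ [? ? ?] Pm]; subst.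
    have c43 : cr e4 e3 by rewrite cr_sym.
    have [Es|Es] := fan s c40 c43.
      by case: (cr_disj c23 (b := s)); rewrite -Es P1.
    by case: (cr_disj c10 (b := ~~ s)); rewrite Es Pe.
  have Eb : b4 = s by apply: negb_inj.
  by case: n02; apply: (vtx_inj (b := s)) => //; rewrite -Pm -Eb ve5.
- move=> + Eb; subst b3; move: v4 v5; rewrite negbK => v4 v5.
  case: (stepP v4)
     => [? b5 c40 n30 En4 _ [? ? ?]|? ve5 En4 _ [? ? ?]]; subst.
    case: n13; apply: (vtx_inj (b := s)); rewrite ?Pe // -P0.
    by rewrite -[s]negbK ve4.
  by rewrite /uncrossed /= !eqxx En4.
Qed.

(** A discrete intermediate value argument: a corner that does not point to one end of [e] points to
    the other, so along [e] the pointing changes somewhere. If it never did, the last corner would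
    point both ways. *)
Lemma chain_switch s e f0 l :
  nxt (e, None, s) = Some f0 -> toward s e (phi (e, None, s)) ->
  cr e l -> nxt (e, Some l, s) = None ->
  toward (~~ s) e (phi (rev (e, Some l, ~~ s))) ->
  exists2 d, switch s d & d.1.1 = e.
Proof.
move=> En0 P0 cel El Pl.
have [n] := ubnP (remaining cr tau e s f0).
have v0 : valid (e, None, s) by [].
elim: n (None) f0 v0 En0 P0 => // n IHn o f v0 En0 P0 lt.
have cef : cr e f := nxt_cr En0.
have vf : valid (e, Some f, s) by [].
have Er : rev (e, Some f, ~~ s) = (e, o, s).
  by have := nxt_rev v0; rewrite En0 /dart_rev /= negbK => ->.
case E: (nxt (e, Some f, s)) => [g|].
  case PN: (toward (~~ s) e (phi (e, Some f, s))).
    exists (e, Some f, s) => //; rewrite /switch eqxx E Er P0 PN vf.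
    by [].
  have [b' Ep] := phi_cross vf E.
  apply: (IHn (Some f) g) => //.
    by move: PN; rewrite Ep; have /orP[->//|->] := toward_or s b' (nxt_cr E).
  exact: leq_trans (remaining_lt (nxt_beyond E)) _.
have Efl : f = l by apply: (last_uniq cef cel E El).
subst l; rewrite Er in Pl; have [b' Ep] := phi_cross v0 En0.
by rewrite Ep in P0 Pl; case: (toward_excl P0 Pl).
Qed.

(** Two shapes are possible: [e] and [h] leave a common vertex and are both cut off by [f], or [f]
    ends in a vertex that an uncrossed [h] joins to the start of [e]. *)
Lemma tri_first s e f : nxt (e, None, s) = Some f ->
  phi (phi (phi (e, None, s))) = (e, None, s) ->
  exists2 h, vtx h s = vtx e s &
  if nxt (phi (e, None, s)) is Some h' then h' = h /\ nxt (h, None, s) = Some f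
  else (phi (e, None, s)).2 = s /\ phi (phi (e, None, s)) = (h, None, ~~ s) /\
       nxt (h, None, ~~ s) = None.
Proof.
move=> En E3; have v : valid (e, None, s) by [].
have [b' Ep] := phi_cross v En; have v1 := valid_phi v.
rewrite Ep in v1 E3 *; have v2 := valid_phi v1; move: v2 E3.
case: (stepP v1) => [h b'' cfh _ En1 Ep1|h vh En1 Ep1] v2.
  case: (stepP v2) => [? ? _ _ _ _ []//|e' ve' En2 _ [E1 E2]].
  subst e'; rewrite E2 in ve'; exists h => //; split=> //.
  by have := nxt_rev v2; rewrite En2 E2.
case: (stepP v2) => [? ? _ _ _ _ []//|e' ve' En2 _ [E1 E2]].
rewrite negbK in E2; subst e' b'; rewrite negbK in ve'.
by exists h; rewrite ?ve'.
Qed.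

Lemma tri_first_P s e f : nxt (e, None, s) = Some f ->
  phi (phi (phi (e, None, s))) = (e, None, s) -> toward s e (phi (e, None, s)).
Proof.
move=> En E3; have [h vh] := tri_first En E3; rewrite /toward.
by case: nxt => [h' [-> _]|[-> _]]; rewrite ?vh eqxx.
Qed.

Lemma tri_last s e l : cr e l -> nxt (e, Some l, s) = None ->
  phi (phi (phi (e, Some l, s))) = (e, Some l, s) ->
  exists2 h, vtx h (~~ s) = vtx e (~~ s) &
  if nxt (phi (rev (e, Some l, ~~ s))) is Some h' then
    h' = h /\ nxt (h, None, ~~ s) = Some l
  else (phi (rev (e, Some l, ~~ s))).2 = ~~ s /\
    phi (e, Some l, s) = (h, None, ~~ s) /\ nxt (h, None, ~~ s) = None.
Proof.
move=> cel En E3; have v : valid (e, Some l, s) by [].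
have v' : valid (e, Some l, ~~ s) by [].
have vr := rev_valid v'.
have Er : rev (e, Some l, ~~ s) = (e, nxt (e, Some l, ~~ s), s).
  by rewrite /dart_rev /= negbK.
have Enr : nxt (rev (e, Some l, ~~ s)) = Some l.
  by have := nxt_rev v'; rewrite Er negbK.
have [b' Ep] : exists b', phi (rev (e, Some l, ~~ s)) = (l, Some e, b').
  by rewrite Er in vr Enr *; apply: phi_cross.
have := @phi_alt e (nxt (e, Some l, ~~ s)) s l.
rewrite -Er => /(_ vr Enr) Ealt.
have := phi_inj (etrans Ealt (esym E3)); rewrite Ep.
have [h Eh vh] := phi_end v En; rewrite Eh /dart_rev /= => E2; exists h => //.
have v2 : valid (h, None, ~~ s) by [].
move: E2; case: (stepP v2) => [k b2 chk _ Enh _ [E4 E5 _]|k vk Enh _ [E4 E5 E6]].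
  by rewrite E5 -E4.
by rewrite E5; split=> //; apply: negb_inj.
Qed.

Lemma tri_last_P s e l : cr e l -> nxt (e, Some l, s) = None ->
  phi (phi (phi (e, Some l, s))) = (e, Some l, s) ->
  toward (~~ s) e (phi (rev (e, Some l, ~~ s))).
Proof.
move=> cel En E3; have [h vh] := tri_last cel En E3; rewrite /toward.
by case: nxt => [h' [-> _]|[-> _]]; rewrite ?vh eqxx.
Qed.

(** * Inequalities for single faces *)

Definition tri (d : dart) := order phi d == 3.

Lemma order_connect d x : fconnect phi d x -> order phi x = order phi d.
Proof.
move=> c; apply/esym/eq_card => y.
by rewrite !inE /= (same_connect (fconnect_sym phi_inj) c).
Qed.

Lemma orbit_connect d x : fconnect phi d x -> perm_eq (orbit phi x) (orbit phi d).
Proof.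
move=> c; rewrite uniq_perm ?orbit_uniq // => y.
by rewrite -!fconnect_orbit (same_connect (fconnect_sym phi_inj) c).
Qed.

Lemma tri_connect d x : fconnect phi d x -> tri x = tri d.
Proof. by move=> /order_connect E; rewrite /tri E. Qed.

Lemma tri_phi d : tri (phi d) = tri d.
Proof. exact: tri_connect (fconnect1 _ _). Qed.

Lemma tri3 d : tri d -> phi (phi (phi d)) = d.
Proof. by move/eqP=> E; have := iter_order phi_inj d; rewrite E. Qed.

Lemma order_ge3 d : valid d -> 2 < order phi d.
Proof.
move=> v; have := iter_order phi_inj d; have := order_gt0 phi d.
case: (order phi d) => [|[|[|n]]] //= _; first by move/(phi_neq1 v).
by move/(phi_neq2 v).
Qed.

Definition extreme (s : bool) (d : dart) :=
  (d.2 == s) && ((d.1.2 == None) || (nxt d == None)).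

Lemma face_sub_sum (g : dart -> nat) d (I : seq nat) :
  uniq I -> all (fun i => i < order phi d) I ->
  \sum_(i <- I) g (iter i phi d) <= \sum_(x <- orbit phi d) g x.
Proof.
move=> uI aI; rewrite -(big_map (fun i => iter i phi d) xpredT g).
set J := [seq iter i phi d | i <- I].
rewrite [leqRHS](bigID [in J]) /= -[X in X <= _]addn0 leq_add // -[X in _ <= X]big_filter.
have pJ : perm_eq [seq x <- orbit phi d | x \in J] J.
  rewrite uniq_perm //.
  - by rewrite filter_uniq // orbit_uniq.
  - rewrite map_inj_in_uniq // => i j /(allP aI) li /(allP aI) lj E.
    by rewrite -(findex_iter li) E findex_iter.
  move=> x; rewrite mem_filter; case: mapP => //= -[i /(allP aI) li ->].
  by rewrite -fconnect_orbit fconnect_iter.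
by rewrite (perm_big _ pJ).
Qed.

(** A quadrangle has no switch. On a larger face the darts two places away from a switch are none,
    which provides four darts that are not switches, except on a pentagon with two consecutive
    switches; there the uncrossed side of [switch_face5] counts twice. *)
Lemma face_big s d : valid d -> 3 < order phi d ->
  4 <= \sum_(x <- orbit phi d) (~~ switch s x + uncrossed s x).
Proof.
move=> v k4; pose g x : nat := ~~ switch s x + uncrossed s x.
have gN x : ~~ switch s x -> 0 < g x by rewrite /g => ->.
case: (boolP (has (switch s) (orbit phi d))) => [/hasP[x xo cx]|/hasPn nc]; last first.
  rewrite (leq_trans (n := \sum_(x <- orbit phi d) 1)) //.
    by rewrite sum1_size size_orbit.
  by rewrite !big_seq; apply: leq_sum => y /nc/gN.
have cxd : fconnect phi d x by rewrite fconnect_orbit.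
have vx : valid x by have := cx => /switch_valid.
have Eo := order_connect cxd; rewrite -(perm_big _ (orbit_connect cxd)) /=.
rewrite -Eo in k4; have k5 : 4 < order phi x.
  rewrite ltn_neqAle k4 andbT; apply/eqP => E4.
  by apply: (switch_face4 cx); have := iter_order phi_inj x; rewrite -E4.
(* If the predecessor is a switch too, start from it: its own predecessor is two places before
   [x]. *)
clear cxd xo Eo; wlog ncp : x cx vx k4 k5 / ~~ switch s (iter (order phi x).-1 phi x).
  move=> W; set y := iter (order phi x).-1 phi x.
  have Ey : phi y = x by rewrite -iterS orderSpred iter_order.
  case: (boolP (switch s y)) => [cy|ncy]; last exact: W.
  have cxy : fconnect phi x y by rewrite fconnect_iter.
  have Eo := order_connect cxy; rewrite -(perm_big _ (orbit_connect cxy)) /=.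
  apply: W; rewrite ?Eo //; first exact: switch_valid cy.
  apply/negP=> c2; apply: (switch_dist2 c2).
  suff -> : phi (iter (order phi x).-1 phi y) = y by rewrite Ey.
  by rewrite -iterS orderSpred -Eo iter_order.
have d2 : ~~ switch s (phi (phi x)) by apply/negP => /(switch_dist2 cx).
set k := order phi x in k4 k5 ncp *.
have dm2 : ~~ switch s (iter k.-2 phi x).
  apply/negP => /switch_dist2; rewrite -!iterS => W; apply: W.
  by rewrite -/k (_ : k.-2.+2 = k) ?iter_order //; lia.
have sub := @face_sub_sum g x.
case: (boolP (switch s (phi x))) => [c1|nc1]; last first.
  apply: leq_trans (sub [:: 1; 2; k.-2; k.-1] _ _).
  - by rewrite !big_cons big_nil -[4]/(1 + (1 + (1 + (1 + 0)))) !leq_add ?gN.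
  - by rewrite /= !inE; lia.
  by rewrite /= -/k; lia.
have d3 : ~~ switch s (iter 3 phi x) by apply/negP => /(switch_dist2 c1).
have [E5|k6] : k = 5 \/ 5 < k by lia.
  have E := iter_order phi_inj x; rewrite -/k E5 /= in E.
  have u3 := switch_face5 cx c1 E; rewrite E5 /= in ncp.
  apply: leq_trans (sub [:: 2; 3; 4] _ _) => //.
    rewrite !big_cons big_nil -[4]/(1 + (2 + (1 + 0))) !leq_add ?gN //.
    by rewrite /g d3 /= u3.
  by rewrite /= -/k E5.
apply: leq_trans (sub [:: 2; 3; k.-2; k.-1] _ _).
- by rewrite !big_cons big_nil -[4]/(1 + (1 + (1 + (1 + 0)))) !leq_add ?gN.
- by rewrite /= !inE; lia.
by rewrite /= -/k; lia.
Qed.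

Lemma phi_corner d : valid d ->
  ((phi d).1.2 == None) = (nxt d == None) /\ (nxt d = None -> (phi d).2 = ~~ d.2).
Proof. by case: d => -[e o] b v; case: (stepP v). Qed.

(** Three edges cannot cross pairwise: two of them cross the third, so they share an end by [fan]
    and do not cross each other. *)
Lemma tri_vertex d : valid d -> tri d ->
  [|| nxt d == None, nxt (phi d) == None | nxt (phi (phi d)) == None].
Proof.
case: d => -[e o] b v /tri3; have v1 := valid_phi v; have v2 := valid_phi v1.
move: v1 v2; case: (stepP v) => [f b1 cef _ _ _|//] v1 v2.
move: v2; case: (stepP v1) => [g b2 cfg _ _ _|//] v2.
case: (stepP v2) => [h b3 cgh _ _ _ [Eh _ _]|//].
rewrite Eh cr_sym in cgh.
by case: (fan true cef cgh) => E; case: (cr_disj cfg E).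
Qed.

Lemma orbit_tri d : tri d -> orbit phi d = [:: d; phi d; phi (phi d)].
Proof. by move=> /eqP E; rewrite /orbit E. Qed.

(** At each vertex corner exactly one of the two sides has direction [s], and it is extreme. With
    two vertex corners the side between them is uncrossed; if it has direction [~~ s], both other
    sides are extreme in direction [s]. Three vertex corners would make directions alternate around
    an odd cycle. *)
Lemma face_tri s d : valid d -> tri d ->
  4 + \sum_(x <- orbit phi d) uncrossed (~~ s) x <=
  \sum_(x <- orbit phi d) (~~ switch s x + extreme s x).
Proof.
move=> v t; have E3 := tri3 t; rewrite orbit_tri //.
have v1 := valid_phi v; have v2 := valid_phi v1.
have nc : ~~ switch s d by apply/negP => c; apply: (switch_face3 c).
have nc1 : ~~ switch s (phi d) by apply/negP => c; apply: (switch_face3 c); rewrite E3.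
have nc2 : ~~ switch s (phi (phi d)) by apply/negP => c; apply: (switch_face3 c); rewrite E3.
have := tri_vertex v t.
have [] := phi_corner v; have [] := phi_corner v1; have [] := phi_corner v2.
rewrite E3 !big_cons !big_nil nc nc1 nc2 /extreme /uncrossed.
move: (nxt d) (nxt (phi d)) (nxt (phi (phi d))) => n0 n1 n2.
move=> -> D2 -> D1 -> D0.
case: n0 D0 => [?|] D0; case: n1 D1 => [?|] D1; case: n2 D2 => [?|] D2 //= _;
  try have := D0 erefl; try have := D1 erefl; try have := D2 erefl;
  by case: d.2; case: (phi d).2; case: (phi (phi d)).2; case: (s).
Qed.

Definition faces := #|[pred r | froots phi r && valid r]|.

(** What [face_tri] and [face_big] count at a dart in addition to its not being a switch. *)
Definition gain s d := if tri d then extreme s d else uncrossed s d.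

Lemma faces_bound s :
  4 * faces + #|[pred d | valid d && (tri d && uncrossed (~~ s) d)]| + #|[pred d | switch s d]|
  <= #|[pred d | valid d]| + #|[pred d | valid d && gain s d]|.
Proof.
have cE (Q : pred dart) : #|[pred d | valid d && Q d]| = \sum_(d | valid d) Q d.
  by rewrite -sum1_card big_mkcondr; apply: eq_bigr => d _; case: (Q d).
have -> : #|[pred d | switch s d]| = \sum_(d | valid d) switch s d.
  rewrite -cE; apply: eq_card => d; rewrite !inE.
  by case: (boolP (switch s d)) => [/switch_valid->|]; rewrite ?andbF.
rewrite !cE; apply: (@leq_trans (\sum_(d | valid d) (~~ switch s d + gain s d) +
  \sum_(d | valid d) switch s d)); last first.
  rewrite big_split /= addnAC leq_add2r -sum1_card -big_split.
  by apply: leq_sum => d _; case: switch.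
rewrite leq_add2r !(sum_orbits _ phi_inj phi_valid) /faces -sum1_card big_distrr -big_split /=.
apply: leq_sum => r /andP[_ vr]; rewrite muln1.
have [t|nt] := boolP (tri r).
  apply: leq_trans _ (leq_trans (face_tri s vr t) _).
    rewrite leq_add2l !big_seq; apply: leq_sum => x.
    by rewrite -fconnect_orbit => /tri_connect ->; rewrite t.
  by rewrite !big_seq; apply: leq_sum => x;
    rewrite -fconnect_orbit /gain => /tri_connect ->; rewrite t.
rewrite big_seq big1 ?addn0; last first.
  by move=> x; rewrite -fconnect_orbit => /tri_connect ->; rewrite (negPf nt).
apply: leq_trans (face_big s vr _) _.
  by rewrite ltn_neqAle eq_sym nt order_ge3.
by rewrite !big_seq; apply: leq_sum => x;
  rewrite -fconnect_orbit /gain => /tri_connect ->; rewrite (negPf nt).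
Qed.

(** * Discharging along the edges *)

Definition at_edge (e : Eg) (Q : pred dart) := #|[pred d | Q d && (d.1.1 == e)]|.

Lemma sum_at_edge (Q : pred dart) : #|Q| = \sum_e at_edge e Q.
Proof.
rewrite -sum1_card (partition_big (fun d : dart => d.1.1) xpredT) //=.
by apply: eq_bigr => e _; rewrite /at_edge -sum1_card; apply: eq_bigl => d; rewrite !inE.
Qed.

Definition cost s := [pred d | valid d && gain s d].
Definition credit s := [pred d | valid d && (tri d && uncrossed (~~ s) d)].

(* What the face inequalities leave unspent at e; truncation is harmless by cost_le. *)
Definition excess s e :=
  1 + at_edge e (switch s) + at_edge e (credit s) - at_edge e (cost s).

Lemma at_edge_gt0 e (Q : pred dart) d : Q d -> d.1.1 = e -> 0 < at_edge e Q.
Proof. by move=> Qd Ee; apply/card_gt0P; exists d; rewrite !inE Qd Ee eqxx. Qed.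

Lemma at_edge_le e (Q : pred dart) (l : seq dart) :
  (forall d, Q d -> d.1.1 = e -> d \in l) -> at_edge e Q <= size l.
Proof.
move=> Ql; apply: leq_trans (card_size l); apply: subset_leq_card.
by apply/fintype.subsetP => d; rewrite !inE => /andP[Qd /eqP Ee]; apply: Ql.
Qed.

Lemma cost_uncrossed s e : nxt (e, None, s) = None -> at_edge e (cost s) <= 1.
Proof.
move=> En; apply: (@at_edge_le e (cost s) [:: (e, None, s)]) => -[[e' o] b].
have ne f : cr e f = false by apply: (nxt_None_cr f En).
rewrite inE => /andP[v g] /= Ee; subst e'.
have -> : o = None by case: o v {g} => // f; rewrite /valid /= ne.
by move: g; rewrite /gain /extreme /uncrossed; case: tri => /andP[/eqP /= -> _]; rewrite ?inE eqxx.
Qed.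

Lemma cost_split s e f : nxt (e, None, s) = Some f ->
  exists l, [/\ cr e l, nxt (e, Some l, s) = None &
    forall d, cost s d -> d.1.1 = e -> tri d /\ (d = (e, None, s) \/ d = (e, Some l, s))].
Proof.
move=> En; have cef : cr e f := nxt_cr En.
have [l cel El] : exists2 l, cr e l & nxt (e, Some l, s) = None.
  have v : valid (e, None, ~~ s) by [].
  have := nxt_rev v; rewrite negbK; have := rev_valid v; rewrite /dart_rev /valid /=.
  case E: (nxt (e, None, ~~ s)) => [l|] cel El; first by exists l.
  by rewrite El in En.
exists l; split=> // -[[e' o] b] /andP[v g] /= Ee; subst e'.
move: g; rewrite /gain /extreme /uncrossed; case: tri => /andP[/eqP /= Eb]; subst b.
  case: o v => [h|] v; last by split=> //; left.
  move=> /orP[//|/eqP nh]; split=> //; right.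
  by rewrite (last_uniq (b := s) cel v El nh).
by case/andP=> /eqP -> /eqP; rewrite En.
Qed.

(** An uncrossed edge costs at most 1. On a crossed edge only the first and the last piece can cost,
    each only on a triangle; if both do, [chain_switch] pays for the second. *)
Lemma cost_le s e : at_edge e (cost s) <= 1 + at_edge e (switch s) + at_edge e (credit s).
Proof.
case En: (nxt (e, None, s)) => [f|]; last first.
  by rewrite (leq_trans (cost_uncrossed En)) // -addnA leq_addr.
have [l [cel El cl]] := cost_split En.
have [t1|/negP t1] := boolP (tri (e, None, s)); last first.
  rewrite (leq_trans (n := 1)) // -?addnA ?leq_addr //.
  apply: (@at_edge_le e (cost s) [:: (e, Some l, s)]) => d cd de.
  by have [td [E|->]] := cl d cd de; rewrite ?inE //; rewrite E in td.
have [t2|/negP t2] := boolP (tri (e, Some l, s)); last first.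
  rewrite (leq_trans (n := 1)) // -?addnA ?leq_addr //.
  apply: (@at_edge_le e (cost s) [:: (e, None, s)]) => d cd de.
  by have [td [->|E]] := cl d cd de; rewrite ?inE //; rewrite E in td.
have [d cd de] := chain_switch En (tri_first_P En (tri3 t1)) cel El (tri_last_P cel El (tri3 t2)).
rewrite (leq_trans (n := 2)) //.
  apply: (@at_edge_le e (cost s) [:: (e, None, s); (e, Some l, s)]) => d' cd' de'.
  by have [_ [->|->]] := cl d' cd' de'; rewrite !inE eqxx ?orbT.
rewrite (leq_trans (n := 1 + at_edge e (switch s))) ?leq_addr //.
by rewrite ltnS (at_edge_gt0 cd de).
Qed.

(** The constant 1 already covers the cost of an uncrossed edge, so the credit of its reverse is
    left over. *)
Lemma excess_uncrossed s e : nxt (e, None, s) = None -> tri (e, None, ~~ s) -> 0 < excess s e.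
Proof.
move=> En t; have := cost_uncrossed En; rewrite /excess.
have := @at_edge_gt0 e (credit s) (e, None, ~~ s).
rewrite /= t /uncrossed /= !eqxx (nxt_None_neg En) => /(_ isT erefl).
by lia.
Qed.

(** The first piece costs nothing. If the last one does, there is still a switch to pay for it,
    since [chain_switch] asks only for the pointing of the first corner and not for a triangle. *)
Lemma excess_first s e f : nxt (e, None, s) = Some f -> toward s e (phi (e, None, s)) ->
  ~~ tri (e, None, s) -> 0 < excess s e.
Proof.
move=> En Pf t1; have [l [cel El cl]] := cost_split En.
have c1 : at_edge e (cost s) <= tri (e, Some l, s).
  case: (boolP (tri (e, Some l, s))) => [t2|nt2].
    apply: (@at_edge_le e (cost s) [:: (e, Some l, s)]) => d cd de.
    by have [td [E|->]] := cl d cd de; rewrite ?inE //; rewrite E (negPf t1) in td.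
  apply: (@at_edge_le e (cost s) [::]) => d cd de.
  by have [td [E|E]] := cl d cd de; rewrite E ?(negPf t1) ?(negPf nt2) in td.
rewrite /excess; case: (boolP (tri (e, Some l, s))) c1 => [t2|nt2] c1; last by lia.
have [d cd de] := chain_switch En Pf cel El (tri_last_P cel El (tri3 t2)).
by have := at_edge_gt0 cd de; lia.
Qed.

Lemma excess_last s e l : cr e l -> nxt (e, Some l, s) = None ->
  toward (~~ s) e (phi (rev (e, Some l, ~~ s))) ->
  ~~ tri (e, Some l, s) -> 0 < excess s e.
Proof.
move=> cel El Pl t1; case En: (nxt (e, None, s)) => [f|]; last first.
  by rewrite (nxt_None_cr l En) in cel.
have [l' [cel' El' cl]] := cost_split En.
have ? : l' = l by apply: (last_uniq cel' cel El' El).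
subst l'.
have c1 : at_edge e (cost s) <= tri (e, None, s).
  case: (boolP (tri (e, None, s))) => [t2|nt2].
    apply: (@at_edge_le e (cost s) [:: (e, None, s)]) => d cd de.
    by have [td [->|E]] := cl d cd de; rewrite ?inE //; rewrite E (negPf t1) in td.
  apply: (@at_edge_le e (cost s) [::]) => d cd de.
  by have [td [E|E]] := cl d cd de; rewrite E ?(negPf t1) ?(negPf nt2) in td.
rewrite /excess; case: (boolP (tri (e, None, s))) c1 => [t2|nt2] c1; last by lia.
have [d cd de] := chain_switch En (tri_first_P En (tri3 t2)) cel El Pl.
by have := at_edge_gt0 cd de; lia.
Qed.

Lemma faces_excess s :
  4 * faces + \sum_e excess s e <= #|[pred d | valid d]| + #|Eg|.
Proof.
have := faces_bound s; rewrite -/(cost s) -/(credit s).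
rewrite (sum_at_edge (cost s)) (sum_at_edge (credit s)) (sum_at_edge (switch s)).
have : \sum_e excess s e + \sum_e at_edge e (cost s) =
    #|Eg| + \sum_e at_edge e (switch s) + \sum_e at_edge e (credit s).
  rewrite -sum1_card -!big_split; apply: eq_bigr => e _.
  by rewrite /= /excess subnK ?cost_le.
by move: (\sum_e _) (\sum_e _) (\sum_e _) (\sum_e _) #|_| #|_| => a b c d p q; lia.
Qed.

(** * Triangles and their vertex corners *)

Definition apex b := [pred d | [&& valid d, tri d, d.1.2 == None, d.2 == b,
  nxt d != None & nxt (phi d) != None]].

Definition whole b := [pred d | [&& valid d, tri d, d.1.2 == None, d.2 == b &
  nxt d == None]].

(** Two edges crossing [g] end in the apex, hence by [fan] all of them do. Beyond the last one that
    [g] cuts off first, no triangle of this shape can follow. The face there is no triangle, and [x]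
    has slack, or it is closed by an uncrossed edge at the apex, which has slack itself. *)
Lemma apex_excess b d : apex b d ->
  exists2 x, vtx x b = vtx d.1.1 b & (0 < excess b x) || (0 < excess (~~ b) x).
Proof.
case: d => -[e o] b0 /and5P[v t /eqP /= Eo /eqP /= Eb]; subst o b0.
case En: (nxt (e, None, b)) => [g|//] /= nl.
have [h vh] := tri_first En (tri3 t).
case El: (nxt (phi (e, None, b))) nl => [h'|//] _ [? Eh]; subst h'.
have neh : e <> h.
  move=> E; have [b' Ep] := phi_cross v En; rewrite Ep E in El.
  by case: (nxt_neq El).
have hv k : cr g k -> vtx k b = vtx e b.
  move=> cgk; have cge : cr g e by rewrite cr_sym (nxt_cr En).
  have cgh : cr g h by rewrite cr_sym (nxt_cr Eh).
  have [->//|E1] := fan b cgk cge; have [->//|E2] := fan b cgk cgh.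
  by case: neh; apply: (vtx_inj (b := b)); rewrite -?E1.
(* Among the edges at the apex whose first crossing is with g, the one crossing g last. *)
pose M := [pred x | (vtx x b == vtx e b) && (nxt (x, None, b) == Some g)].
have Me : M e by rewrite /= En !eqxx.
case: (arg_minnP (remaining cr tau g b) Me) => x /andP[/eqP vx /eqP Ex] xmin.
have noM k l b' : nxt (g, Some x, b') = Some l -> b' = b -> l = k ->
    vtx k b = vtx x b -> nxt (k, None, b) = Some g -> False.
  move=> /nxt_beyond E ? ? vk Ek; subst l b'.
  have := xmin k; rewrite /= vk vx Ek !eqxx => /(_ isT).
  by rewrite leqNgt (remaining_lt E).
have cxg : cr x g := nxt_cr Ex.
have vx0 : valid (x, None, b) by [].
have Pl : toward b x (g, Some x, b).
  rewrite /toward; case E: nxt => [k|] //=.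
  by rewrite vx (hv k (nxt_cr E)).
have [b' Ep] := phi_cross vx0 Ex.
(* The sense of the turn decides whether the face beyond [x] contains the first piece of [x] in
   direction [b] or the last one in direction [~~ b]. *)
have [Eb|Eb] : b' = b \/ b' = ~~ b by case: (b) (b') => -[]; auto.
  subst b'; have [tx|ntx] := boolP (tri (x, None, b)); last first.
    by exists x => //; rewrite (excess_first Ex) ?Ep.
  have [k vk] := tri_first Ex (tri3 tx); rewrite Ep.
  case E: nxt => [l|] [Elk Ek]; first by case: (noM _ _ _ E erefl Elk vk Ek).
  case: Ek => Ek nk; exists k; first by rewrite vk.
  rewrite excess_uncrossed //; last by rewrite -Ek -Ep !tri_phi.
  by rewrite -[b]negbK nxt_None_neg.
subst b'; have nl : nxt (x, Some g, ~~ b) = None by have := nxt_rev vx0; rewrite Ex.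
have vg : valid (x, Some g, b) by [].
have vr := rev_valid vg.
have Ep2 : phi (rev (x, Some g, ~~ ~~ b)) = (g, Some x, b).
  have := nxt_rev vg; rewrite negbK; move: vr; rewrite /dart_rev /= => vr Enr.
  have [b2 E2] := phi_cross vr Enr; rewrite E2.
  have [->//|Eb2] : b2 = b \/ b2 = ~~ b by case: (b) (b2) => -[]; auto.
  by move: E2; rewrite Eb2 -Ep => /phi_inj[_]; case: (b).
have [tx|ntx] := boolP (tri (x, Some g, ~~ b)); last first.
  by exists x => //; rewrite (excess_last cxg nl _ ntx) ?orbT // Ep2 negbK.
have [k] := tri_last cxg nl (tri3 tx); rewrite Ep2 negbK => vk.
case E: nxt => [l|] [Elk Ek]; first by case: (noM _ _ _ E erefl Elk vk Ek).
case: Ek => Ek nk; exists k; first by rewrite vk.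
rewrite (excess_uncrossed (s := ~~ b)) ?orbT ?nxt_None_neg //.
by rewrite negbK -Ek tri_phi.
Qed.

Lemma tri_has d : valid d -> tri d ->
  has (fun x => [|| apex true x, apex false x, whole true x | whole false x])
    (orbit phi d).
Proof.
move=> v t.
suff W x : valid x -> tri x -> nxt x = None -> fconnect phi d x ->
    exists2 y, [|| apex true y, apex false y, whole true y | whole false y] &
      y \in orbit phi d.
  have v1 := valid_phi v; have v2 := valid_phi v1.
  apply/hasP; suff [y y1 y2] : exists2 y,
     [|| apex true y, apex false y, whole true y | whole false y] &
      y \in orbit phi d by exists y.
  have c0 := connect0 (frel phi) d; have c1 := fconnect1 phi d.
  have c2 := fconnect_iter phi 2 d; rewrite /= in c2.
  case/or3P: (tri_vertex v t) => /eqP E; first exact: (W d).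
    by apply: (W (phi d)); rewrite ?tri_phi.
  by apply: (W (phi (phi d))); rewrite ?tri_phi.
move=> vx tx En cx; have v1 := valid_phi vx; have v2 := valid_phi v1.
have w1 : (phi x).1.2 = None by have [E _] := phi_corner vx; apply/eqP; rewrite E En.
have cy k : fconnect phi d (iter k phi x).
  exact: connect_trans cx (fconnect_iter _ _ _).
case E1: (nxt (phi x)) => [f|]; last first.
  exists (phi x); last by rewrite -fconnect_orbit (cy 1).
  by rewrite /apex /whole /= v1 tri_phi tx w1 E1 /=; case: (phi x).2.
case E2: (nxt (phi (phi x))) => [g|].
  exists (phi x); last by rewrite -fconnect_orbit (cy 1).
  by rewrite /apex /whole /= v1 tri_phi tx w1 E1 E2 /=; case: (phi x).2.
have o3 : x.1.2 = None.
  by have [E _] := phi_corner v2; apply/eqP; rewrite -(tri3 tx) E E2.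
exists x; last by rewrite -fconnect_orbit.
by rewrite /apex /whole /= vx tx o3 En /=; case: x.2.
Qed.

(** * The bound on the number of edges *)

Lemma card_valid :
  #|[pred d | valid d]| = 2 * #|Eg| + 2 * #|[pred p : Eg * Eg | cr p.1 p.2]|.
Proof.
have -> : #|[pred d | valid d]| = \sum_(b : bool) \sum_(x : Eg * option Eg) valid (x, b).
  rewrite -sum1_card (exchange_big) /= pair_big /= big_mkcond /=.
  by apply: eq_bigr => -[x b] _; rewrite inE; case: valid.
rewrite (eq_bigr (fun=> #|Eg| + #|[pred p : Eg * Eg | cr p.1 p.2]|)); last first.
  move=> b _; rewrite -(pair_big xpredT xpredT (fun e o => nat_of_bool (valid (e, o, b)))) /=.
  rewrite -!sum1_card [X in _ + X](eq_bigl (fun p => true && cr p.1 p.2)); last first.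
    by move=> p; rewrite !inE.
  rewrite -(pair_big_dep xpredT (fun e f => cr e f) (fun _ _ => 1)) /= -big_split.
  apply: eq_bigr => e _ /=; rewrite (bigD1 None) //=; congr (_ + _).
  rewrite [RHS]big_mkcond /= (reindex_omap Some id) /=; last by case.
  by apply: eq_big => // f; rewrite eqxx.
by rewrite sum_nat_const card_bool; lia.
Qed.

(** Twice the Euler inequality of the planarization: there are two darts to a piece and two ordered
    pairs to a crossing. *)
Hypothesis euler : #|[pred d | valid d]| + 4 <=
  2 * faces + 2 * #|V| + #|[pred p : Eg * Eg | cr p.1 p.2]|.

Lemma excess_sum_le s : #|Eg| + 8 + \sum_e excess s e <= 4 * #|V|.
Proof.
have := faces_excess s; have := euler; rewrite card_valid.
by move: (\sum_e _) #|_| #|_| #|_| faces => a b c d p; lia.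
Qed.

Lemma tri_count : 4 * faces <= #|[pred d | valid d]| +
  (\sum_b #|apex b| + \sum_b #|whole b|).
Proof.
pose Z x := [|| apex true x, apex false x, whole true x | whole false x].
have leZ : \sum_(d | valid d) Z d <= \sum_b #|apex b| + \sum_b #|whole b|.
  have cE (Q : pred dart) : #|Q| = \sum_x Q x.
    rewrite -sum1_card big_mkcond; apply: eq_bigr => x _.
    by rewrite -[x \in Q]/(Q x); case: (Q x).
  rewrite !big_bool !cE big_mkcond -!big_split.
  apply: leq_sum => x _; rewrite /Z; cbv beta.
  by move: (apex true x) (apex false x) (whole true x) (whole false x) (valid x) => [] [] [] [] [].
apply: leq_trans (leq_add (leqnn _) leZ).
rewrite -sum1_card !(sum_orbits _ phi_inj phi_valid) -big_split /faces -sum1_card big_distrr /=.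
apply: leq_sum => r /andP[_ vr]; rewrite muln1 sum1_size size_orbit.
have := order_ge3 vr; have [t|nt] := boolP (tri r); last first.
  by move: nt; rewrite /tri; lia.
have /hasP[x xo Zx] := tri_has vr t.
rewrite (eqP t) => _; rewrite (big_rem x xo) /= /Z Zx.
by rewrite addnA leq_addr.
Qed.

Lemma whole_le b : #|whole b| <= \sum_e excess (~~ b) e.
Proof.
rewrite sum_at_edge; apply: leq_sum => e _.
have [->//|] := posnP (at_edge e (whole b)).
move=> /card_gt0P[[[e' o] b']]; rewrite inE => /andP[/and5P[v t]] /=.
move=> /eqP Eo /eqP Eb /eqP En /eqP Ee; subst e' o b'.
apply: leq_trans (@at_edge_le e (whole b) [:: (e, None, b)] _) _.
  move=> [[e' o] b'] /and5P[_ _ /eqP /= -> /eqP /= -> _] /= ->.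
  by rewrite inE.
by rewrite (@excess_uncrossed (~~ b)) ?nxt_None_neg ?negbK.
Qed.

Definition ends b := [set vtx e b | e : Eg].

(** Every apex lies on an edge with slack, so the total slack bounds the number of apices; at a
    given apex the dart is determined by the other end of its edge. *)
Lemma apex_le b : #|apex b| <= (\sum_e excess b e + \sum_e excess (~~ b) e) * #|ends (~~ b)|.
Proof.
pose W := [set v | [exists d, apex b d && (vtx d.1.1 b == v)]].
have leW : #|W| <= \sum_e excess b e + \sum_e excess (~~ b) e.
  pose U := [pred e | (0 < excess b e) || (0 < excess (~~ b) e)].
  apply: (@leq_trans #|[set vtx e b | e in U]|).
    apply/subset_leq_card/fintype.subsetP => v; rewrite inE => /existsP[d /andP[ad /eqP <-]].
    have [x <- Ux] := apex_excess ad; exact: imset_f.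
  apply: leq_trans (leq_imset_card _ _) _; rewrite -sum1_card -big_split big_mkcond /=.
  by apply: leq_sum => e _; rewrite inE; case: ifP; lia.
apply: leq_trans (leq_mul leW (leqnn _)); rewrite -cardsX.
have inj : {in apex b &, injective (fun d : dart => (vtx d.1.1 b, vtx d.1.1 (~~ b)))}.
  move=> [[e o] c] [[e' o'] c'] /and5P[_ _ /eqP /= -> /eqP /= -> _].
  move=> /and5P[_ _ /eqP /= -> /eqP /= -> _] [E1 E2].
  by rewrite (vtx_inj E1 E2).
rewrite -(card_in_imset inj); apply/subset_leq_card/fintype.subsetP => p /imsetP[d ad ->].
rewrite inE /=; apply/andP; split; last exact: imset_f.
by rewrite inE; apply/existsP; exists d; rewrite eqxx andbT.
Qed.

Theorem edge_bound : 3 <= #|V| -> #|Eg| + 10 <= 4 * #|V|.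
Proof.
move=> n3; rewrite leqNgt; apply/negP => lt.
have Ut := excess_sum_le true; have Uf := excess_sum_le false.
have tc := tri_count; rewrite !big_bool /= in tc.
have wt := whole_le true; have wf := whole_le false; rewrite /= in wt wf.
have at_ := apex_le true; have af := apex_le false; rewrite /= in at_ af.
have disj : #|ends true| + #|ends false| <= #|V|.
  rewrite -cardsUI (_ : ends true :&: ends false = finset.set0) ?cards0 ?addn0 ?max_card //.
  apply/setP => v; rewrite !inE; apply/negP => /andP[/imsetP[e _ ->] /imsetP[f _]].
  exact: vtx_col.
have eprod : #|Eg| <= #|ends true| * #|ends false|.
  rewrite -cardsX -(card_imset (f := fun e => (vtx e true, vtx e false))).
    apply/subset_leq_card/fintype.subsetP => p /imsetP[e _ ->].
    by rewrite inE /= !imset_f.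
  by move=> e f [E1 E2]; apply: (vtx_inj E1 E2).
have eu := euler; rewrite card_valid in tc eu.
set ut := \sum_e excess true e in Ut wf at_ af; set uf := \sum_e excess false e in Uf wt at_ af.
have ut1 : ut <= 1 by lia.
have uf1 : uf <= 1 by lia.
have at2 : #|apex true| <= 2 * #|ends false|.
  by apply: leq_trans at_ _; rewrite leq_mul2r; lia.
have af2 : #|apex false| <= 2 * #|ends true|.
  by apply: leq_trans af _; rewrite leq_mul2r; lia.
move: #|ends true| #|ends false| at2 af2 disj eprod => p q at2 af2 disj eprod.
(* Here [tri_count] gives [4F <= #darts + 2(p + q) + 2], and with [euler] this yields
   [#|Eg| + 3 <= 3 * #|V|]; against [#|Eg| >= 4 * #|V| - 9] only [#|V| <= 6] is left. *)
have [p6 q6] : p <= 6 /\ q <= 6 by lia.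
have pq : p + q <= 6 by lia.
have : p * q <= 9.
  move: p6 q6 pq {at2 af2 disj eprod}.
  by case: p => [|[|[|[|[|[|[|p]]]]]]] // _; case: q => [|[|[|[|[|[|[|q]]]]]]].
move: p6 q6 pq eprod disj {at2 af2}.
by case: p => [|[|[|[|[|[|[|p]]]]]]] // _; case: q => [|[|[|[|[|[|[|q]]]]]]] // _; lia.
Qed.
End Counting.

(** * The Euler inequality *)

Section EulerRank.
Import GRing.Theory.
Local Open Scope ring_scope.

Lemma addb_F2 (a b : bool) : (a (+) b)%:R = a%:R + b%:R :> 'F_2.
Proof. by case: a; case: b; apply/eqP. Qed.

Lemma F2_bool (x : 'F_2) : (x != 0)%:R = x.
Proof. by case: x => -[|[|m]] i //; apply: val_inj. Qed.

(** The rows of the incidence matrix [B] of pieces and nodes sum to 0, and so do the columns of the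
    matrix [M] of faces and pieces, so [B] has rank below [#|N|] and [M] below [#|O|]. The
    hypothesis puts the kernel of [B] inside the row space of [M], whence
    [#|S| - \rank B <= \rank M]. *)
Lemma euler_rank (S N O : finType) (t h : S -> N) (l r : S -> O) (n0 : N) (o0 : O) :
  (forall c : S -> bool,
     (forall z, \big[addb/false]_s (c s && ((t s == z) (+) (h s == z))) = false) ->
     exists f : O -> bool, forall s, c s = f (l s) (+) f (r s)) ->
  (#|S| + 2 <= #|O| + #|N|)%N.
Proof.
move=> H.
pose B : 'M['F_2]_(#|S|, #|N|) := \matrix_(i, j)
  ((t (enum_val i) == enum_val j)%:R + (h (enum_val i) == enum_val j)%:R).
pose M : 'M['F_2]_(#|O|, #|S|) := \matrix_(i, j)
  ((l (enum_val j) == enum_val i)%:R + (r (enum_val j) == enum_val i)%:R).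
have sum1 (T : finType) (x : T) : \sum_(i < #|T|) (x == enum_val i)%:R = 1 :> 'F_2.
  rewrite (bigD1 (enum_rank x)) //= enum_rankK eqxx big1 ?addr0 // => i ni.
  by case: (x =P _) => // E; rewrite E enum_valK eqxx in ni.
have two0 : 1 + 1 = 0 :> 'F_2 by apply/eqP.
have rkB : (\rank B + 1 <= #|N|)%N.
  have B0 : B *m (const_mx 1 : 'cV_#|N|) = 0.
    apply/matrixP => i j; rewrite !mxE.
    under eq_bigr => k _ do rewrite !mxE mulr1.
    by rewrite big_split /= !sum1 two0.
  have := mulmx0_rank_max B0; apply: leq_trans; rewrite leq_add2l lt0n mxrank_eq0.
  apply/eqP => /matrixP/(_ (enum_rank n0) 0); rewrite !mxE => /eqP.
  by rewrite oner_eq0.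
have rkM : (1 + \rank M <= #|O|)%N.
  have M0 : (const_mx 1 : 'rV_#|O|) *m M = 0.
    apply/matrixP => i j; rewrite !mxE.
    under eq_bigr => k _ do rewrite !mxE mul1r.
    by rewrite big_split /= !sum1 two0.
  have := mulmx0_rank_max M0; apply: leq_trans; rewrite leq_add2r lt0n mxrank_eq0.
  apply/eqP => /matrixP/(_ 0 (enum_rank o0)); rewrite !mxE => /eqP.
  by rewrite oner_eq0.
suff : (kermx B <= M)%MS.
  move/mxrankS; rewrite mxrank_ker => le.
  rewrite -(leq_add2r (\rank B)) in le.
  have rB := rank_leq_row B; rewrite subnK // in le.
  apply: leq_trans (leq_add rkM rkB).
  by rewrite add1n addn1 addSn addnS ltnS addn1 addnS ltnS.
apply/row_subP => i; set u := row i (kermx B).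
have uB : u *m B = 0 by apply/eqP; rewrite -sub_kermx row_sub.
have [|f Ef] := H (fun s => u 0 (enum_rank s) != 0).
  move=> z; have /matrixP/(_ 0 (enum_rank z)) := uB; rewrite !mxE => E.
  have F2inj : injective (fun b : bool => b%:R : 'F_2) by move=> [] [].
  apply: F2inj; rewrite -[RHS]E (big_morph _ addb_F2 (erefl _)) big_enum_val /=.
  apply: eq_bigr => j _; rewrite enum_valK -mulnb natrM F2_bool addb_F2.
  by congr (_ * _); rewrite /B mxE enum_rankK.
apply/submxP; exists (\row_j (f (enum_val j))%:R); apply/matrixP => k j.
rewrite (ord1 k) [RHS]mxE -[LHS]F2_bool; have := Ef (enum_val j).
rewrite enum_valK => ->; rewrite addb_F2.
have pick (x : O) : \sum_(i < #|O|) (f (enum_val i))%:R * (x == enum_val i)%:R = (f x)%:R :> 'F_2.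
  rewrite (bigD1 (enum_rank x)) //= enum_rankK eqxx mulr1 big1 ?addr0 // => i' ni.
  case: eqP => [E|]; rewrite ?mulr0 //; by rewrite E enum_valK eqxx in ni.
under eq_bigr => k' _ do rewrite !mxE mulrDr.
by rewrite big_split /= !pick.
Qed.

End EulerRank.

(* sigma rotates the darts around the nodes.  A crossing is kept in cr2 only if the two edges
   alternate around it: the others are touchings, where each edge makes a bend. *)
Section Alternation.
Variables (V Eg : finType) (vtx : Eg -> bool -> V).
Variables (cr : rel Eg) (tau : Eg -> Eg -> nat).
Hypothesis cr_sym : symmetric cr.
Hypothesis cr_irr : irreflexive cr.
Hypothesis tau_inj : forall e f g, cr e f -> cr e g -> tau e f = tau e g -> f = g.
Hypothesis vtx_col : forall e f b, vtx e b <> vtx f (~~ b).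

Local Notation dart := (dart Eg).
Local Notation rev1 := (dart_rev cr tau).
Local Notation nxt1 := (nxt cr tau).
Local Notation valid1 := (@valid Eg cr).

Definition same_node (d d' : dart) : bool :=
  match d.1.2, d'.1.2 with
  | None, None => (d.2 == d'.2) && (vtx d.1.1 d.2 == vtx d'.1.1 d'.2)
  | Some f, Some f' => (d.1.1 == d'.1.1) && (f == f') || (d.1.1 == f') && (f == d'.1.1)
  | _, _ => false
  end.

Variable sigma : dart -> dart.
Hypothesis sigma_inj : injective sigma.
Hypothesis sigma_node : forall d d', valid1 d ->
  fconnect sigma d d' = valid1 d' && same_node d d'.

Definition quad (e f : Eg) : seq dart :=
  [:: (e, Some f, true); (e, Some f, false); (f, Some e, true); (f, Some e, false)].

Lemma quad_uniq e f : cr e f -> uniq (quad e f).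
Proof.
move=> c; have nef : (e == f) = false.
  by apply/negP => /eqP E; rewrite E cr_irr in c.
by rewrite /= !inE !xpair_eqE nef !andbF.
Qed.

Lemma mem_quad e f b d : cr e f ->
  valid1 d && same_node (e, Some f, b) d = (d \in quad e f).
Proof.
move=> c; case: d => -[e' [f'|]] b'; last by rewrite !inE !xpair_eqE !andbF.
rewrite /same_node /= !inE !xpair_eqE /= !(inj_eq Some_inj).
rewrite /valid /=; apply/andP/idP => [[_]|].
  by case/orP=> /andP[/eqP -> /eqP ->]; rewrite !eqxx; case: b'; rewrite ?orbT.
by case/or4P=> /andP[/andP[/eqP -> /eqP [->]] _]; rewrite ?c ?(cr_sym f) ?c !eqxx ?orbT.
Qed.

Lemma orbit_quad e f b : cr e f -> perm_eq (orbit sigma (e, Some f, b)) (quad e f).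
Proof.
move=> c; rewrite uniq_perm ?orbit_uniq ?quad_uniq // => d.
by rewrite -fconnect_orbit sigma_node // mem_quad.
Qed.

Lemma order_quad e f b : cr e f -> order sigma (e, Some f, b) = 4.
Proof. by move=> c; rewrite -size_orbit (perm_size (orbit_quad b c)). Qed.

Lemma sigma4 e f b : cr e f ->
  sigma (sigma (sigma (sigma (e, Some f, b)))) = (e, Some f, b).
Proof. by move=> c; have := iter_order sigma_inj (e, Some f, b); rewrite order_quad. Qed.

Lemma quad_spec e f b d : cr e f -> d \in quad e f ->
  let x := (e, Some f, b) in
  [\/ d = x, d = sigma x, d = sigma (sigma x) | d = sigma (sigma (sigma x))].
Proof.
move=> c; rewrite -(perm_mem (orbit_quad b c)) /orbit order_quad // !inE.
by case/or4P=> /eqP ->; [constructor 1|constructor 2|constructor 3|constructor 4].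
Qed.

Lemma orbit_quadE e f b : cr e f -> let x := (e, Some f, b) in
  perm_eq [:: x; sigma x; sigma (sigma x); sigma (sigma (sigma x))] (quad e f).
Proof. by move=> c /=; have := orbit_quad b c; rewrite /orbit order_quad. Qed.

(** In a cyclic order of four darts, two edges alternate exactly when the darts of one of them are
    opposite. *)
Definition alt e f := sigma (sigma (e, Some f, true)) == (e, Some f, false).

Definition cr2 e f := cr e f && alt e f.

Lemma cr2W e f : cr2 e f -> cr e f. Proof. by case/andP. Qed.

Lemma alt_bool e f b : cr2 e f -> sigma (sigma (e, Some f, b)) = (e, Some f, ~~ b).
Proof.
case/andP=> c /eqP a; case: b => //; rewrite -a.
exact: sigma4.
Qed.

Lemma alt_turn e f b : cr2 e f -> exists b', sigma (e, Some f, b) = (f, Some e, b').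
Proof.
move=> c2; have c := cr2W c2; have := perm_uniq (orbit_quadE b c).
have : sigma (e, Some f, b) \in quad e f.
  by rewrite -(perm_mem (orbit_quadE b c)) !inE eqxx orbT.
rewrite quad_uniq // (alt_bool b c2) !inE /=.
case/or4P=> /eqP ->; do ?[by exists true|by exists false];
  by case: (b); rewrite !inE !eqxx ?orbT ?andbF.
Qed.

Lemma cr2_sym : symmetric cr2.
Proof.
suff W e f : cr2 e f -> cr2 f e by move=> e f; apply/idP/idP; apply: W.
move=> c2; rewrite /cr2 cr_sym cr2W //= /alt.
have [b Eb] := alt_turn true c2; have [b' Eb'] := alt_turn false c2.
have E1 := sigma4 true (cr2W c2); have A1 := alt_bool true c2.
rewrite A1 Eb' in E1; rewrite Eb in A1.
have nb : b' = ~~ b.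
  apply/eqP; apply: contraT => nb; have E : b' = b by move: nb; case: (b) (b') => -[].
  by rewrite E -Eb in Eb'; have /sigma_inj[] := Eb'.
rewrite nb in E1 Eb'; case: b {nb} Eb A1 Eb' E1 => /= Eb A1 Eb' E1.
  by rewrite A1 Eb'.
by rewrite E1 Eb.
Qed.

Lemma touch e f b : cr e f -> ~~ cr2 e f ->
  sigma (e, Some f, ~~ b) = (e, Some f, b) \/ sigma (e, Some f, b) = (e, Some f, ~~ b).
Proof.
move=> c; rewrite /cr2 c /= => na.
have : (e, Some f, ~~ b) \in quad e f by case: (b); rewrite !inE eqxx ?orbT.
case/(quad_spec b c) => E; last 1 first.
- by left; rewrite {1}E sigma4.
- by case: E; case: (b).
- by right; rewrite -E.
case/negP: na; rewrite /alt; case: b E => /= ->; first by [].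
by rewrite (sigma4 false c).
Qed.

(** * Forgetting the touchings *)

Local Notation rev2 := (dart_rev cr2 tau).
Local Notation nxt2 := (nxt cr2 tau).
Local Notation valid2 := (@valid Eg cr2).

Lemma tau_inj2 e f g : cr2 e f -> cr2 e g -> tau e f = tau e g -> f = g.
Proof. by move=> /cr2W cf /cr2W cg; apply: tau_inj. Qed.

Lemma valid2W d : valid2 d -> valid1 d.
Proof. by case: d => -[e [f|]] b //; apply: cr2W. Qed.

Lemma nxt2_real e o b f : nxt1 (e, o, b) = Some f -> cr2 e f -> nxt2 (e, o, b) = Some f.
Proof.
case: (nxtP tau_inj) => // g gb gmin [?] c2; subst g.
have fb2 : beyond cr2 tau e o b f by move: gb; rewrite /beyond c2 => /andP[].
case: (nxtP tau_inj2) => [h hb hmin|/(_ f)]; last by rewrite fb2.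
have hb1 : beyond cr tau e o b h by move: hb; rewrite /beyond => /andP[/cr2W -> ->].
have [->//|fh] := gmin h hb1.
by have [->//|hf] := hmin f fb2; case: (before_asym fh hf).
Qed.

Lemma nxt2_None e o b : nxt1 (e, o, b) = None -> nxt2 (e, o, b) = None.
Proof.
case: (nxtP tau_inj) => // nb _; case: (nxtP tau_inj2) => // h /andP[/cr2W ch hb].
by have := nb h; rewrite /beyond ch hb.
Qed.

Lemma eq_beyond e o o' b : beyond cr2 tau e o b =1 beyond cr2 tau e o' b ->
  nxt2 (e, o, b) = nxt2 (e, o', b).
Proof.
move=> E; rewrite /nxt; apply: eq_pick => f; rewrite E; congr (_ && _).
by apply: eq_forallb => g; rewrite E.
Qed.

Lemma nxt2_touch e o b f : valid1 (e, o, b) -> nxt1 (e, o, b) = Some f ->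
  ~~ cr2 e f -> nxt2 (e, o, b) = nxt2 (e, Some f, b).
Proof.
move=> v En nc; apply: eq_beyond => h; move: En.
case: (nxtP tau_inj) => // g gb gmin [?]; subst g; rewrite /beyond.
case c2: (cr2 e h) => //=; have ch := cr2W c2; case/andP: gb => cf of'.
apply/idP/idP => [gh|fh]; last first.
  by case: o of' {v gmin} => // g gf; apply: before_trans gf fh.
have hb1 : beyond cr tau e o b h by rewrite /beyond ch.
by have [E|//] := gmin h hb1; rewrite E c2 in nc.
Qed.

Lemma nxt2_back e b f : cr e f -> ~~ cr2 e f ->
  nxt2 (e, nxt2 (e, Some f, ~~ b), b) = nxt2 (e, Some f, b).
Proof.
move=> cf nc; apply: eq_beyond => h; rewrite /beyond.
case c2: (cr2 e h) => //=; have ch := cr2W c2.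
have nfh : tau e f <> tau e h.
  by move/(tau_inj cf ch) => E; rewrite E c2 in nc.
have tot := before_total b nfh.
case: (nxtP tau_inj2) => [g /andP[cg gf] gmin|/(_ h)].
  rewrite before_neg in gf; apply/idP/idP => [gh|fh]; last exact: before_trans gf fh.
  case/orP: tot => // hf.
  have hb' : beyond cr2 tau e (Some f) (~~ b) h by rewrite /beyond c2 before_neg.
  have [E|] := gmin h hb'; first by rewrite E before_irr in gh.
  by rewrite before_neg => hg; case: (before_asym gh hg).
by rewrite /beyond c2 /= before_neg => /negbT nb; move: tot; rewrite (negPf nb) orbF => ->.
Qed.

(** The hypothesis of [euler_rank] for the map that still has its touchings: [c] is a set of pieces,
    written on both darts of each. *)
Hypothesis potential : forall c : dart -> bool, (forall d, valid1 d -> c (rev1 d) = c d) ->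
  (forall d, valid1 d -> \big[addb/false]_(d' | valid1 d' && same_node d d') c d' = false) ->
  exists f : dart -> bool, forall d, valid1 d ->
    f d (+) f (rev1 d) = c d /\ f (sigma (rev1 d)) = f d.

(* At a touching the face function takes the same value on both sides of each bend, so
   it extends along the edge past the touching. *)
Lemma potential_cr2 (c : dart -> bool) : (forall d, valid2 d -> c (rev2 d) = c d) ->
  (forall d, valid2 d -> \big[addb/false]_(d' | valid2 d' && same_node d d') c d' = false) ->
  exists f : dart -> bool, forall d, valid2 d ->
    f d (+) f (rev2 d) = c d /\ f (sigma (rev2 d)) = f d.
Proof.
move=> csym ceven.
pose c1 (d : dart) := c (d.1.1, nxt2 d, ~~ d.2).
have c1E d : valid2 d -> c1 d = c d by move=> v; rewrite -[RHS]csym.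
have vn e o b : valid2 (e, nxt2 (e, o, b), ~~ b).
  by rewrite /valid /=; case E: nxt => [g|//]; apply: (nxt_cr tau_inj2 E).
have c1_sym d : valid1 d -> c1 (rev1 d) = c1 d.
  case: d => -[e o] b v; rewrite /dart_rev /c1 /= negbK -(csym _ (vn e o b)) /dart_rev /= negbK.
  congr (c (_, _, _)); case E: (nxt1 (e, o, b)) => [f|].
    case c2: (cr2 e f); first by rewrite (nxt2_real E c2).
    have := @nxt2_back e (~~ b) f (nxt_cr tau_inj E).
    by rewrite negbK c2 (nxt2_touch v E) ?c2 // => ->.
  by rewrite (nxt2_None E).
have c1_touch e f : cr e f -> ~~ cr2 e f -> c1 (e, Some f, true) = c1 (e, Some f, false).
  move=> cf nc; rewrite /c1 /= -(csym _ (vn e (Some f) true)) /dart_rev /=.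
  by congr (c (_, _, _)); have := @nxt2_back e false f cf nc.
have [|f Hf] := potential c1_sym.
  move=> d v; case: d v => -[e [g|]] b v; last first.
    rewrite -[RHS](ceven (e, None, b)) //; apply: eq_big => [d'|d' /andP[v' s]].
      case: d' => -[e' [f'|]] b'; rewrite /same_node /= ?andbF //.
    by apply: c1E; case: d' s {v'} => -[e' [f'|]] b'.
  case c2: (cr2 e g).
    rewrite -[RHS](ceven (e, Some g, b)) //; apply: eq_big => [d'|d' /andP[v' s]].
      case: d' => -[e' [f'|]] b'; rewrite /same_node /= ?andbF //.
      rewrite /valid /=; apply: andb_id2r.
      by case/orP=> /andP[/eqP <- /eqP <-]; rewrite ?[cr2 g e]cr2_sym ?c2 -?(cr_sym e) ?(cr2W c2).
    apply: c1E; case: d' s {v'} => -[e' [f'|]] b' //.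
    by rewrite /same_node /valid /= => /orP[]/andP[/eqP <- /eqP <-]; rewrite ?[cr2 g e]cr2_sym c2.
  have cge : cr g e by rewrite cr_sym.
  have c2' : ~~ cr2 g e by rewrite cr2_sym c2.
  rewrite (eq_bigl (fun d' => d' \in quad e g)); last by move=> d'; rewrite mem_quad.
  rewrite -big_uniq ?quad_uniq //= !big_cons big_nil c1_touch ?c2 //.
  by rewrite (c1_touch g e) // !addbA addbb addbF addbb.
(* At a bend one dart of the edge is the rotation of the other, so [f] agrees before and after the
   bend on one side of the edge. As [c1] has the same value before and after, [f] agrees on the
   other side as well. *)
have f_touch d g : valid1 d -> nxt1 d = Some g -> ~~ cr2 d.1.1 g ->
    f (d.1.1, Some g, d.2) = f d.
  case: d => -[e o] b /= v E nc; have cg : cr e g := nxt_cr tau_inj E.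
  have Er : rev1 (e, o, b) = (e, Some g, ~~ b) by rewrite /dart_rev /= E.
  have [Hd1 Hd2] := Hf _ v; rewrite Er in Hd1 Hd2.
  have [E1|E1] := touch b cg nc; first by rewrite -E1.
  have vt : valid1 (e, Some g, b) by [].
  have [Ht1 Ht2] := Hf _ vt.
  have vrt := rev_valid tau_inj vt.
  have [_] := Hf _ vrt; rewrite (revK tau_inj vt) E1 => Ef.
  have ct : c1 (e, Some g, b) = c1 (e, Some g, ~~ b).
    by case: (b); rewrite /= c1_touch.
  have Hd : c1 (e, Some g, ~~ b) = c1 (e, o, b) by rewrite -(c1_sym _ v) Er.
  rewrite Ef ct Hd in Ht1 Hd1 *; rewrite -Ht1 in Hd1.
  by move: Hd1; case: (f (e, o, b)); case: (f (rev1 _)); case: (f (e, Some g, b)).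
have f_run n e o b : valid1 (e, o, b) ->
    #|[pred h | beyond cr tau e o b h]| < n ->
    f (rev1 (e, nxt2 (e, o, b), ~~ b)) = f (e, o, b).
  elim: n e o b => // n IHn e o b v lt; have rr := revK tau_inj v.
  rewrite /dart_rev /= in rr; case E: (nxt1 (e, o, b)) rr => [g|] rr; last first.
    by rewrite (nxt2_None E) /dart_rev /= rr.
  have cg : cr e g := nxt_cr tau_inj E.
  case c2: (cr2 e g); first by rewrite (nxt2_real E c2) /dart_rev /= rr.
  rewrite (nxt2_touch v E) ?c2 // IHn //; first by apply: (f_touch _ _ v E); rewrite c2.
  rewrite ltnS in lt; apply: leq_trans lt; apply: proper_card; apply/properP; split.
    apply/fintype.subsetP => h; rewrite !inE /beyond => /andP[-> /= gh].
    have := nxt_beyond tau_inj E; rewrite /beyond; case: (o) => // k /andP[_ kg].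
    exact: before_trans kg gh.
  exists g; rewrite !inE.
    exact: (nxt_beyond tau_inj E).
  by rewrite /beyond before_irr andbF.
exists f => d v; have v1 := valid2W v.
have v2 : valid1 (rev2 d) by apply/valid2W/(rev_valid tau_inj2).
have Er : f (rev1 (rev2 d)) = f d.
  by case: d v1 {v v2} => -[e o] b v1; apply: f_run.
have [Hr1 Hr2] := Hf _ v2; split; last first.
  have [_] := Hf _ (rev_valid tau_inj v2).
  by rewrite (revK tau_inj v2) Er.
rewrite -(csym _ v) -(c1E _ (rev_valid tau_inj2 v)) -Hr1 Er addbC //.
Qed.

Definition phi (d : dart) := if valid2 d then sigma (rev2 d) else d.

Lemma same_node_valid2 d d' : valid1 d' -> same_node d d' -> valid2 d -> valid2 d'.
Proof.
case: d => -[e [f|]] b; case: d' => -[e' [f'|]] b' //= _.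
rewrite /same_node /valid /= => /orP[]/andP[/eqP <- /eqP <-] //.
by rewrite cr2_sym.
Qed.

Lemma sigma_valid2 d : valid2 (sigma d) = valid2 d.
Proof.
have W x : valid2 x -> valid2 (sigma x).
  move=> v; have := fconnect1 sigma x; rewrite sigma_node ?(valid2W v) // => /andP[v' s].
  exact: same_node_valid2 v' s v.
apply/idP/idP; last exact: W.
move=> v; have : fconnect sigma (sigma d) d by rewrite fconnect_sym // fconnect1.
rewrite sigma_node ?(valid2W v) // => /andP[v' s].
exact: same_node_valid2 v' s v.
Qed.

Lemma phi_valid d : valid2 (phi d) = valid2 d.
Proof.
rewrite /phi; case: ifP => // v.
by rewrite sigma_valid2; apply: (rev_valid tau_inj2).
Qed.

Lemma phi_inj : injective phi.
Proof.
move=> d d' E; have := congr1 valid2 E; rewrite !phi_valid => Ev.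
move: E; rewrite /phi -Ev; case: ifP => // v /sigma_inj E.
have v' : valid2 d' by rewrite -Ev.
by rewrite -(revK tau_inj2 v) E (revK tau_inj2 v').
Qed.

Lemma phi_cross e o b f : valid2 (e, o, b) -> nxt2 (e, o, b) = Some f ->
  exists b', phi (e, o, b) = (f, Some e, b').
Proof.
move=> v E; rewrite /phi v /dart_rev /= E.
exact: alt_turn (nxt_cr tau_inj2 E).
Qed.

Lemma phi_end e o b : valid2 (e, o, b) -> nxt2 (e, o, b) = None ->
  exists2 e', phi (e, o, b) = (e', None, ~~ b) & vtx e' (~~ b) = vtx e (~~ b).
Proof.
move=> v E; rewrite /phi v /dart_rev /= E.
have := fconnect1 sigma (e, None, ~~ b); rewrite sigma_node //.
case: (sigma _) => -[e' [f'|]] b' /andP[_]; rewrite /same_node //= => /andP[/eqP <- /eqP ->].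
by exists e'.
Qed.

Lemma phi_alt e o b f : valid2 (e, o, b) -> nxt2 (e, o, b) = Some f ->
  phi (rev2 (phi (e, o, b))) = (e, Some f, b).
Proof.
move=> v E; have [b' Ep] := phi_cross v E; have vp : valid2 (phi (e, o, b)).
  by rewrite phi_valid.
rewrite {1}/phi (rev_valid tau_inj2) // revK //; last exact: tau_inj2.
by rewrite /phi v /dart_rev /= E alt_bool ?negbK //; apply: (nxt_cr tau_inj2 E).
Qed.

Lemma phi_leaf e b : nxt2 (e, None, b) = None -> phi (e, None, b) = (e, None, ~~ b) ->
  forall e', vtx e' (~~ b) = vtx e (~~ b) -> e' = e.
Proof.
move=> En; rewrite /phi /dart_rev /= En => Es e' ve'.
have : fconnect sigma (e, None, ~~ b) (e', None, ~~ b).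
  by rewrite sigma_node // /same_node /= ve' !eqxx.
move/iter_findex; elim: (findex _ _ _) => [[]//|n IHn].
by rewrite iterSr Es.
Qed.

Lemma card_cross : #|[pred d | valid2 d && (d.1.2 != None)]| =
  2 * #|[pred p : Eg * Eg | cr2 p.1 p.2]|.
Proof.
pose g (p : Eg * Eg * bool) : dart := (p.1.1, Some p.1.2, p.2).
have g_inj : injective g by move=> [[a b] c] [[a' b'] c'] [-> -> ->].
rewrite mulnC -card_bool -cardX -(fintype.card_image g_inj); apply: eq_card => d.
apply/idP/fintype.imageP => [|[[[e f] b]]].
  case: d => -[e [f|]] b /andP[v _] //; exists ((e, f), b) => //.
  by rewrite !inE /= andbT.
by rewrite !inE /= andbT => c ->; rewrite /= andbT.
Qed.

(** An orbit at a crossing has four darts, and [card_cross] counts these darts; the other orbits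
    belong to different vertices. *)
Lemma card_nodes : 2 * #|[pred d | froots sigma d && valid2 d]| <=
  2 * #|V| + #|[pred p : Eg * Eg | cr2 p.1 p.2]|.
Proof.
pose A := [pred d : dart | valid2 d && (d.1.2 != None)].
have A_sigma d : A (sigma d) = A d.
  rewrite /= sigma_valid2; case v: (valid2 d) => //=.
  have := fconnect1 sigma d; rewrite sigma_node ?(valid2W v) // => /andP[_].
  by case: (d) (sigma d) => -[e [f|]] b [[e' [f'|]] b'].
have := sum_orbits (fun=> 1) sigma_inj A_sigma.
rewrite sum1_card card_cross (eq_bigr (fun=> 4)); last first.
  move=> [[e [f|]] b] /andP[_ /andP[v _]] //.
  by rewrite sum1_size size_orbit order_quad //; apply: cr2W v.
rewrite sum_nat_const.
set B := [pred d | froots sigma d && valid2 d] => E.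
rewrite -(cardID A B).
have -> : #|[predI B & A]| = #|[pred r | froots sigma r && A r]|.
  by apply: eq_card => d; rewrite !inE -andbA; case: (valid2 d) => //=.
have arith a b c n : 2 * c = a * 4 -> b <= n -> 2 * (a + b) <= 2 * n + c by lia.
apply: (arith _ _ _ _ E); rewrite {arith E}.
pose g (d : dart) := vtx d.1.1 d.2.
rewrite -(card_in_imset (f := g)) ?max_card // => d d'.
rewrite !inE !negb_and !negbK => /andP[d1 /andP[/eqP d2 v]] /andP[d1' /andP[/eqP d2' v']].
rewrite v /= in d1; rewrite v' /= in d1'.
rewrite /g => Eg'; rewrite -d2 -d2'; apply/fingraph.rootP; first exact: fconnect_sym.
rewrite sigma_node ?(valid2W v) // (valid2W v').
case: d {d2} d1 v Eg' => -[e [f|]] b //= _ _; case: d' {d2'} d1' v' => -[e' [f'|]] b' //= _ _.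
rewrite /same_node /= => E'; rewrite E' eqxx andbT.
have [//|Eb] : b = b' \/ b' = ~~ b by case: (b) (b') => -[]; auto.
  by move=> ->.
by rewrite Eb in E'; case: (vtx_col E').
Qed.

Lemma euler (e0 : Eg) : #|[pred d | valid2 d]| + 4 <=
  2 * faces cr2 phi + 2 * #|V| + #|[pred p : Eg * Eg | cr2 p.1 p.2]|.
Proof.
have := card_nodes.
pose S : finType := {x : Eg * option Eg | valid2 (x, true)}.
pose N : finType := {d : dart | froots sigma d && valid2 d}.
pose O : finType := {d : dart | froots phi d && valid2 d}.
have sub_valid2 (f : dart -> dart) d : injective f -> (forall x, valid2 (f x) = valid2 x) ->
    valid2 d -> froots f (froot f d) && valid2 (froot f d).
  move=> f_inj fv v; rewrite roots_root /=; last exact: fconnect_sym.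
  have /iter_findex <- := connect_root (frel f) d.
  by elim: (findex _ _ _) => //= n IHn; rewrite fv.
have NP d (v : valid2 d) := sub_valid2 _ d sigma_inj sigma_valid2 v.
have OP d (v : valid2 d) := sub_valid2 _ d phi_inj phi_valid v.
have v0 : valid2 (e0, None, true) by [].
have n0 : N by exists (froot sigma (e0, None, true)); apply: NP.
have o0 : O by exists (froot phi (e0, None, true)); apply: OP.
pose toN d : N := insubd n0 (froot sigma d).
pose toO d : O := insubd o0 (froot phi d).
pose up (s : S) : dart := (val s, true).
have upv s : valid2 (up s) by case: s.
have dnv s : valid2 (rev2 (up s)) by apply: (rev_valid tau_inj2).
have Nval d : valid2 d -> val (toN d) = froot sigma d.
  by move=> v; rewrite val_insubd NP.
have Oval d : valid2 d -> val (toO d) = froot phi d.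
  by move=> v; rewrite val_insubd OP.
suff le : #|S| + 2 <= #|O| + #|N|.
  have cS : #|[pred d | valid2 d]| = 2 * #|S|.
    rewrite card_sig mulnC -card_bool -cardX; apply: eq_card => -[x b].
    by rewrite !inE andbT.
  have arith a b c d m n : d = 2 * a -> a + 2 <= b + c -> 2 * c <= 2 * n + m ->
    d + 4 <= 2 * b + 2 * n + m by lia.
  have EO : #|O| = faces cr2 phi by exact: card_sig.
  have EN : #|N| = #|[pred d | froots sigma d && valid2 d]| by exact: card_sig.
  by move=> cN; apply: (arith _ _ _ _ _ _ cS); [rewrite -EO; exact: le | rewrite EN; exact: cN].
apply: (@euler_rank S N O (toN \o up) (toN \o rev2 \o up)
  (toO \o up) (toO \o rev2 \o up) n0 o0) => c hc.
pose c2 (d : dart) := if insub (d.1.1, if d.2 then d.1.2 else nxt2 d) is Some s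
  then c s else false.
have c2up s : c2 (up s) = c s by rewrite /c2 /= -surjective_pairing valK.
have c2sym d : valid2 d -> c2 (rev2 d) = c2 d.
  case: d => -[e o] b v; rewrite /c2 /dart_rev /=; case: b v => //= v.
  by rewrite (nxt_rev tau_inj2 v).
have [|f Hf] := potential_cr2 c2sym.
  move=> d v; rewrite -[RHS](hc (toN d)).
  have nodeE d' : valid2 d' && same_node d d' = valid2 d' && (toN d' == toN d).
    apply: andb_id2l => v'; rewrite -val_eqE !Nval // root_connect; last exact: fconnect_sym.
    by rewrite fconnect_sym // sigma_node ?valid2W.
  (* The darts at a node in direction [true] are starts of pieces, the others are reversed ends;
     these are the two incidences in [euler_rank]. *)
  rewrite (eq_bigl _ _ nodeE) (bigID (fun d' : dart => d'.2)) /=.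
  transitivity (\big[addb/false]_(s : S | toN (up s) == toN d) c s (+)
                \big[addb/false]_(s : S | toN (rev2 (up s)) == toN d) c s); last first.
    rewrite [X in X (+) _]big_mkcond [X in _ (+) X]big_mkcond -big_split /=.
    by apply: eq_bigr => s _; case: (c s); case: eqP; case: eqP.
  congr (_ (+) _).
    rewrite (reindex_omap up (fun d' => insub d'.1)) /=.
      apply: eq_big => [s|s _]; last exact: c2up.
      by rewrite upv andbT valK eqxx andbT.
    move=> [x b] /= /andP[/andP[v' _] b1]; case: b b1 v' => // _ v'.
    by rewrite insubT /= /up SubK.
  rewrite (reindex_omap (rev2 \o up) (fun d' => insub (rev2 d').1)) /=.
    apply: eq_big => [s|s _]; last by rewrite c2sym.
    rewrite dnv andbT; have -> : insub (rev2 (rev2 (up s))).1 = Some s.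
      by rewrite (revK tau_inj2) //= valK.
    by rewrite eqxx andbT.
  move=> d' /andP[/andP[v' _] b1].
  have vr := rev_valid tau_inj2 v'.
  case E: (rev2 d') => [x b]; have b2 : b = true by rewrite -b1; have := congr1 snd E.
  have -> : (d'.1.1, nxt2 d') = x by have := congr1 fst E.
  move: vr E; rewrite b2 => vr E; rewrite E in vr; rewrite insubT /= /up SubK -E.
  by rewrite (revK tau_inj2 v').
exists (fun o => f (val o)) => s /=.
have froot_f d : valid2 d -> f (froot phi d) = f d.
  move=> v; have /iter_findex <- := connect_root (frel phi) d.
  elim: (findex _ _ _) => //= n <-; set d' := iter n phi d.
  have v' : valid2 d' by rewrite /d'; elim: n {d'} => //= n IHn; rewrite phi_valid.
  by have [_] := Hf _ v'; rewrite /phi v'.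
rewrite !Oval // !froot_f //.
by have [-> _] := Hf _ (upv s); rewrite c2up.
Qed.

Hypothesis vtx_inj : forall e f b,
  vtx e b = vtx f b -> vtx e (~~ b) = vtx f (~~ b) -> e = f.
Hypothesis cr_disj : forall e f b, cr e f -> vtx e b <> vtx f b.
Hypothesis fan : forall e f g b, cr e f -> cr e g ->
  vtx f b = vtx g b \/ vtx f (~~ b) = vtx g (~~ b).
Hypothesis no_isolated : forall e, exists2 e', e' != e & exists b : bool, vtx e' b = vtx e b.

Theorem edge_bound_rotation : 3 <= #|V| -> #|Eg| + 10 <= 4 * #|V|.
Proof.
move=> n3; have [|] := posnP #|Eg|; first by lia.
move=> /card_gt0P[e0 _]; 
apply: (@edge_bound V Eg vtx cr2 tau cr2_sym tau_inj2 vtx_col vtx_inj _ _ _ phi) => //.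
- by move=> e f b /cr2W; apply: cr_disj.
- by move=> e f g b /cr2W c /cr2W c'; exact: (fan b c c').
- exact: phi_inj.
- exact: phi_valid.
- exact: phi_cross.
- exact: phi_end.
- exact: phi_alt.
- exact: phi_leaf.
- exact: euler.
Qed.
End Alternation.

(* P gives the nodes of a system of arcs.  The permutation turns around each node, and the
   arcs satisfy a mod 2 Jordan curve theorem: a set c of arcs that is even at every node is
   the boundary of a set f of faces, (i, b) standing for the face to the left of the arc i
   followed in one of its two directions. *)
Definition has_rotation (I : finType) (T : eqType) (P : I * bool -> T) :=
  exists2 sigma : I * bool -> I * bool,
    injective sigma /\ (forall d d', fconnect sigma d d' = (P d == P d')) &
    forall c : I -> bool,
      (forall d, \big[addb/false]_(d' | P d' == P d) c d'.1 = false) ->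
      exists f : I * bool -> bool, forall i b,
        f (i, b) (+) f (i, ~~ b) = c i /\ f (sigma (i, ~~ b)) = f (i, b).

Lemma eq_has_rotation (I : finType) (T T' : eqType) (P : I * bool -> T) (Q : I * bool -> T') :
  (forall d d', (P d == P d') = (Q d == Q d')) -> has_rotation P -> has_rotation Q.
Proof.
move=> PQ [sigma [sigma_inj sigmaE] H]; exists sigma => [|c c_even].
  by split=> // d d'; rewrite sigmaE PQ.
by apply: H => d; rewrite (eq_bigl _ _ (fun d' => PQ d' d)).
Qed.

(** * Ends of pieces as darts *)

Section Segments.
Variables (V Eg : finType) (vtx : Eg -> bool -> V).
Variables (cr : rel Eg) (tau : Eg -> Eg -> nat).
Hypothesis cr_sym : symmetric cr.
Hypothesis cr_irr : irreflexive cr.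
Hypothesis tau_inj : forall e f g, cr e f -> cr e g -> tau e f = tau e g -> f = g.
Hypothesis vtx_col : forall e f b, vtx e b <> vtx f (~~ b).

Local Notation dart := (dart Eg).
Local Notation rev := (dart_rev cr tau).
Local Notation valid := (@valid Eg cr).

Definition segment := {s : Eg * option Eg | valid (s, true)}.

(** Leaves the end [x.2] of the piece [x.1] along this piece; in this way the ends of pieces index
    the valid darts. *)
Definition exit_dart (x : segment * bool) : dart :=
  if x.2 then rev (val x.1, true) else (val x.1, true).

Lemma exit_dart_valid x : valid (exit_dart x).
Proof. by case: x => s []; [exact: (rev_valid tau_inj (valP s)) | exact: (valP s)]. Qed.

Lemma exit_dart_inj : injective exit_dart.
Proof.
move=> [s b] [s' b']; rewrite /exit_dart /= => E.
have Eb : b = b' by move: (congr1 snd E); case: (b) (b') => -[].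
subst b'; congr (_, _); apply: val_inj; case: b E => [/(congr1 rev)|[]//].
by rewrite !(revK tau_inj) ?(valP s) ?(valP s') // => -[].
Qed.

Lemma exit_dart_rev s b : exit_dart (s, ~~ b) = rev (exit_dart (s, b)).
Proof. by case: b; rewrite /exit_dart //= (revK tau_inj) ?(valP s). Qed.

Lemma validP d : valid d -> exists x, d = exit_dart x.
Proof.
case: d => -[e o] [] v; first by exists (exist _ (e, o) v, false).
have v' := rev_valid tau_inj v; exists (exist _ ((rev (e, o, false)).1) v', true).
by rewrite /exit_dart /= -[LHS](revK tau_inj v).
Qed.

Variables (T : eqType) (P : segment * bool -> T).
Hypothesis P_node : forall x y, (P x == P y) = same_node vtx (exit_dart x) (exit_dart y).
Hypothesis P_rot : has_rotation P.

Hypothesis vtx_inj : forall e f b,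
  vtx e b = vtx f b -> vtx e (~~ b) = vtx f (~~ b) -> e = f.
Hypothesis cr_disj : forall e f b, cr e f -> vtx e b <> vtx f b.
Hypothesis fan : forall e f g b, cr e f -> cr e g ->
  vtx f b = vtx g b \/ vtx f (~~ b) = vtx g (~~ b).
Hypothesis no_isolated : forall e, exists2 e', e' != e & exists b : bool, vtx e' b = vtx e b.

Theorem edge_bound_segments : 3 <= #|V| -> #|Eg| + 10 <= 4 * #|V|.
Proof.
have [rho [rho_inj rhoE] H] := P_rot.
pose sigma d := if [pick x | exit_dart x == d] is Some x then exit_dart (rho x) else d.
have pickE (x : segment * bool) : [pick y | exit_dart y == exit_dart x] = Some x.
  by case: pickP => [y /eqP/exit_dart_inj->//|/(_ x)]; rewrite eqxx.
have sigmaE x : sigma (exit_dart x) = exit_dart (rho x) by rewrite /sigma pickE.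
have sigma_out d : ~~ valid d -> sigma d = d.
  move=> nv; rewrite /sigma; case: pickP => // x /eqP E.
  by rewrite -E exit_dart_valid in nv.
have iterE n x : iter n sigma (exit_dart x) = exit_dart (iter n rho x).
  by elim: n => //= n ->; rewrite sigmaE.
apply: (edge_bound_rotation cr_sym cr_irr tau_inj vtx_col (sigma := sigma)) => //.
- move=> d d'; case v: (valid d); case v': (valid d').
  + have [x ->] := validP v; have [y ->] := validP v'.
    by rewrite !sigmaE => /exit_dart_inj/rho_inj ->.
  + have [x ->] := validP v; rewrite sigmaE sigma_out ?v' // => E.
    by rewrite -E exit_dart_valid in v'.
  + have [y ->] := validP v'; rewrite sigmaE sigma_out ?v // => E.
    by rewrite E exit_dart_valid in v.
  by rewrite !sigma_out ?v ?v'.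
- move=> d d' v; have [x ->] := validP v; apply/idP/andP => [c|[v' s]].
    have := iter_findex c; rewrite iterE => <-; split; first exact: exit_dart_valid.
    by rewrite -P_node -rhoE fconnect_iter.
  have [y Ey] := validP v'; rewrite Ey -P_node -rhoE in s *.
  by rewrite -(iter_findex s) -iterE fconnect_iter.
move=> c c_rev c_even.
pose cI (s : segment) := c (exit_dart (s, false)).
have cE s b : c (exit_dart (s, b)) = cI s.
  by case: b; rewrite // -[true]/(~~ false) exit_dart_rev c_rev ?exit_dart_valid.
have [|f Hf] := H cI.
  move=> x; rewrite -[RHS](c_even _ (exit_dart_valid x)).
  rewrite [RHS](reindex_omap exit_dart (fun d => [pick y | exit_dart y == d])) /=; last first.
    by move=> d /andP[/validP[y ->] _]; rewrite pickE.
  apply: eq_big => [y|[s b] _]; last by rewrite cE.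
  by rewrite exit_dart_valid pickE eqxx andbT /= [P y == _]eq_sym P_node.
exists (fun d => if [pick x | exit_dart x == d] is Some x then f x else false) => d v.
have [[s b] ->] := validP v; rewrite -exit_dart_rev sigmaE !pickE cE.
exact: Hf.
Qed.
End Segments.

(** * Paths in the square grid *)

Section GridModel.
Import Order.TTheory GRing.Theory.
Local Open Scope ring_scope.

(** * Lattice steps and vertical rays *)

Section Lattice.
Definition lpt : Type := (int * int)%type.
Implicit Types (p q x y : lpt) (s : seq lpt).

Definition nbr p q := ((p.2 == q.2) && ((q.1 == p.1 + 1) || (p.1 == q.1 + 1))) ||
  ((p.1 == q.1) && ((q.2 == p.2 + 1) || (p.2 == q.2 + 1))).

(* Unit cells are named by their lower left corner. *)
Definition lcell p q : lpt :=
  if q.1 == p.1 + 1 then p else if q.2 == p.2 + 1 then (p.1 - 1, p.2)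
  else if p.1 == q.1 + 1 then (p.1 - 1, p.2 - 1) else (p.1, p.2 - 1).

(* The step from p to q meets the vertical ray going up from the centre of the cell a. *)
Definition ray (a : lpt) p q := [&& a.2 < p.2, p.2 == q.2 &
  ((p.1 == a.1) && (q.1 == a.1 + 1)) || ((p.1 == a.1 + 1) && (q.1 == a.1))].

Definition same_link p q x y := ((p == x) && (q == y)) || ((p == y) && (q == x)).

Definition above x y p := [&& x.1 == y.1, p.1 == x.1 & (x.2 < p.2) || (y.2 < p.2)].

Lemma nbrC p q : nbr p q = nbr q p.
Proof. by rewrite /nbr; lia. Qed.

Variant nbr_spec : lpt -> lpt -> Prop :=
| NbrE a b : nbr_spec (a, b) (a + 1, b)
| NbrW a b : nbr_spec (a + 1, b) (a, b)
| NbrN a b : nbr_spec (a, b) (a, b + 1)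
| NbrS a b : nbr_spec (a, b + 1) (a, b).

Lemma nbrP p q : nbr p q -> nbr_spec p q.
Proof.
case: p q => [p1 p2] [q1 q2]; rewrite /nbr /=.
case/orP=> /andP[/eqP->] /orP[]/eqP->; constructor.
Qed.

Lemma lcellE a b : (lcell (a, b) (a + 1, b) = (a, b)) * (lcell (a + 1, b) (a, b) = (a, b - 1)) *
  (lcell (a, b) (a, b + 1) = (a - 1, b)) * (lcell (a, b + 1) (a, b) = (a, b)).
Proof. by rewrite /lcell /=; do ![split]; repeat case: ifP; move=> *; congr (_, _); lia. Qed.

Ltac decide_cells := repeat (match goal with
  | |- context [?u == ?v] => case: (u =P v) => ?
  | |- context [(?u < ?v)%R] => case: (boolP (u < v)%R) => ? end;
  rewrite ?andbF ?andbT ?orbF ?orbT //=; try (exfalso; lia)).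

(** The cell [lcell x y] is to the left of the step from [x] to [y], [lcell y x] to its right. If
    the step is horizontal, both rays lie in one column and differ in this step only. If it is
    vertical, they lie in neighbouring columns, and a step meets just one of them when it enters or
    leaves the line between them; [above] records this. *)
Lemma ray_step x y p q : nbr x y -> nbr p q ->
  ray (lcell x y) p q (+) ray (lcell y x) p q =
  same_link x y p q (+) (above x y p (+) above x y q).
Proof.
case/nbrP=> a b /nbrP[] c d; rewrite !lcellE /ray /same_link /above !xpair_eqE /=.
all: by decide_cells.
Qed.
End Lattice.

Section Walks.
Implicit Types (p q x y : lpt) (s : seq lpt).

Fixpoint steps p s : seq (lpt * lpt) := if s is q :: s' then (p, q) :: steps q s' else [::].

Lemma steps_cat p s1 s2 : steps p (s1 ++ s2) = steps p s1 ++ steps (last p s1) s2.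
Proof. by elim: s1 p => //= q s1 IH p; rewrite IH. Qed.

Definition crossings a p s := odd (count (fun e => ray a e.1 e.2) (steps p s)).
Definition uses x y p s := odd (count (fun e => same_link x y e.1 e.2) (steps p s)).

(** Summed along a walk, the terms with [above] telescope to its two ends. *)
Lemma walk_crossings x y p s : nbr x y -> path nbr p s ->
  crossings (lcell x y) p s (+) crossings (lcell y x) p s =
  uses x y p s (+) (above x y p (+) above x y (last p s)).
Proof.
rewrite /crossings /uses => xy; elim: s p => [|q s IHs] p /=; first by rewrite addbb.
case/andP=> pq /IHs E; rewrite !oddD !oddb addbACA E ray_step // addbACA.
by congr (_ (+) _); rewrite addbA -(addbA (above x y p)) addbb addbF.
Qed.

Lemma same_linkC x y p q : same_link x y p q = same_link y x p q.
Proof. by rewrite /same_link orbC andbC [(y == q) && _]andbC. Qed.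

Lemma uses_cat x y p s1 s2 :
  uses x y p (s1 ++ s2) = uses x y p s1 (+) uses x y (last p s1) s2.
Proof. by rewrite /uses steps_cat count_cat oddD. Qed.

Lemma uses0 x y p s : (forall e, e \in steps p s -> same_link x y e.1 e.2 = false) ->
  uses x y p s = false.
Proof. by move=> h; rewrite /uses (@eq_in_count _ _ pred0) ?count_pred0. Qed.

Lemma mem_steps p s e : e \in steps p s -> (e.1 \in p :: s) && (e.2 \in s).
Proof.
elim: s p => //= q s IHs p; rewrite !inE => /orP[/eqP->|/IHs]; first by rewrite !eqxx.
by rewrite !inE => /andP[-> ->]; rewrite !orbT.
Qed.

Lemma uses_out x y p s : x \notin p :: s -> uses x y p s = false.
Proof.
move=> xs; apply: uses0 => e /mem_steps/andP[e1 e2]; apply/negP.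
have {}e2 : e.2 \in p :: s by rewrite inE e2 orbT.
by case/orP=> /andP[/eqP E1 /eqP E2]; move: xs; rewrite ?E1 ?E2 ?e1 ?e2.
Qed.
End Walks.

Lemma cycle_mkseq (T : Type) (e : rel T) (f : nat -> T) n :
  (forall k, (k < n)%N -> e (f k) (f k.+1)) -> e (f n) (f 0%N) -> cycle e (mkseq f n.+1).
Proof.
move=> h hn; have E : mkseq f n.+1 = f 0%N :: mkseq (fun k => f k.+1) n.
  by rewrite /mkseq -[n.+1]/(1 + n)%N /= (iotaDl 1 0) -map_comp.
rewrite E /= rcons_path; apply/andP; split.
  apply/(pathP (f 0%N)) => k; rewrite size_mkseq => hk.
  by rewrite -E !nth_mkseq ?h // ltnS ltnW.
by rewrite (last_nth (f 0%N)) size_mkseq -E nth_mkseq.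
Qed.

(** * Boxes and the edges leaving them *)

Section Boxes.
Variable r : nat.
Implicit Types (a p q : lpt).

Definition inbox a p := (a.1 - r%:Z <= p.1 <= a.1 + r%:Z) && (a.2 - r%:Z <= p.2 <= a.2 + r%:Z).

Definition side := r.*2.+1.

(* The edges leaving the box, clockwise from the top left corner. *)
Definition exit_link a (k : nat) : lpt * lpt :=
  if (k < side)%N then
    let x := a.1 - r%:Z + k%:Z in ((x, a.2 + r%:Z), (x, a.2 + r%:Z + 1))
  else if (k < 2 * side)%N then
    let y := a.2 + r%:Z - (k - side)%N%:Z in ((a.1 + r%:Z, y), (a.1 + r%:Z + 1, y))
  else if (k < 3 * side)%N then
    let x := a.1 + r%:Z - (k - 2 * side)%N%:Z in ((x, a.2 - r%:Z), (x, a.2 - r%:Z - 1))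
  else
    let y := a.2 - r%:Z + (k - 3 * side)%N%:Z in ((a.1 - r%:Z, y), (a.1 - r%:Z - 1, y)).

Definition exits a := mkseq (exit_link a) (4 * side).

Lemma exits_uniq a : uniq (exits a).
Proof.
apply/mkseq_uniqP => j k; rewrite !inE /exit_link /side => hj hk.
do ![case: ifP => ?] => -[]; lia.
Qed.

Lemma exitsP a e : reflect (exists2 k, (k < 4 * side)%N & e = exit_link a k) (e \in exits a).
Proof.
by apply: (iffP mapP) => -[k hk ->]; exists k => //; rewrite mem_iota in hk *.
Qed.

Lemma mem_exits a p q : ((p, q) \in exits a) = [&& inbox a p, ~~ inbox a q & nbr p q].
Proof.
apply/exitsP/idP => [[k]|].
  rewrite /exit_link /side /inbox /nbr => hk.
  do ![case: ifP => ?] => -[-> ->] /=; lia.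
case: p q => [p1 p2] [q1 q2] /and3P[]; rewrite /inbox /nbr /= => hp hq.
case/orP=> /andP[/eqP E] /orP[]/eqP E'; subst.
- exists (side + `|(a.2 + r%:Z - q2)%R|)%N; rewrite /exit_link /side; first by lia.
  repeat case: ifP => ?; (do 2 congr (_, _)); try lia.
- exists (3 * side + `|(q2 - a.2 + r%:Z)%R|)%N; rewrite /exit_link /side; first by lia.
  repeat case: ifP => ?; (do 2 congr (_, _)); try lia.
- exists (`|(q1 - a.1 + r%:Z)%R|)%N; rewrite /exit_link /side; first by lia.
  repeat case: ifP => ?; (do 2 congr (_, _)); try lia.
- exists (2 * side + `|(a.1 + r%:Z - q1)%R|)%N; rewrite /exit_link /side; first by lia.
  repeat case: ifP => ?; (do 2 congr (_, _)); try lia.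
Qed.

(** The cell to the right of [x] is the cell to the left of [y]. *)
Definition turn (x y : lpt * lpt) := lcell x.2 x.1 == lcell y.1 y.2.

Lemma lcellE' (x y : int) : (lcell (x, y) (x, y - 1) = (x, y - 1)) *
  (lcell (x, y - 1) (x, y) = (x - 1, y - 1)) *
  (lcell (x, y) (x - 1, y) = (x - 1, y - 1)) * (lcell (x - 1, y) (x, y) = (x - 1, y)).
Proof. by rewrite /lcell /=; do ![split]; repeat case: ifP; move=> *; congr (_, _); lia. Qed.

Lemma turn_exit a k : (k.+1 < 4 * side)%N -> turn (exit_link a k) (exit_link a k.+1).
Proof.
rewrite /turn /exit_link => hk; apply/eqP; have sE : side = r.*2.+1 by [].
do 2![case: ifP => /= ?]; first by rewrite !lcellE; congr (_, _); lia.
all: do ?[case: ifP => /= ?]; rewrite ?lcellE ?lcellE'; congr (_, _); lia.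
Qed.

Lemma exits_turn a : cycle turn (exits a).
Proof.
rewrite /exits -[(4 * side)%N]prednK //; apply: cycle_mkseq => [k hk|].
  by apply: turn_exit; lia.
rewrite /exit_link; do ![case: ifP => /= ?]; have sE : side = r.*2.+1 by []; try lia.
by rewrite /turn /= !lcellE lcellE'; apply/eqP; congr (_, _); lia.
Qed.

End Boxes.

Lemma box_walk r a p q : inbox r a p -> inbox r a q ->
  exists s, [/\ path nbr p s, last p s = q & all (inbox r a) s].
Proof.
move=> hp hq; pose D := (`|(p.1 - q.1)%R| + `|(p.2 - q.2)%R|)%N.
have [n] := ubnP D; rewrite {}/D; elim: n p hp => // n IHn p hp lt.
have step p' : nbr p p' -> inbox r a p' ->
    (`|(p'.1 - q.1)%R| + `|(p'.2 - q.2)%R| < `|(p.1 - q.1)%R| + `|(p.2 - q.2)%R|)%N ->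
    exists s, [/\ path nbr p s, last p s = q & all (inbox r a) s].
  move=> pp' hp' lt'; have [|s [s1 s2 s3]] := IHn p' hp'; first by lia.
  by exists (p' :: s); rewrite /= pp' hp'.
case: p q hp hq lt step {IHn} => [p1 p2] [q1 q2]; rewrite /inbox /nbr /= => hp hq lt step.
have [lt1|gt1|E1] := ltgtP p1 q1; [apply: (step (p1 + 1, p2)) => /=; lia| |].
  by apply: (step (p1 - 1, p2)) => /=; lia.
have [lt2|gt2|E2] := ltgtP p2 q2; [apply: (step (p1, p2 + 1)) => /=; lia| |].
  by apply: (step (p1, p2 - 1)) => /=; lia.
by exists [::]; rewrite E1 E2.
Qed.

Definition clockwise (q p : lpt) : lpt := (q.1 + (p.2 - q.2), q.2 - (p.1 - q.1)).

Lemma lcell_clockwise q p : nbr q p -> lcell p q = lcell q (clockwise q p) /\ nbr q (clockwise q p).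
Proof.
case/nbrP => a b; rewrite /clockwise /=; split; rewrite /lcell /nbr /=;
  do ?[case: ifP => ?]; try (congr (_, _)); lia.
Qed.

Lemma clockwise_neq q p : nbr q p ->
  clockwise q p != p /\ clockwise q (clockwise q p) != p.
Proof.
by case/nbrP => a b; rewrite /clockwise !xpair_eqE /=; split; lia.
Qed.

Lemma clockwise_cases q p p' : nbr q p -> nbr q p' ->
  [\/ p' = p, p' = clockwise q p, p' = clockwise q (clockwise q p) |
      p' = clockwise q (clockwise q (clockwise q p))].
Proof.
have eqp (x y : lpt) : x.1 = y.1 -> x.2 = y.2 -> x = y by case: x y => [? ?] [? ?] /= -> ->.
case/nbrP => a b; rewrite /clockwise /nbr /= => /orP[]/andP[/eqP h1 /orP[]/eqP h2];
  do ?[by constructor 1; apply: eqp => /=; lia | by constructor 2; apply: eqp => /=; lia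
  | by constructor 3; apply: eqp => /=; lia | by constructor 4; apply: eqp => /=; lia].
Qed.

(** * Lattice paths between boxes *)

Section Model.
Variables (I : finType) (r : nat) (ctr pe : I * bool -> lpt) (w A B : I -> seq lpt).
Implicit Types (d : I * bool) (p q x y : lpt).
Local Notation p0 i := (pe (i, false)).
Local Notation p1 i := (pe (i, true)).

Hypothesis box_disj : forall d d' q, inbox r (ctr d) q -> inbox r (ctr d') q -> ctr d = ctr d'.
Hypothesis pe_box : forall d, inbox r (ctr d) (pe d).
Hypothesis w_path : forall i, path nbr (p0 i) (rcons (w i) (p1 i)).
Hypothesis w_uniq : forall i, uniq (p0 i :: rcons (w i) (p1 i)).
Hypothesis w_neq0 : forall i, w i != [::].
Hypothesis w_box : forall i q d, q \in w i -> ~~ inbox r (ctr d) q.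
Hypothesis w_disj : forall i j q, q \in w i -> q \in w j -> i = j.
Hypothesis A_walk : forall i, [/\ path nbr (ctr (i, false)) (A i),
  last (ctr (i, false)) (A i) = p0 i & all (inbox r (ctr (i, false))) (A i)].
Hypothesis B_walk : forall i, [/\ path nbr (p1 i) (B i),
  last (p1 i) (B i) = ctr (i, true) & all (inbox r (ctr (i, true))) (B i)].

(** Prolonged to the centres, all paths at a node end in one point, where the end terms of
    [walk_crossings] can cancel. *)
Let W i := A i ++ rcons (w i) (p1 i) ++ B i.
Let U i x y := uses x y (ctr (i, false)) (W i).

Lemma W_path i : path nbr (ctr (i, false)) (W i).
Proof.
have [a1 a2 _] := A_walk i; have [b1 _ _] := B_walk i.
by rewrite /W !cat_path a1 a2 w_path last_rcons b1.
Qed.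

Lemma W_last i : last (ctr (i, false)) (W i) = ctr (i, true).
Proof. by have [_ b2 _] := B_walk i; rewrite /W !last_cat last_rcons b2. Qed.

Lemma U_split i x y : U i x y = uses x y (ctr (i, false)) (A i) (+)
  (uses x y (p0 i) (rcons (w i) (p1 i)) (+) uses x y (p1 i) (B i)).
Proof. by have [_ a2 _] := A_walk i; rewrite /U /W !uses_cat a2 last_rcons. Qed.

Lemma ctr_box d : inbox r (ctr d) (ctr d). Proof. by rewrite /inbox; lia. Qed.

Lemma A_box i q : q \in ctr (i, false) :: A i -> inbox r (ctr (i, false)) q.
Proof.
have [_ _ /allP a3] := A_walk i; rewrite inE => /orP[/eqP->|/a3//]; exact: ctr_box.
Qed.

Lemma B_box i q : q \in p1 i :: B i -> inbox r (ctr (i, true)) q.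
Proof. by have [_ _ /allP b3] := B_walk i; rewrite inE => /orP[/eqP->|/b3]. Qed.

Lemma U_inner i j m1 q m2 y : w i = m1 ++ q :: m2 ->
  U j q y = (j == i) && ((y == last (p0 i) m1) (+) (y == head (p1 i) m2)).
Proof.
move=> wE; have qw : q \in w i by rewrite wE mem_cat inE eqxx orbT.
rewrite U_split uses_out; last by apply: contraL qw => /A_box h; apply: contraL h; apply: w_box.
rewrite [uses _ _ _ (B j)]uses_out; last first.
  by apply: contraL qw => /B_box h; apply: contraL h; apply: w_box.
rewrite addFb addbF; case: eqP => [->|ji] /=; last first.
  apply: uses_out; rewrite inE mem_rcons inE !negb_or.
  have nq d : q != pe d by apply: contraL (pe_box d) => /eqP <-; exact: (w_box _ qw).
  by rewrite !nq /=; apply/negP => qj; apply: ji; apply: w_disj qj qw.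
have := w_uniq i; rewrite wE rcons_cat rcons_cons -cat_cons cat_uniq => /and3P[_].
rewrite /= negb_or => /andP[q1 _] /andP[q2 _].
rewrite uses_cat uses_out // addFb; case: m2 q2 wE => [|z m2] /= q2 wE.
  rewrite /uses /= !addn0 !oddD !oddb /same_link eqxx /=.
  have -> : (q == last (p0 i) m1) = false by apply: contraNF q1 => /eqP ->; apply: mem_last.
  by rewrite inE in q2; rewrite (negPf q2) /= orbF.
have := @uses_out q y z (rcons m2 (p1 i)) q2; rewrite /uses /= !oddD !oddb => ->.
rewrite /same_link eqxx /= addbF.
have -> : (q == last (p0 i) m1) = false by apply: contraNF q1 => /eqP ->; apply: mem_last.
by move: q2; rewrite inE negb_or => /andP[/negPf ->]; rewrite /= orbF.
Qed.

Definition link_out d : lpt * lpt := (pe d, if d.2 then last (p0 d.1) (w d.1) else head (p1 d.1) (w d.1)).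

Lemma link_out_inner d : (link_out d).2 \in w d.1.
Proof.
rewrite /link_out; case: (w _) (w_neq0 d.1) => // q m _ /=.
by case: (d.2); [apply: mem_last | rewrite inE eqxx].
Qed.

Lemma p0_p1 i : p0 i != p1 i.
Proof. by have := w_uniq i; rewrite /= mem_rcons inE negb_or => /andP[/andP[]]. Qed.

Lemma link_out_inj : injective link_out.
Proof.
move=> [i b] [j b'] E; have Ei : i = j.
  by apply: (@w_disj _ _ (link_out (i, b)).2); [|rewrite E]; apply: (link_out_inner (_, _)).
subst j; have := congr1 fst E; have := p0_p1 i.
by case: b b' {E} => -[] //= /eqP n E; case: n.
Qed.

Lemma link_out_nbr d : nbr (link_out d).1 (link_out d).2.
Proof.
case: d => i b; rewrite /link_out /=; have := w_path i; case: (w i) (w_neq0 i) => // q m _.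
case: b; rewrite /= rcons_path => /andP[h1 /andP[h2 h3]] //=.
by rewrite nbrC.
Qed.

(** The parts [A] and [B] stay inside a box. A link leaving a box is therefore used by the middle
    part alone, which does so only in its first and its last step. *)
Lemma U_exit d p q : inbox r (ctr d) p -> ~~ inbox r (ctr d) q ->
  (forall d', link_out d' != (p, q)) -> forall j, U j p q = false.
Proof.
move=> hp hq nH j; rewrite U_split.
have inb d' s t : (forall z, z \in t :: s -> inbox r (ctr d') z) -> uses p q t s = false.
  move=> ts; apply: uses0 => e /mem_steps/andP[e1 e2]; apply/negP => E.
  have {}e2 : e.2 \in t :: s by rewrite inE e2 orbT.
  have [pd qd] : inbox r (ctr d') p /\ inbox r (ctr d') q.
    by case/orP: E => /andP[/eqP-> /eqP->]; split; apply: ts.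
  by case/negP: hq; rewrite (box_disj hp pd).
rewrite (inb (j, false)); last exact: A_box.
rewrite (inb (j, true) (B j)); last exact: B_box.
rewrite addbF addFb; have := w_uniq j.
have pw : p \notin w j by apply: contraL hp; apply: w_box.
have [E0|n0] := eqVneq p (p0 j).
  have := nH (j, false); rewrite /link_out /= -E0; case: (w j) (w_neq0 j) pw => // h m _ _ /=.
  rewrite xpair_eqE eqxx /= => qh /andP[ph _].
  have := @uses_out p q h (rcons m (p1 j)); move/(_ ph).
  rewrite /uses /= oddD => ->; rewrite addbF oddb /same_link eqxx /=.
  rewrite eq_sym (negPf qh) /=; apply/negP => /andP[/eqP E _].
  by rewrite E inE eqxx in ph.
have [E1|n1] := eqVneq p (p1 j); last first.
  by move=> _; apply: uses_out; rewrite inE mem_rcons inE !negb_or n0 n1.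
have := nH (j, true); rewrite /link_out /= -E1 xpair_eqE eqxx /= => ql _.
rewrite -cats1 uses_cat uses_out ?inE ?negb_or ?n0 // addFb /uses /= addn0 oddb /same_link eqxx.
have lw : last (p0 j) (w j) \in w j by case: (w j) (w_neq0 j) => // h m _ /=; apply: mem_last.
rewrite (_ : (p == _) = false) /=; last by apply: contraNF pw => /eqP E; rewrite {1}E.
by rewrite eq_sym (negPf ql).
Qed.

(** * Ray parity as a function on cells *)

Section Potential.
Variable c : I -> bool.
Hypothesis c_even : forall d, \big[addb/false]_(d' | ctr d' == ctr d) c d'.1 = false.

Let F a := \big[addb/false]_i (c i && crossings a (ctr (i, false)) (W i)).

(** Grouped by nodes, the value of [h] at a node is counted once for each selected path end there,
    hence an even number of times. *)
Lemma even_sum (h : lpt -> bool) :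
  \big[addb/false]_i (c i && (h (ctr (i, false)) (+) h (ctr (i, true)))) = false.
Proof.
transitivity (\big[addb/false]_d (c d.1 && h (ctr d))).
  rewrite (eq_bigr (fun d => c d.1 && h (ctr (d.1, d.2)))); last by move=> [].
  rewrite -(pair_bigA _ (fun i b => c i && h (ctr (i, b)))) /=; apply: eq_bigr => i _.
  by rewrite big_bool /= andb_addr addbC.
pose rep d := odflt d [pick d' | ctr d' == ctr d].
have repP d : ctr (rep d) = ctr d by rewrite /rep; case: pickP => //= d' /eqP.
have rep_eq d d' : (rep d == rep d') = (ctr d == ctr d').
  apply/eqP/eqP => E; first by rewrite -repP E repP.
  rewrite /rep; rewrite E; case: pickP => // /(_ d'); by rewrite eqxx.
rewrite (partition_big rep predT) //= big1 // => d0 _.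
have [/existsP[d /eqP Ed]|/existsPn nd] := boolP [exists d, rep d == d0]; last first.
  by rewrite big_pred0 // => d; apply/negbTE/nd.
subst d0; under eq_bigl do rewrite rep_eq.
rewrite (eq_bigr (fun d' => h (ctr d) && c d'.1)); last first.
  by move=> d' /eqP ->; rewrite andbC.
by rewrite -big_distrr /= c_even andbF.
Qed.

Lemma F_diff x y : nbr x y ->
  F (lcell x y) (+) F (lcell y x) = \big[addb/false]_i (c i && U i x y).
Proof.
move=> xy; rewrite -[RHS]addbF -[X in _ = _ (+) X](even_sum (above x y)) -!big_split /=.
apply: eq_bigr => i _; case: (c i); rewrite ?andFb // !andTb.
by rewrite walk_crossings ?W_path // W_last.
Qed.

Lemma F_inner i m1 q m2 y : w i = m1 ++ q :: m2 -> nbr q y ->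
  F (lcell q y) (+) F (lcell y q) = c i && ((y == last (p0 i) m1) (+) (y == head (p1 i) m2)).
Proof.
move=> wE qy; rewrite F_diff // (bigD1 i) //= (U_inner _ _ wE) eqxx /= big1 ?addbF // => j ji.
by rewrite (U_inner _ _ wE) (negPf ji) andbF.
Qed.

Lemma inner_path i m1 q m2 : w i = m1 ++ q :: m2 ->
  [/\ nbr q (last (p0 i) m1), nbr q (head (p1 i) m2) & last (p0 i) m1 != head (p1 i) m2].
Proof.
move=> wE; have := w_path i; rewrite wE rcons_cat cat_path /= => /and3P[_ q1 q2].
split; first by rewrite nbrC.
  by case: (m2) q2 => [|z m] /= /andP[].
have := w_uniq i; rewrite wE rcons_cat -cat_cons cat_uniq => /and3P[_ /hasPn n _].
apply/eqP => E; have /n : head (p1 i) m2 \in rcons (q :: m2) (p1 i).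
  by case: (m2) => [|z m]; rewrite /= !inE eqxx !orbT.
by rewrite -E mem_last.
Qed.

(* The other edges at q are not used, so turning around q crosses no path. *)
Lemma inner_turn i m1 q m2 : w i = m1 ++ q :: m2 ->
  F (lcell (last (p0 i) m1) q) = F (lcell q (head (p1 i) m2)).
Proof.
move=> wE; have [] := inner_path wE; set p := last _ _; set n := head _ _ => qp qn pn.
have straight y : nbr q y -> y != p -> n != y -> F (lcell q y) = F (lcell y q).
  move=> qy yp yn; apply: addbI (F (lcell y q)) _ _ _; rewrite addbb addbC (F_inner wE qy).
  by rewrite -/p -/n (negPf yp) [y == n]eq_sym (negPf yn) andbF.
have next y : nbr q y -> F (lcell y q) = F (lcell q (clockwise q y)).
  by case/lcell_clockwise => ->.
have cwN y : nbr q y -> nbr q (clockwise q y) by case/lcell_clockwise.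
have [c1 c2] := clockwise_neq qp; rewrite next //.
have [->//|n1] := eqVneq n (clockwise q p).
rewrite (straight _ (cwN _ qp) c1 n1) (next _ (cwN _ qp)).
have [->//|n2] := eqVneq n (clockwise q (clockwise q p)).
rewrite (straight _ (cwN _ (cwN _ qp)) c2 n2) (next _ (cwN _ (cwN _ qp))).
by case: (clockwise_cases qp qn) => E;
  [rewrite E eqxx in pn | rewrite E eqxx in n1 | rewrite E eqxx in n2 | rewrite E].
Qed.

Lemma path_side i : F (lcell (p0 i) (head (p1 i) (w i))) = F (lcell (last (p0 i) (w i)) (p1 i)).
Proof.
suff H m1 : forall m2, w i = m1 ++ m2 ->
    F (lcell (p0 i) (head (p1 i) (w i))) = F (lcell (last (p0 i) m1) (head (p1 i) m2)).
  by rewrite (H (w i) [::]) ?cats0.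
elim/last_ind: m1 => [|m1 q IHm] m2; first by move=> ->.
rewrite cat_rcons => wE; rewrite (IHm _ wE) /= last_rcons.
exact: (inner_turn wE).
Qed.

Definition face d := F (lcell (link_out d).1 (link_out d).2).

Lemma face_out d : face d = F (lcell (link_out d).2 (link_out d).1) (+) c d.1.
Proof.
case: d => i b; rewrite /face; set x := (link_out _).1; set y := (link_out _).2.
have xy : nbr x y := link_out_nbr (i, b).
suff : F (lcell x y) (+) F (lcell y x) = c i by move=> <-; rewrite addbC addbK.
rewrite addbC; rewrite /x /y /link_out /=; move: xy; rewrite nbrC /x /y /link_out /=.
case: b {x y}; last first.
  case wE: (w i) (w_neq0 i) => [//|h m] _ /= hp; rewrite (F_inner (m1 := [::]) wE) // eqxx /=.
  have [_ _] := inner_path (m1 := [::]) wE => /negPf /= ->; rewrite andbT //.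
case/lastP wE: (w i) (w_neq0 i) => [//|m l] _ /=; rewrite last_rcons => lp.
rewrite -cats1 in wE; rewrite (F_inner wE) // eqxx /=.
by have [_ _] := inner_path wE; rewrite eq_sym => /negPf /= ->; rewrite andbT.
Qed.

(** By [path_side] the value on the left of the path is the same at both ends, and the dart coming
    from the far end has this side on its right. *)
Lemma face_sym i b : face (i, b) (+) face (i, ~~ b) = c i.
Proof.
suff E : face (i, false) (+) face (i, true) = c i by case: b => /=; rewrite // addbC.
rewrite [face (i, true)]face_out /= -path_side.
by rewrite /face /= addbA addbb.
Qed.

Lemma face_back d : F (lcell (link_out d).2 (link_out d).1) = face (d.1, ~~ d.2).
Proof.
have := face_out d; have := face_sym d.1 d.2; rewrite -surjective_pairing => <-.
by case: (face d); case: (face _); case: (F _).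
Qed.

End Potential.

Definition inv_out (e : lpt * lpt) := [pick d | link_out d == e].

Lemma inv_outK d : inv_out (link_out d) = Some d.
Proof.
rewrite /inv_out; case: pickP => [d' /eqP/link_out_inj ->//|/(_ d)]; by rewrite eqxx.
Qed.

Lemma inv_out_cancel : ocancel inv_out link_out.
Proof. by move=> x; rewrite /inv_out; case: pickP => //= d /eqP. Qed.

Lemma link_out_exits d : link_out d \in exits r (ctr d).
Proof.
rewrite [link_out d]surjective_pairing mem_exits link_out_nbr pe_box /= andbT.
exact: w_box (link_out_inner d).
Qed.

Definition around a := pmap inv_out (exits r a).

Lemma around_uniq a : uniq (around a).
Proof. exact: (pmap_uniq inv_out_cancel (exits_uniq r a)). Qed.

Lemma mem_around d d' : (d' \in around (ctr d)) = (ctr d' == ctr d).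
Proof.
rewrite mem_pmap; apply/mapP/eqP => [[x xd E]|E]; last first.
  by exists (link_out d'); rewrite -?E ?link_out_exits ?inv_outK.
have Ex : x = link_out d' by have := inv_out_cancel x; rewrite -E.
move: xd; rewrite Ex [link_out d']surjective_pairing mem_exits => /and3P[pd _ _].
exact: box_disj (pe_box d') pd.
Qed.

Definition rotation d := next (around (ctr d)) d.

Lemma ctr_rotation d : ctr (rotation d) = ctr d.
Proof. by apply/eqP; rewrite -mem_around mem_next mem_around. Qed.

Lemma rotation_inj : injective rotation.
Proof.
move=> d d' E; have Ec : ctr d = ctr d' by rewrite -ctr_rotation E ctr_rotation.
move: E; rewrite /rotation Ec => /(congr1 (prev (around (ctr d')))).
by rewrite !prev_next ?around_uniq.
Qed.

Lemma fconnect_rotation d d' : fconnect rotation d d' = (ctr d == ctr d').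
Proof.
have cyc : fcycle rotation (around (ctr d)).
  rewrite (eq_in_cycle (P := mem (around (ctr d))) (e' := frel (next (around (ctr d))))).
  - exact: cycle_next (around_uniq _).
  - by move=> x y /=; rewrite mem_around /rotation => /eqP ->.
  by apply/allP.
by rewrite (fconnect_cycle cyc) ?mem_around 1?eq_sym.
Qed.

Lemma face_rotation c : (forall d, \big[addb/false]_(d' | ctr d' == ctr d) c d'.1 = false) ->
  forall i b, face c (rotation (i, ~~ b)) = face c (i, b).
Proof.
move=> c_even i b; have -> : (i, b) = ((i, ~~ b).1, ~~ (i, ~~ b).2) by rewrite /= negbK.
rewrite -face_back //; set d := (i, ~~ b); pose F a := \big[addb/false]_i
  (c i && crossings a (ctr (i, false)) (W i)).
rewrite -/(F _) /face -/(F _).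
have straight (e : lpt * lpt) : e \in exits r (ctr d) -> inv_out e = None ->
    F (lcell e.1 e.2) = F (lcell e.2 e.1).
  case: e => p q; rewrite mem_exits => /and3P[hp hq pq] H; rewrite /=.
  apply: addbI (F (lcell q p)) _ _ _; rewrite addbb addbC F_diff // big1 // => j _.
  rewrite (U_exit hp hq) ?andbF // => d'; apply/eqP => E.
  by rewrite -E inv_outK in H.
have [k s sE] := rot_to (link_out_exits d).
have turns : path turn (link_out d) (rcons s (link_out d)).
  by have := exits_turn r (ctr d); rewrite -(rot_cycle k) sE.
have -> : rotation d = head d (pmap inv_out s).
  rewrite /rotation; have pE : pmap inv_out (rot k (exits r (ctr d))) = d :: pmap inv_out s.
    by rewrite sE /= inv_outK.
  have [k' E] : exists k', rot k' (around (ctr d)) = d :: pmap inv_out s.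
    exists (size (pmap inv_out (take k (exits r (ctr d))))).
    by rewrite -pE /around -{2}[exits _ _](cat_take_drop k) !pmap_cat rot_size_cat.
  rewrite -(next_rot k' (around_uniq _)) E /=.
  by case: (pmap _ _) => [|d' l] /=; rewrite eqxx.
have {k sE} : {subset s <= exits r (ctr d)}.
  by move=> x xs; rewrite -(mem_rot k) sE inE xs orbT.
move=> sub; suff : forall e, path turn e (rcons s (link_out d)) ->
    F (lcell (link_out (head d (pmap inv_out s))).1 (link_out (head d (pmap inv_out s))).2) =
    F (lcell e.2 e.1) by exact.
elim: {turns} s sub => [|e' s IHs] sub e /=; first by rewrite andbT => /eqP ->.
case/andP=> /eqP -> ys; case E: (inv_out e') => [d'|] /=.
  by have := inv_out_cancel e'; rewrite E /= => <-.
rewrite straight ?sub ?inE ?eqxx //; apply: IHs ys => z zs.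
by apply: sub; rewrite inE zs orbT.
Qed.

End Model.

Lemma split_last (T : eqType) (a : pred T) s : has a s ->
  exists s1 x s2, [/\ s = s1 ++ x :: s2, a x & ~~ has a s2].
Proof.
elim: s => //= x s IHs; case hs: (has a s); last first.
  by rewrite orbF => ax; exists [::], x, s; rewrite hs.
by have [s1 [y [s2 [-> ay h2]]]] := IHs hs; exists (x :: s1), y, s2.
Qed.

(** * From walks to disjoint paths *)

Section Rotation.
Variables (I : finType) (r : nat) (ctr : I * bool -> lpt).
Hypothesis box_disj : forall d d' q, inbox r (ctr d) q -> inbox r (ctr d') q -> ctr d = ctr d'.

Lemma path_rotation (pe : I * bool -> lpt) (w : I -> seq lpt) :
  (forall d, inbox r (ctr d) (pe d)) ->
  (forall i, path nbr (pe (i, false)) (rcons (w i) (pe (i, true)))) ->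
  (forall i, uniq (pe (i, false) :: rcons (w i) (pe (i, true)))) ->
  (forall i, w i != [::]) ->
  (forall i q d, q \in w i -> ~~ inbox r (ctr d) q) ->
  (forall i j q, q \in w i -> q \in w j -> i = j) ->
  has_rotation ctr.
Proof.
move=> pe_box w_path w_uniq w_neq0 w_box w_disj.
have /fin_all_exists[A hA] i : exists s, [/\ path nbr (ctr (i, false)) s,
    last (ctr (i, false)) s = pe (i, false) & all (inbox r (ctr (i, false))) s].
  exact: box_walk (ctr_box _ _ _) (pe_box _).
have /fin_all_exists[B hB] i : exists s, [/\ path nbr (pe (i, true)) s,
    last (pe (i, true)) s = ctr (i, true) & all (inbox r (ctr (i, true))) s].
  exact: box_walk (pe_box _) (ctr_box _ _ _).
exists (rotation r ctr pe w); first by split; [apply: rotation_inj | apply: fconnect_rotation].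
move=> c c_even; exists (face ctr pe w A B c) => i b; split.
  exact: face_sym.
exact: face_rotation.
Qed.

(** Loops are removed by [shortenP]. The path is then cut at its first point in the box of its end
    and, before that, at its last point in the box of its start; what lies between meets no box. *)
Theorem walk_rotation (s : I -> seq lpt) :
  (forall d d' p q, inbox r (ctr d) p -> inbox r (ctr d') q -> nbr p q -> ctr d = ctr d') ->
  (forall i, ctr (i, false) != ctr (i, true)) ->
  (forall i, path nbr (ctr (i, false)) (s i)) ->
  (forall i, last (ctr (i, false)) (s i) = ctr (i, true)) ->
  (forall i q d, q \in s i -> inbox r (ctr d) q -> exists b, ctr d = ctr (i, b)) ->
  (forall i j q, q \in s i -> q \in s j -> (forall d, ~~ inbox r (ctr d) q) -> i = j) ->
  has_rotation ctr.
Proof.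
move=> apart ends s_path s_last s_box s_disj.
have /fin_all_exists[w hw] i : exists w : lpt * lpt * seq lpt, let: (x0, x1, m) := w in
    [/\ path nbr x0 (rcons m x1), uniq (x0 :: rcons m x1),
        inbox r (ctr (i, false)) x0 /\ inbox r (ctr (i, true)) x1,
        {subset m <= s i} & forall b, ~~ has (inbox r (ctr (i, b))) m].
  have := s_last i.
  case: (shortenP (s_path i)) => p p_path p_uniq p_sub p_last.
  have h1 : has (inbox r (ctr (i, true))) p.
    apply/hasP; exists (ctr (i, true)); rewrite ?ctr_box //.
    case: p {p_path p_uniq p_sub} p_last => [|x p] /= E; last by rewrite -E mem_last.
    by move/eqP: E; rewrite (negPf (ends i)).
  case: (split_find h1) p_path p_uniq p_sub => x1 u v ux1 nu; rewrite cat_rcons.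
  rewrite -cat_cons => p_path p_uniq p_sub.
  have h0 : has (inbox r (ctr (i, false))) (ctr (i, false) :: u) by rewrite /= ctr_box.
  have [u1 [x0 [m [uE hx0 nm]]]] := split_last h0.
  exists (x0, x1, m); split=> //.
  - have : path nbr (ctr (i, false)) (u ++ x1 :: v) by [].
    rewrite -[path _ _ _]/(sorted nbr (_ :: (u ++ x1 :: v))) -cat_cons uE -catA.
    by move/cat_sorted2=> [_ /=]; rewrite -cat_rcons cat_path => /andP[].
  - move: p_uniq; rewrite uE -catA cat_uniq => /and3P[_ _].
    by rewrite /= -cat_rcons cat_uniq mem_cat negb_or => /andP[/andP[-> _] /andP[-> _]].
  - move=> q qm; apply: p_sub; rewrite mem_cat.
    have : q \in ctr (i, false) :: u by rewrite uE mem_cat inE qm !orbT.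
    rewrite inE => /orP[/eqP E|->//]; case/hasP: nm; exists q => //; rewrite E; exact: ctr_box.
  - move=> [] //; apply: contra nu => /hasP[q qm hq]; apply/hasP; exists q => //.
    have : q \in ctr (i, false) :: u by rewrite uE mem_cat inE qm !orbT.
    rewrite inE => /orP[/eqP E|//]; rewrite E in hq.
    by move: (ends i); rewrite (box_disj hq (ctr_box r ctr (i, false))) ?eqxx.
apply: (@path_rotation (fun d => if d.2 then (w d.1).1.2 else (w d.1).1.1) (fun i => (w i).2)) => /=.
- by case=> i b; have := hw i; case: (w i) => -[x0 x1] m [_ _ []]; case: b.
- by move=> i; have := hw i; case: (w i) => -[x0 x1] m [].
- by move=> i; have := hw i; case: (w i) => -[x0 x1] m [].
- move=> i; have := hw i; case: (w i) => -[x0 x1] m [xm _ [h0 h1] _ _] /=.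
  apply/eqP => E; rewrite E /= andbT in xm.
  by have /eqP := apart _ _ _ _ h0 h1 xm; rewrite (negPf (ends i)).
- move=> i q d; have := hw i; case: (w i) => -[x0 x1] m [_ _ _ ms mb] /= qm.
  apply/negP => hq; have [b Eb] := s_box _ _ _ (ms _ qm) hq.
  by have /hasP[] := mb b; exists q; rewrite -?Eb.
move=> i j q qi qj; apply: (@s_disj i j q).
- by have := hw i; move: qi; case: (w i) => -[x0 x1] m qm [_ _ _ ms _]; apply: ms.
- by have := hw j; move: qj; case: (w j) => -[x0 x1] m qm [_ _ _ ms _]; apply: ms.
move=> d; have := hw i; move: qi; case: (w i) => -[x0 x1] m /= qm [_ _ _ ms mb].
apply/negP => hq; have [b Eb] := s_box _ _ _ (ms _ qm) hq.
by have /hasP[] := mb b; exists q; rewrite -?Eb.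
Qed.
End Rotation.

End GridModel.

(** * Curves in the plane and on the sphere *)

Section Topology.
Import Order.TTheory GRing.Theory Num.Theory.
Import numFieldNormedType.Exports.
Local Open Scope classical_set_scope.
Local Open Scope ring_scope.

Lemma compact_dist_gt0 (R : realType) (V : normedModType R) (A B : set V) :
  compact A -> compact B -> A `&` B = set0 ->
  exists2 e : R, 0 < e & forall a b, A a -> B b -> e <= `|a - b|.
Proof.
move=> cA cB AB; pose dist (x : V * V) := `|x.1 - x.2|.
have cdist : continuous dist.
  by move=> x; apply: cvg_norm; apply: cvgB; [exact: cvg_fst | exact: cvg_snd].
have cK : closed (dist @` (A `*` B)).
  apply: compact_closed; first exact: norm_hausdorff.
  by apply: continuous_compact; [exact: continuous_subspaceT | exact: compact_setX].
have K0 : (~` (dist @` (A `*` B))) 0.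
  case=> -[a b] [/= Aa Bb] /eqP; rewrite /dist /= normr_eq0 subr_eq0 => /eqP E.
  suff : (A `&` B) a by rewrite AB.
  by split; rewrite // E.
have /nbhs_ballP[e /= e0 he] : nbhs 0 (~` (dist @` (A `*` B))).
  by apply: open_nbhs_nbhs; split; first exact: closed_openC.
exists e => // a b Aa Bb; rewrite leNgt; apply/negP => lt.
apply: (he (dist (a, b))); last by exists (a, b).
by rewrite /ball /= sub0r normrN /dist normr_id.
Qed.

Lemma fin_all_gt0 (R : realType) (T : finType) (Q : T -> R -> Prop) :
  (forall t e e', 0 < e' -> e' <= e -> Q t e -> Q t e') ->
  (forall t, exists2 e, 0 < e & Q t e) -> exists2 e, 0 < e & forall t, Q t e.
Proof.
move=> Qle /fin_all_exists2[e e0 Qe].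
exists (\big[Num.min/1]_t e t); first by apply: lt_bigmin.
by move=> t; apply: Qle (Qe t); [apply: lt_bigmin | apply: bigmin_le_cond].
Qed.

(** Connectedness of the interval: the supremum of the points reachable from 0 is reachable and
    cannot be below 1. It serves to build lattice walks and again in [no_bypass]. *)
Lemma unit_interval_chain (R : realType) (E : R -> R -> Prop) :
  (forall t, 0 <= t <= 1 -> exists2 e, 0 < e &
     forall u, 0 <= u <= 1 -> `|u - t| < e -> E t u /\ E u t) ->
  (forall t u v, E t u -> E u v -> E t v) -> E 0 1.
Proof.
move=> loc trans; pose S := [set t : R | 0 <= t <= 1 /\ E 0 t].
have S0 : S 0.
  split; first by rewrite lexx ler01.
  by have [|e e0 /(_ 0)[]] := loc 0; rewrite ?lexx ?ler01 ?subrr ?normr0.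
have supS : has_sup S by split; [exists 0 | exists 1 => t [/andP[]]].
have s01 : 0 <= sup S <= 1.
  by rewrite sup_upper_bound //= ge_sup //; [exists 0 | move=> t [/andP[]]].
have [e e0 he] := loc _ s01.
have [t [t01 Et] lt] := sup_adherent e0 supS.
have le : t <= sup S by apply: sup_upper_bound.
have Es : E 0 (sup S).
  by apply: trans Et _; apply: (he t _ _).2 => //; rewrite ltr_norml; lra.
have [->//|s1] := eqVneq 1 (sup S).
pose u := Num.min 1 (sup S + e / 2).
have su : sup S < u by rewrite lt_min; move: s1 s01 => /eqP s1 s01; apply/andP; split; lra.
have u1 : u <= 1 by rewrite ge_min lexx.
have ue : u <= sup S + e / 2 by rewrite ge_min lexx orbT.
have : u <= sup S.
  apply: sup_upper_bound => //; split; first lra.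
  by apply: trans Es _; apply: (he u _ _).1; [lra | rewrite ltr_norml; lra].
lra.
Qed.

(** * Discretization of plane curves *)

Section Plane.
Variable R : realType.

Definition fl (x : R * R) : lpt := (Num.floor x.1, Num.floor x.2).
Definition emb (q : lpt) : R * R := (q.1%:~R, q.2%:~R).

Lemma norm2_le (x : R * R) (e : R) : (`|x| <= e) = (`|x.1| <= e) && (`|x.2| <= e).
Proof. by rewrite prod_normE ge_max. Qed.

Lemma norm2_lt (x : R * R) (e : R) : (`|x| < e) = (`|x.1| < e) && (`|x.2| < e).
Proof. by rewrite prod_normE gt_max. Qed.

Lemma floor_dist (x : R) (q : int) (r : nat) :
  (Num.floor x - r%:Z <= q <= Num.floor x + r%:Z) -> `|q%:~R - x| < r%:R + 1.
Proof.
have /andP[] := floor_itv x; set m := Num.floor x => h1 h2 /andP[q1 q2].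
have {}q1 : (m%:~R - r%:R : R) <= q%:~R.
  by have := q1; rewrite -(ler_int R) rmorphB /= -pmulrn.
have {}q2 : q%:~R <= (m%:~R + r%:R : R).
  by have := q2; rewrite -(ler_int R) rmorphD /= -pmulrn.
rewrite intrD mulr1z in h2; rewrite ltr_norml; lra.
Qed.

Lemma inbox_dist r (x : R * R) q : inbox r (fl x) q -> `|emb q - x| < r%:R + 1.
Proof. by case/andP=> h1 h2; rewrite norm2_lt !floor_dist. Qed.

Lemma dist_inbox (r : nat) (x : R * R) q : `|emb q - x| <= r%:R -> inbox r (fl x) q.
Proof.
have H (y : R) (k : int) : `|k%:~R - y| <= r%:R -> (Num.floor y - r%:Z <= k <= Num.floor y + r%:Z).
  rewrite ler_norml => /andP[h1 h2]; have /andP[f1 f2] := floor_itv y.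
  rewrite intrD mulr1z in f2; apply/andP; split.
    by rewrite -(ler_int R) rmorphB /= -pmulrn; lra.
  by rewrite -ltzD1 -(ltr_int R) !rmorphD /= -pmulrn; lra.
by rewrite norm2_le /inbox => /andP[/H -> /H ->].
Qed.

Lemma nbr_dist p q : nbr p q -> `|emb p - emb q| <= 1.
Proof.
by case/nbrP=> a b; rewrite norm2_le /= ?intrD ?mulr1z !ler_norml; apply/andP; split;
  apply/andP; split; lra.
Qed.

(** The bound 2 is [inbox_dist] with radius 1: scaled points less than 1 apart have integer parts in
    a common box of radius 1. *)
Lemma curve_walk (g : R -> R * R) (k : R) : continuous g -> 0 < k ->
  exists s, [/\ path nbr (fl (k *: g 0)) s, last (fl (k *: g 0)) s = fl (k *: g 1) &
    forall q, q \in s -> exists2 t, 0 <= t <= 1 & `|emb q - k *: g t| <= 2].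
Proof.
move=> cg k0; pose E t u := exists s, [/\ path nbr (fl (k *: g t)) s,
  last (fl (k *: g t)) s = fl (k *: g u) &
  forall q, q \in s -> exists2 t, 0 <= t <= 1 & `|emb q - k *: g t| <= 2].
suff : E 0 1 by [].
apply: unit_interval_chain => [t t01|t u v [s1 [p1 l1 h1]] [s2 [p2 l2 h2]]]; last first.
  exists (s1 ++ s2); rewrite cat_path last_cat p1 l1; split=> // q.
  by rewrite mem_cat => /orP[/h1|/h2].
have close u v : 0 <= u <= 1 -> `|k *: g u - k *: g v| < 1 -> E u v.
  move=> u01 uv; have [||s [s1 s2 s3]] := @box_walk 1 (fl (k *: g u)) (fl (k *: g u)) (fl (k *: g v)).
  - by rewrite /inbox; lia.
  - have H (x y : R) : `|x - y| < 1 -> Num.floor x - 1 <= Num.floor y <= Num.floor x + 1.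
      have /andP[x1 x2] := floor_itv x; have /andP[y1 y2] := floor_itv y.
      rewrite ltr_norml => /andP[h1 h2]; rewrite !intrD !mulr1z in x2 y2.
      by apply/andP; split; rewrite -ltzD1 -(ltr_int R) !(intrD, intrB) !mulr1z; lra.
    move: uv; rewrite norm2_lt => /andP[/H h1 /H h2]; exact/andP.
  exists s; split=> // q /(allP s3)/inbox_dist; exists u => //; exact: ltW.
have : {for t, continuous (fun u => k *: g u)} by apply: cvgZr => //; apply: cg.
move/cvgrPdist_lt/(_ 1 ltr01)/nbhs_ballP => -[e /= e0 he]; exists e => // u u01 tu.
have := he u; rewrite /ball /= distrC => /(_ tu) d.
by split; apply: close; rewrite // distrC.
Qed.

Definition itv01 : set R := [set` `[0, 1]%R].

Lemma itv01P (t : R) : itv01 t = (0 <= t <= 1) :> Prop.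
Proof. by rewrite /itv01 /= in_itv. Qed.

Section Curves.
Variables (I : finType) (g : I -> R -> R * R).
Hypothesis g_cont : forall i, continuous (g i).
Let P (d : I * bool) := g d.1 (if d.2 then 1 else 0).
Hypothesis g_ends : forall i, P (i, false) != P (i, true).
Hypothesis g_vertex : forall i t d, 0 < t < 1 -> g i t <> P d.
Hypothesis g_disj : forall i j t u, i != j -> 0 < t < 1 -> 0 <= u <= 1 -> g i t <> g j u.

Lemma t01_cases (t : R) : 0 <= t <= 1 -> [\/ t = 0, t = 1 | 0 < t < 1].
Proof.
move=> /andP[]; rewrite !le_eqVlt => /orP[/eqP<-|h]; first by constructor 1.
by move/orP=> [/eqP->|h']; [constructor 2 | constructor 3; rewrite h].
Qed.

Lemma compact_curve i : compact (g i @` itv01).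
Proof. by apply: continuous_compact (@segment_compact _ _ _); apply: continuous_subspaceT. Qed.

Lemma vertex_sep : exists2 e, 0 < e & forall d d', P d <> P d' -> 4 * e <= `|P d - P d'|.
Proof.
have [||e e0 he] := @fin_all_gt0 R ((I * bool) * (I * bool))%type
  (fun x e => P x.1 <> P x.2 -> 4 * e <= `|P x.1 - P x.2|).
- by move=> x e e' e0 le h /h; apply: le_trans; lra.
- move=> [d d'] /=; have [->|/eqP n] := eqVneq (P d) (P d'); first by exists 1.
  exists (`|P d - P d'| / 4); last by move=> _; lra.
  by rewrite divr_gt0 // normr_gt0 subr_eq0; apply/eqP.
by exists e => // d d'; apply: (he (d, d')).
Qed.

Lemma curve_vertex_sep : exists2 e, 0 < e & forall i d t, 0 <= t <= 1 ->
  (forall b, P d <> P (i, b)) -> 2 * e <= `|g i t - P d|.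
Proof.
have [||e e0 he] := @fin_all_gt0 R (I * (I * bool))%type
  (fun x e => forall t, 0 <= t <= 1 -> (forall b, P x.2 <> P (x.1, b)) -> 2 * e <= `|g x.1 t - P x.2|).
- by move=> x e e' e0 le h t t01 /(h t t01); apply: le_trans; lra.
- move=> [i d] /=; have [h|/existsNP[b /contrapT E]] := pselect (forall b, P d <> P (i, b)); last first.
    by exists 1 => // t _ /(_ b).
  have [|||e e0 he] := @compact_dist_gt0 R _ (g i @` itv01) [set P d].
  - exact: compact_curve.
  - exact: compact_set1.
  - apply/seteqP; split=> x //= -[[t]]; rewrite itv01P => t01 <- E.
    have [t0|t1|t'] := t01_cases t01; last exact: g_vertex t' E.
    - by apply: (h false); rewrite -E t0.
    - by apply: (h true); rewrite -E t1.
  exists (e / 2); first by rewrite divr_gt0.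
  move=> t t01 _; rewrite [2 * _]mulrC divfK ?pnatr_eq0 //.
  have gt : (g i @` itv01) (g i t) by exists t => //; rewrite itv01P.
  exact (he _ (P d) gt erefl).
by exists e => // i d t; apply: (he (i, d)).
Qed.

(** Two curves may end in the same point, so a bound exists only away from the ends of [g i]. *)
Lemma curves_sep (r : R) : 0 < r -> exists2 e, 0 < e & forall i j t u, i != j -> 0 <= t <= 1 ->
  0 <= u <= 1 -> (forall b, r <= `|g i t - P (i, b)|) -> e <= `|g i t - g j u|.
Proof.
move=> r0; have [||e e0 he] := @fin_all_gt0 R (I * I)%type
  (fun x e => x.1 != x.2 -> forall t u, 0 <= t <= 1 ->
  0 <= u <= 1 -> (forall b, r <= `|g x.1 t - P (x.1, b)|) -> e <= `|g x.1 t - g x.2 u|).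
- by move=> x e e' e0 le h n t u t01 u01 /(h n t u t01 u01); apply: le_trans.
- move=> [i j] /=; have [->|ij] := eqVneq i j; first by exists 1.
  pose far b := [set x | r <= `|x - P (i, b)|].
  have far_closed b : closed (far b).
    have /continuous_closedP : continuous (fun x : R * R => `|x - P (i, b)|).
      by move=> x; apply: cvg_norm; apply: cvgB; [exact: cvg_id | exact: cvg_cst].
    by move=> /(_ [set y : R | r <= y]); apply; exact: closed_ge.
  have [|||e e0 he] := @compact_dist_gt0 R _ (g i @` itv01 `&` far false `&` far true) (g j @` itv01).
  - by do 2!apply: compact_closedI => //; apply: compact_curve.
  - exact: compact_curve.
  - apply/seteqP; split=> x //= -[[[[t]]]]; rewrite itv01P => t01 <- h0 h1 [u]; rewrite itv01P => u01 /esym.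
    have [t0|t1|t'] := t01_cases t01; last exact: g_disj ij t' u01.
    - by move: h0; rewrite /far /= t0 subrr normr0 leNgt r0.
    - by move: h1; rewrite /far /= t1 subrr normr0 leNgt r0.
  exists e => // _ t u t01 u01 h.
  have gt : (g i @` itv01 `&` far false `&` far true) (g i t).
    by split; [split; [exists t => //; rewrite itv01P | exact: h] | exact: h].
  have gu : (g j @` itv01) (g j u) by exists u => //; rewrite itv01P.
  exact (he _ _ gt gu).
by exists e => // i j t u ij; apply: (he (i, j)).
Qed.

Theorem plane_rotation : has_rotation P.
Proof.
have [r1 r10 h1] := vertex_sep; have [r2 r20 h2] := curve_vertex_sep.
pose rho := Num.min r1 r2.
have rho0 : 0 < rho by rewrite lt_min r10.
have [rho1 rho2] : rho <= r1 /\ rho <= r2 by rewrite !ge_min !lexx orbT.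
have rho2_0 : 0 < rho / 2 by lra.
have [eta eta0 h3] := curves_sep rho2_0.
(* The scale makes [k * rho] and [k * eta] at least 8. This absorbs the lattice errors: a point of a
   box is within [r + 1] of its scaled node, with [r] the integer part of [k * rho], and a point of
   a walk within 2 of its scaled curve. *)
pose k := 8 / rho + 8 / eta.
have i1 : 0 < 8 / rho by rewrite divr_gt0.
have i2 : 0 < 8 / eta by rewrite divr_gt0.
have k0 : 0 < k by rewrite addr_gt0.
have krho : 8 <= k * rho.
  by rewrite /k mulrDl divfK ?gt_eqF // lerDl mulr_ge0 // ltW.
have keta : 8 <= k * eta.
  by rewrite /k mulrDl divfK ?gt_eqF // lerDr mulr_ge0 // ltW.
pose r := `|Num.floor (k * rho)|%N.
have [rk kr] : r%:R <= k * rho /\ k * rho < r%:R + 1.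
  have /andP[f1 f2] := floor_itv (k * rho).
  have r_eq : r%:R = (Num.floor (k * rho))%:~R :> R.
    by rewrite pmulrn /r gez0_abs // floor_ge0; lra.
  by rewrite intrD mulr1z in f2; rewrite r_eq.
have kdist (x y : R * R) : `|k *: x - k *: y| = k * `|x - y|.
  by rewrite -scalerBr normrZ gtr0_norm.
pose ctr d := fl (k *: P d).
have near d d' q q' : inbox r (ctr d) q -> inbox r (ctr d') q' ->
    `|emb q - emb q'| <= 1 -> P d = P d'.
  move=> /inbox_dist b1 /inbox_dist b2 qq; apply/eqP; apply: contraT => /eqP /h1.
  have := ler_distD (emb q) (k *: P d) (k *: P d').
  have := ler_distD (emb q') (emb q) (k *: P d').
  rewrite kdist [`|k *: P d - _|]distrC => d1 d2.
  rewrite -(ler_pM2l k0) => d3.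
  have : k * (4 * rho) <= k * (4 * r1) by rewrite ler_pM2l //; lra.
  lra.
have near_self d : inbox r (ctr d) (ctr d) by exact: ctr_box.
have ctrP d d' : (ctr d == ctr d') = (P d == P d').
  apply/eqP/eqP => [E|E]; last by rewrite /ctr E.
  by apply: (near d d' (ctr d) (ctr d)); rewrite ?subrr ?normr0 // E.
have /fin_all_exists[s hs] i := curve_walk (@g_cont i) k0.
have far i q d : q \in s i -> inbox r (ctr d) q -> exists b, ctr d = ctr (i, b).
  have [_ _ sh] := hs i; move=> /sh[t t01 tq] /inbox_dist b1.
  have [nP|/existsNP[b /contrapT E]] := pselect (forall b, P d <> P (i, b)); last first.
    by exists b; apply/eqP; rewrite ctrP E.
  have := h2 i d t t01 nP; rewrite -(ler_pM2l k0) -kdist.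
  have := ler_distD (emb q) (k *: g i t) (k *: P d).
  rewrite [`|k *: g i t - emb q|]distrC => d1 d2.
  have : k * (2 * rho) <= k * (2 * r2) by rewrite ler_pM2l //; lra.
  lra.
apply: (@eq_has_rotation _ _ _ ctr) => //; apply: (@walk_rotation I r ctr _ s).
- by move=> d d' q b1 b2; apply/eqP; rewrite ctrP (near _ _ _ _ b1 b2) ?subrr ?normr0.
- by move=> d d' p q b1 b2 pq; apply/eqP; rewrite ctrP (near _ _ _ _ b1 b2 (nbr_dist pq)).
- by move=> i; rewrite ctrP.
- by move=> i; have [] := hs i.
- by move=> i; have [] := hs i.
- exact: far.
move=> i j q qi qj out; apply/eqP; apply: contraT => ij.
have [_ _ /(_ q qi)[t t01 tq]] := hs i; have [_ _ /(_ q qj)[u u01 uq]] := hs j.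
have : eta <= `|g i t - g j u|.
  apply: h3 => // b; rewrite -(ler_pM2l k0) -kdist leNgt; apply/negP => lt.
  have /negP := out (i, b); apply; apply: dist_inbox.
  have := ler_distD (k *: g i t) (emb q) (k *: P (i, b)).
  lra.
rewrite -(ler_pM2l k0) -kdist.
have := ler_distD (emb q) (k *: g i t) (k *: g j u).
rewrite [`|k *: g i t - emb q|]distrC; lra.
Qed.
End Curves.
End Plane.

(** * Stereographic projection *)

Section Sphere.
Variable R : realType.
Local Notation point := (R * R * R)%type.

Definition dot (p q : point) := p.1.1 * q.1.1 + p.1.2 * q.1.2 + p.2 * q.2.

(** Projection from [p] to the plane through 0 orthogonal to [p], with the third coordinate dropped;
    if [0 < p.2], orthogonality gives this coordinate back. *)
Definition stereo (p q : point) : R * R :=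
  ((q.1.1 - dot p q * p.1.1) / (1 - dot p q), (q.1.2 - dot p q * p.1.2) / (1 - dot p q)).

Lemma point_eq (p q : point) : p.1.1 = q.1.1 -> p.1.2 = q.1.2 -> p.2 = q.2 -> p = q.
Proof. by case: p q => [[a b] c] [[a' b'] c'] /= -> -> ->. Qed.

Lemma dot_lt1 p q : dot p p = 1 -> dot q q = 1 -> p <> q -> 0 < 1 - dot p q.
Proof.
case: p q => [[a b] c] [[a' b'] c']; rewrite /dot /= => hp hq n.
rewrite lt_neqAle; apply/andP; split; last first.
  have := sqr_ge0 (a - a'); have := sqr_ge0 (b - b'); have := sqr_ge0 (c - c').
  rewrite !expr2; nra.
apply/eqP => E; apply: n.
have : (a - a') ^+ 2 + (b - b') ^+ 2 + (c - c') ^+ 2 = 0 by rewrite !expr2; nra.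
move/eqP; rewrite paddr_eq0 ?addr_ge0 ?sqr_ge0 // paddr_eq0 ?sqr_ge0 // !sqrf_eq0 !subr_eq0.
by case/andP=> /andP[/eqP-> /eqP->] /eqP->.
Qed.

Lemma stereo_inj p q q' : 0 < p.2 -> dot p p = 1 -> dot q q = 1 -> dot q' q' = 1 ->
  p <> q -> p <> q' -> stereo p q = stereo p q' -> q = q'.
Proof.
move=> p3 hp hq hq' n n'; have s1 := dot_lt1 hp hq n; have s1' := dot_lt1 hp hq' n'.
set a := 1 - dot p q in s1; set a' := 1 - dot p q' in s1'.
move=> [E1 E2]; rewrite -/a -/a' in E1 E2.
pose Z := (q.2 - dot p q * p.2) / a; pose Z' := (q'.2 - dot p q' * p.2) / a'.
set X := (_ / a) in E1; set Y := (_ / a) in E2.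
have a0 : a != 0 by rewrite gt_eqF.
have a0' : a' != 0 by rewrite gt_eqF.
have q1 : q.1.1 = a * X + (1 - a) * p.1.1 by rewrite /X mulrC divfK // /a; ring.
have q2 : q.1.2 = a * Y + (1 - a) * p.1.2 by rewrite /Y mulrC divfK // /a; ring.
have q3 : q.2 = a * Z + (1 - a) * p.2 by rewrite /Z mulrC divfK // /a; ring.
have q1' : q'.1.1 = a' * X + (1 - a') * p.1.1 by rewrite E1 mulrC divfK // /a'; ring.
have q2' : q'.1.2 = a' * Y + (1 - a') * p.1.2 by rewrite E2 mulrC divfK // /a'; ring.
have q3' : q'.2 = a' * Z' + (1 - a') * p.2 by rewrite /Z' mulrC divfK // /a'; ring.
have orth : p.1.1 * X + p.1.2 * Y + p.2 * Z = 0.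
  apply: (mulfI a0); rewrite mulr0.
  have -> : a * (p.1.1 * X + p.1.2 * Y + p.2 * Z) = dot p q - (1 - a) * dot p p.
    by rewrite /dot q1 q2 q3; ring.
  by rewrite hp /a; ring.
have orth' : p.1.1 * X + p.1.2 * Y + p.2 * Z' = 0.
  apply: (mulfI a0'); rewrite mulr0.
  have -> : a' * (p.1.1 * X + p.1.2 * Y + p.2 * Z') = dot p q' - (1 - a') * dot p p.
    by rewrite /dot q1' q2' q3'; ring.
  by rewrite hp /a'; ring.
have EZ : Z = Z'.
  by apply: (mulfI (lt0r_neq0 p3)); apply: (addrI (p.1.1 * X + p.1.2 * Y)); rewrite orth orth'.
pose N := X * X + Y * Y + Z * Z.
(* The equation of the sphere: the squared length [N] of the projection determines [a], and thereby
   [q]. *)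
have aN : a * (N + 1) = 2.
  apply: (mulfI a0); apply/eqP; rewrite -subr_eq0; apply/eqP.
  transitivity (dot q q - 1 - 2 * a * (1 - a) * (p.1.1 * X + p.1.2 * Y + p.2 * Z)
    - (1 - a) ^+ 2 * (dot p p - 1)); last by rewrite orth hq hp; ring.
  by rewrite /dot q1 q2 q3 /N; ring.
have aN' : a' * (N + 1) = 2.
  apply: (mulfI a0'); apply/eqP; rewrite -subr_eq0; apply/eqP.
  transitivity (dot q' q' - 1 - 2 * a' * (1 - a') * (p.1.1 * X + p.1.2 * Y + p.2 * Z')
    - (1 - a') ^+ 2 * (dot p p - 1)); last by rewrite orth' hq' hp; ring.
  by rewrite /dot q1' q2' q3' /N EZ; ring.
have N0 : N + 1 != 0 by rewrite gt_eqF // ltr_wpDl // /N -!expr2 !addr_ge0 ?sqr_ge0.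
have Ea : a = a' by apply: (mulIf N0); rewrite aN aN'.
by apply: point_eq; rewrite ?q1 ?q1' ?q2 ?q2' ?q3 ?q3' Ea ?EZ.
Qed.

Lemma continuous_pair (T U V : topologicalType) (f : T -> U) (g : T -> V) :
  continuous f -> continuous g -> continuous (fun x => (f x, g x)).
Proof. by move=> cf cg x; apply: cvg_pair; [apply: cf | apply: cg]. Qed.

Lemma continuous_coord (g : R -> point) : continuous g ->
  [/\ continuous (fun t => (g t).1.1), continuous (fun t => (g t).1.2) & continuous (fun t => (g t).2)].
Proof.
move=> cg; split=> t.
- apply: (continuous_comp (f := fun t => (g t).1)); last exact: cvg_fst.
  by apply: continuous_comp; [exact: cg | exact: cvg_fst].
- apply: (continuous_comp (f := fun t => (g t).1)); last exact: cvg_snd.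
  by apply: continuous_comp; [exact: cg | exact: cvg_fst].
- by apply: continuous_comp; [exact: cg | exact: cvg_snd].
Qed.

Lemma stereo_continuous p (g : R -> point) : continuous g ->
  (forall t, 1 - dot p (g t) != 0) -> continuous (stereo p \o g).
Proof.
move=> cg nz; have [c1 c2 c3] := continuous_coord cg.
have cdot : continuous (fun t => dot p (g t)).
  by move=> t; apply: cvgD; [apply: cvgD|]; apply: cvgM;
    [exact: cvg_cst | exact: c1 | exact: cvg_cst | exact: c2 | exact: cvg_cst | exact: c3].
have cinv : continuous (fun t => (1 - dot p (g t))^-1).
  by move=> t; apply: cvgV => //; apply: cvgB; [exact: cvg_cst | exact: cdot].
apply: continuous_pair => t; apply: cvgM; try exact: cinv; apply: cvgB.
- exact: c1.
- by apply: cvgM; [exact: cdot | exact: cvg_cst].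
- exact: c2.
- by apply: cvgM; [exact: cdot | exact: cvg_cst].
Qed.

Theorem sphere_rotation (I : finType) (g : I -> R -> point) (p0 : point) :
  let P (d : I * bool) := g d.1 (if d.2 then 1 else 0) in
  (forall i, continuous (g i)) ->
  (forall i t, dot (g i t) (g i t) = 1) ->
  dot p0 p0 = 1 -> 0 < p0.2 -> (forall i t, p0 <> g i t) ->
  (forall i, P (i, false) <> P (i, true)) ->
  (forall i t d, 0 < t < 1 -> g i t <> P d) ->
  (forall i j t u, i != j -> 0 < t < 1 -> 0 <= u <= 1 -> g i t <> g j u) ->
  has_rotation P.
Proof.
move=> P g_cont g_sph p0_sph p0_pos p0_g ends vertex disj.
have inj i j t u : stereo p0 (g i t) = stereo p0 (g j u) -> g i t = g j u.
  exact: stereo_inj.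
apply: (@eq_has_rotation _ _ _ (fun d => stereo p0 (P d))).
  by move=> d d'; apply/eqP/eqP => [/inj//|->].
apply: (@plane_rotation R I (fun i t => stereo p0 (g i t))).
- move=> i; apply: stereo_continuous => // t.
  by rewrite gt_eqF //; apply: dot_lt1 => //; apply: p0_g.
- by move=> i; apply/eqP => /inj/(ends i).
- by move=> i t d t01 /inj; apply: vertex.
- by move=> i j t u ij t01 u01 /inj; apply: disj.
Qed.
End Sphere.

(** * A point missed by finitely many arcs *)

Section Cap.
Variable R : realType.
Local Notation point := (R * R * R)%type.

Definition cap (x : R * R) : point := (x.1, x.2, Num.sqrt (1 - x.1 ^+ 2 - x.2 ^+ 2)).

Lemma cap_inj : injective cap.
Proof. by move=> [a b] [a' b'] [-> ->]. Qed.

Lemma cap_continuous : continuous cap.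
Proof.
have c1 : continuous (fun x : R * R => x.1) by move=> x; exact: cvg_fst.
have c2 : continuous (fun x : R * R => x.2) by move=> x; exact: cvg_snd.
apply: continuous_pair; first exact: continuous_pair.
move=> x; apply: (continuous_comp (f := fun x : R * R => 1 - x.1 ^+ 2 - x.2 ^+ 2));
  last exact: sqrt_continuous.
by apply: cvgB; [apply: cvgB; first exact: cvg_cst|]; rewrite !expr2; apply: cvgM;
  [exact: c1|exact: c1|exact: c2|exact: c2].
Qed.

Definition line (A B : R * R) (t : R) : R * R := (A.1 + t * (B.1 - A.1), A.2 + t * (B.2 - A.2)).

Lemma line_continuous A B : continuous (line A B).
Proof.
have c a b : continuous (fun t : R => a + t * b).
  by move=> t; apply: cvgD; [exact: cvg_cst | apply: cvgM; [exact: cvg_id | exact: cvg_cst]].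
exact: continuous_pair.
Qed.

Lemma closed_arc (g : R -> point) (a b : R) : continuous g -> closed (g @` [set` `[a, b]%R]).
Proof.
move=> cg; apply: compact_closed; first exact: norm_hausdorff.
by apply: continuous_compact (@segment_compact _ _ _); exact: continuous_subspaceT.
Qed.

Variable g : R -> point.
Hypothesis g_cont : continuous g.
Hypothesis g_inj : forall t u, 0 <= t <= 1 -> 0 <= u <= 1 -> g t = g u -> t = u.

(* The two closed subarcs on either side of g m meet only there, so they would disconnect
   a segment from A to B that avoids M. *)
Lemma no_bypass A B M a m b :
  0 <= a -> b <= 1 -> a < m -> m < b -> g a = cap A -> g m = cap M -> g b = cap B ->
  (forall t, 0 <= t <= 1 -> exists2 u, 0 <= u <= 1 & g u = cap (line A B t)) ->
  (forall t, 0 <= t <= 1 -> line A B t <> M) -> False.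
Proof.
move=> a0 b1 am mb ga gm gb cov avoid.
pose low t := (g @` [set` `[0, m]%R]) (cap (line A B t)).
pose high t := (g @` [set` `[m, 1]%R]) (cap (line A B t)).
have total t : 0 <= t <= 1 -> low t \/ high t.
  move=> /cov[u /andP[u0 u1] gu]; have [um|mu] := leP u m.
    by left; exists u => //; rewrite /= in_itv /= u0.
  by right; exists u => //; rewrite /= in_itv /= u1 ltW.
have excl t : 0 <= t <= 1 -> low t -> high t -> False.
  move=> t01 [u /=]; rewrite in_itv /= => /andP[u0 um] gu [v /=]; rewrite in_itv /= => /andP[mv v1] gv.
  have E : u = v by apply: g_inj; rewrite ?gu ?gv //; lra.
  have um' : u = m by lra.
  by apply: (avoid t t01); apply: cap_inj; rewrite -gm -um'.
have loc t (c d : R) : ~ (g @` [set` `[c, d]%R]) (cap (line A B t)) -> exists2 e, 0 < e &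
    forall u, `|u - t| < e -> ~ (g @` [set` `[c, d]%R]) (cap (line A B u)).
  move=> nt; have cont : continuous (cap \o line A B).
    by move=> v; apply: continuous_comp; [exact: line_continuous | exact: cap_continuous].
  have /cont/nbhs_ballP[e /= e0 he] : nbhs (cap (line A B t)) (~` (g @` [set` `[c, d]%R])).
    by apply: open_nbhs_nbhs; split => //; apply: closed_openC; apply: closed_arc.
  by exists e => // u tu; apply: he; rewrite /ball /= distrC.
have : low 0 <-> low 1.
  apply: (@unit_interval_chain R (fun t u => low t <-> low u)) => [t t01|t u v];
    last by move=> [? ?] [? ?]; split; auto.
  have [l|h] := total t t01.
    have [|e e0 he] := loc t m 1; first exact: excl.
    exists e => // u u01 /he nh; have lu : low u by case: (total u u01).
    by [].
  have [|e e0 he] := loc t 0 m; first by move=> /excl; apply.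
  have nlt : ~ low t by move=> /excl; apply.
  by exists e => // u u01 /he nl.
have l0 : low 0 by exists a; rewrite ?ga /line ?mul0r ?addr0 -?surjective_pairing //= in_itv /=; lra.
have h1 : high 1.
  exists b; first by rewrite /= in_itv /=; lra.
  by rewrite gb /line !mul1r !addrA [A.1 + _]addrC [A.2 + _]addrC !addrK -surjective_pairing.
by move=> [/(_ l0) l1 _]; apply: (excl 1); rewrite ?ler01 ?lexx.
Qed.

(** Take three points of a covered ball that are not collinear. The one with the middle parameter
    separates the other two on the arc, but the straight segment joining these stays in the ball and
    avoids it. *)
Lemma uncovered c e : 0 < e -> exists2 x : R * R, `|x - c| < e & forall t, 0 <= t <= 1 -> g t <> cap x.
Proof.
move=> e0; apply: contrapT => nx.
have cov x : `|x - c| < e -> exists2 t, 0 <= t <= 1 & g t = cap x.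
  move=> xc; apply: contrapT => nt; apply: nx; exists x => // t t01 gt.
  by apply: nt; exists t.
have ball_line A B t : 0 <= t <= 1 -> `|A - c| < e -> `|B - c| < e -> `|line A B t - c| < e.
  move=> /andP[t0 t1] Ac Bc; pose m := Num.max `|A - c| `|B - c|.
  have lt : m < e by rewrite gt_max Ac.
  have /[!norm2_le]/andP[A1 A2] : `|A - c| <= m by rewrite le_max lexx.
  have /[!norm2_le]/andP[B1 B2] : `|B - c| <= m by rewrite le_max lexx orbT.
  have conv (x y z : R) : `|x - z| <= m -> `|y - z| <= m -> `|x + t * (y - x) - z| <= m.
    rewrite !ler_norml => /andP[x1 x2] /andP[y1 y2]; have t1' : 0 <= 1 - t by lra.
    have := mulr_ge0 t0 (_ : 0 <= m - (y - z)); have := mulr_ge0 t0 (_ : 0 <= (y - z) + m).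
    have := mulr_ge0 t1' (_ : 0 <= m - (x - z)); have := mulr_ge0 t1' (_ : 0 <= (x - z) + m).
    by do 4!(move=> /(_ ltac:(lra)) ?); apply/andP; split; lra.
  by apply: le_lt_trans lt; rewrite norm2_le !conv.
have bypass A B M a m b : `|A - c| < e -> `|B - c| < e -> 0 <= a <= 1 -> 0 <= b <= 1 ->
    g a = cap A -> g m = cap M -> g b = cap B -> a < m < b \/ b < m < a ->
    (forall t, 0 <= t <= 1 -> line A B t <> M) -> (forall t, 0 <= t <= 1 -> line B A t <> M) -> False.
  move=> Ac Bc /andP[a0 a1] /andP[b0 b1] ga gm gb [] /andP[lt1 lt2] av av'.
    apply: (no_bypass a0 b1 lt1 lt2 ga gm gb) => // t t01; apply: cov; exact: ball_line.
  apply: (no_bypass b0 a1 lt1 lt2 gb gm ga) => // t t01; apply: cov; exact: ball_line.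
pose X := c; pose Y := (c.1 + e / 2, c.2); pose Z := (c.1, c.2 + e / 2).
have Xc : `|X - c| < e by rewrite subrr normr0.
have Yc : `|Y - c| < e.
  by rewrite norm2_lt !ltr_norml /=; apply/andP; split; apply/andP; split; lra.
have Zc : `|Z - c| < e.
  by rewrite norm2_lt !ltr_norml /=; apply/andP; split; apply/andP; split; lra.
have [x x01 gx] := cov X Xc; have [y y01 gy] := cov Y Yc; have [z z01 gz] := cov Z Zc.
have distinct P Q p q : g p = cap P -> g q = cap Q -> P <> Q -> p <> q.
  by move=> gp gq PQ E; apply: PQ; apply: cap_inj; rewrite -gp -gq E.
have XY : x <> y by apply: (distinct X Y) => // /(congr1 fst) /=; rewrite /X; lra.
have XZ : x <> z by apply: (distinct X Z) => // /(congr1 snd) /=; rewrite /X; lra.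
have YZ : y <> z by apply: (distinct Y Z) => // /(congr1 fst) /=; lra.
have : [\/ y < x < z \/ z < x < y, x < y < z \/ z < y < x | x < z < y \/ y < z < x].
  have [h1|h1|//] := ltgtP x y; have [h2|h2|//] := ltgtP x z; have [h3|h3|//] := ltgtP y z;
  rewrite ?h1 ?h2 ?h3; do ?[by constructor 1; auto | by constructor 2; auto | by constructor 3; auto]; lra.
case=> h.
- apply: (bypass Y Z X y x z) => // t t01 E; have := congr1 fst E; have := congr1 snd E;
    by rewrite /X /Y /Z /line /=; nra.
- apply: (bypass X Z Y x y z) => // t t01 E; have := congr1 fst E;
    by rewrite /X /Y /Z /line /=; nra.
- apply: (bypass X Y Z x z y) => // t t01 E; have := congr1 snd E;
    by rewrite /X /Y /Z /line /=; nra.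
Qed.

(** The missed set is open, so finitely many arcs can be treated one by one in shrinking balls. *)
Lemma uncovered_ball c e : 0 < e -> exists c' e', [/\ 0 < e', forall x, `|x - c'| < e' -> `|x - c| < e &
  forall x t, `|x - c'| < e' -> 0 <= t <= 1 -> g t <> cap x].
Proof.
move=> e0; have [x xc nx] := uncovered c e0.
have /cap_continuous/nbhs_ballP[d /= d0 hd] : nbhs (cap x) (~` (g @` [set` `[0, 1]%R])).
  apply: open_nbhs_nbhs; split; first by apply: closed_openC; apply: closed_arc.
  by case=> t /=; rewrite in_itv /= => /nx.
exists x, (Num.min d (e - `|x - c|)); split.
- by rewrite lt_min d0 subr_gt0.
- move=> y; rewrite lt_min => /andP[_ h]; have := ler_distD x y c; lra.
move=> y t; rewrite lt_min => /andP[yx _] t01 gt.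
apply: (hd y); first by rewrite -ball_normE /ball_ /= distrC.
by exists t => //=; rewrite in_itv.
Qed.
End Cap.

Lemma exists_uncovered (R : realType) (I : finType) (g : I -> R -> R * R * R) :
  (forall i, continuous (g i)) ->
  (forall i t u, 0 <= t <= 1 -> 0 <= u <= 1 -> g i t = g i u -> t = u) ->
  exists p0 : R * R * R, [/\ dot p0 p0 = 1, 0 < p0.2 & forall i t, 0 <= t <= 1 -> p0 <> g i t].
Proof.
move=> g_cont g_inj.
(* The bound 1/2 keeps the ball inside the unit disk, so that the point found lies strictly above
   the equator. *)
have [c [e [e0 he av]]] : exists c e, [/\ 0 < e, forall x : R * R, `|x - c| < e -> `|x| < 1 / 2 &
    forall i, i \in enum I -> forall x t, `|x - c| < e -> 0 <= t <= 1 -> g i t <> cap x].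
  elim: (enum I) => [|i s [c [e [e0 he av]]]].
    by exists 0, (1 / 2); split; [rewrite divr_gt0 | move=> x; rewrite subr0 |].
  have [c' [e' [e0' he' av']]] := @uncovered_ball _ _ (@g_cont i) (@g_inj i) c e e0.
  exists c', e'; split=> // [x /he'/he//|j].
  by rewrite inE => /orP[/eqP->//|/av h x t /he' xc]; apply: h.
have cc : `|c - c| < e by rewrite subrr normr0.
have := he c cc; rewrite norm2_lt !ltr_norml => /andP[/andP[h1 h2] /andP[h3 h4]].
have pos : 0 < 1 - c.1 ^+ 2 - c.2 ^+ 2 by rewrite !expr2; nra.
exists (cap c); split; last by move=> i t t01 E; apply: (av i _ c t); rewrite ?mem_enum.
  by rewrite /dot /cap /= -!expr2 sqr_sqrtr ?(ltW pos) //; ring.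
by rewrite /= sqrtr_gt0.
Qed.

Section Clamp.
Variable R : realType.

(** The retraction of the line onto [[0, 1]]; composing with it makes an arc continuous on the whole
    line. *)
Definition clamp (t : R) := (1 + `|t| - `|t - 1|) / 2.

Lemma clamp_id t : 0 <= t <= 1 -> clamp t = t.
Proof. by move=> /andP[t0 t1]; rewrite /clamp ger0_norm // ler0_norm; lra. Qed.

Lemma clamp_itv t : 0 <= clamp t <= 1.
Proof.
rewrite /clamp; have [h1|/ltW h1] := leP 0 t; have [h2|/ltW h2] := leP 0 (t - 1);
  rewrite ?(ger0_norm h1) ?(ler0_norm h1) ?(ger0_norm h2) ?(ler0_norm h2); lra.
Qed.

Lemma clamp_continuous : continuous clamp.
Proof.
have c1 : continuous (fun t : R => `|t|) by move=> t; apply: cvg_norm; exact: cvg_id.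
have c2 : continuous (fun t : R => `|t - 1|).
  by move=> t; apply: cvg_norm; apply: cvgB; [exact: cvg_id | exact: cvg_cst].
move=> t; apply: cvgM; last exact: cvg_cst.
by apply: cvgB; [apply: cvgD; [exact: cvg_cst | exact: c1] | exact: c2].
Qed.

Lemma continuous_clamp (T : topologicalType) (g : R -> T) :
  {within @unit_seg R, continuous g} -> continuous (g \o clamp).
Proof.
move=> /subspace_continuousP cg t; have ct : unit_seg (clamp t) by exact: clamp_itv.
move=> B /(cg _ ct) /= gB; have := clamp_continuous gB; rewrite !nbhs_simpl /=.
by apply: filterS => u /=; apply; exact: clamp_itv.
Qed.
End Clamp.

(** * The darts of a drawing *)

Section DrawingDarts.
Variables (R : realType) (V : finType) (adj : rel V) (c : V -> bool).
Variables (pos : V -> R * R * R) (arc : V -> V -> R -> R * R * R).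
Hypothesis adj_sym : symmetric adj.
Hypothesis adj_col : forall x y, adj x y -> c x != c y.
Hypothesis drawing : is_drawing adj pos arc.
Hypothesis simple : is_simple_drawing adj arc.
Hypothesis fan_crossing : is_fan_crossing adj arc.

Definition oedge := {p : V * V | adj p.1 p.2 && c p.1}.
Implicit Types (e f h : oedge) (b : bool) (t u : R) (w : V).

Definition vtx e b := if b then (val e).1 else (val e).2.
Definition gam e t := arc (vtx e true) (vtx e false) (clamp t).

Lemma oedge_adj e : adj (vtx e true) (vtx e false).
Proof. by case: e => -[x y] /= /andP[]. Qed.

Lemma vtx_color e b : c (vtx e b) = b.
Proof.
have := adj_col (oedge_adj e); have : c (vtx e true) by case: e => -[x y] /= /andP[].
by case: b => //; case: (c _) => //; case: (c _).
Qed.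

Lemma vtx_col e f b : vtx e b <> vtx f (~~ b).
Proof. by move/(congr1 c); rewrite !vtx_color; case: b. Qed.

Lemma vtx_inj e f b : vtx e b = vtx f b -> vtx e (~~ b) = vtx f (~~ b) -> e = f.
Proof.
by case: b => /= h1 h2; apply: val_inj; apply: injective_projections.
Qed.

Lemma neq_same_edge e f : e != f ->
  ~~ same_edge (vtx e true) (vtx e false) (vtx f true) (vtx f false).
Proof.
apply: contraNN => /eqP/setP E; apply/eqP; apply: (@vtx_inj e f true) => /=.
  have := E (vtx e true); rewrite !inE eqxx => /esym/orP[/eqP//|/eqP h].
  by case: (@vtx_col e f true).
have := E (vtx e false); rewrite !inE eqxx orbT => /esym/orP[/eqP h|/eqP//].
by case: (@vtx_col e f false).
Qed.

Lemma gam_jordan e : [/\ jordan_arc (arc (vtx e true) (vtx e false)),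
  gam e 0 = pos (vtx e true) & gam e 1 = pos (vtx e false)].
Proof.
case: drawing => _ /(_ _ _ (oedge_adj e))[jarc a0 a1 _] _ _ _.
by split=> //; rewrite /gam clamp_id // lexx ler01.
Qed.

Lemma gam_continuous e : continuous (gam e).
Proof. by have [[cg _ _] _ _] := gam_jordan e; apply: (continuous_clamp cg). Qed.

Lemma gam_inj e t u : 0 <= t <= 1 -> 0 <= u <= 1 -> gam e t = gam e u -> t = u.
Proof.
have [[_ ginj _] _ _] := gam_jordan e => t01 u01.
by rewrite /gam !clamp_id // => /ginj; apply.
Qed.

Lemma gam_pts e t : edge_pts arc (vtx e true) (vtx e false) (gam e t).
Proof. by exists (clamp t) => //; exact: clamp_itv. Qed.

Lemma gam_int e t : 0 < t < 1 -> edge_int arc (vtx e true) (vtx e false) (gam e t).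
Proof. by move=> t01; exists t => //; rewrite /gam clamp_id //; lra. Qed.

Lemma gam_sphere e t : dot (gam e t) (gam e t) = 1.
Proof.
have [[_ _ sph] _ _] := gam_jordan e; have := sph _ (gam_pts e t).
by rewrite /sphere /dot /= !expr2.
Qed.

Lemma gam_end e b : gam e (if b then 0 else 1) = pos (vtx e b).
Proof. by have [_ g0 g1] := gam_jordan e; case: b. Qed.

Lemma pos_inj : injective pos. Proof. by case: drawing => -[]. Qed.

Lemma gam_pos e t w : 0 <= t <= 1 -> gam e t = pos w ->
  exists2 b, w = vtx e b & t = if b then 0 else 1.
Proof.
move=> t01 E; have := gam_pts e t; rewrite E => pw.
have [b wb] : exists b, w = vtx e b.
  case: drawing => _ _ /(_ _ _ _ (oedge_adj e) pw) [->|->] _ _; by [exists true|exists false].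
exists b => //; apply: (@gam_inj e) => //; last by rewrite gam_end E wb.
by case: (b); rewrite lexx ler01.
Qed.

Lemma meet_once e f t u t' u' : e != f -> gam e t = gam f u -> gam e t' = gam f u' ->
  gam e t = gam e t'.
Proof.
move=> ef E E'; apply: (simple (oedge_adj e) (oedge_adj f) (neq_same_edge ef)).
- exact: gam_pts.
- by rewrite E; exact: gam_pts.
- exact: gam_pts.
- by rewrite E'; exact: gam_pts.
Qed.

Definition crossed_at e f t := 0 < t < 1 /\ exists2 u, 0 < u < 1 & gam e t = gam f u.
Definition cr e f : bool := (e != f) && `[< exists t, crossed_at e f t >].
(** Meaningful under [cr e f], where [place_uniq] shows that the parameter is unique. *)
Definition place e f : R := xget 0 [set t | crossed_at e f t].

Lemma placeP e f : cr e f -> crossed_at e f (place e f).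
Proof. by case/andP=> _ /asboolP; apply: xgetPex. Qed.

Lemma cr_sym : symmetric cr.
Proof.
suff H e f : cr e f -> cr f e by move=> e f; apply/idP/idP; apply: H.
case/andP=> ef /asboolP[t [t01 [u u01 E]]]; rewrite /cr eq_sym ef /=; apply/asboolP.
by exists u; split=> //; exists t.
Qed.

Lemma cr_irr : irreflexive cr. Proof. by move=> e; rewrite /cr eqxx. Qed.

Lemma place_itv e f : cr e f -> 0 < place e f < 1.
Proof. by case/placeP. Qed.

Lemma place_uniq e f t u : e != f -> cr e f -> 0 <= t <= 1 -> gam e t = gam f u -> t = place e f.
Proof.
move=> ef /placeP[/andP[p0 p1] [v _ E']] t01 E; apply: (@gam_inj e) => //; first by rewrite !ltW.
exact: meet_once ef E E'.
Qed.

Lemma gam_place e f : cr e f -> gam e (place e f) = gam f (place f e).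
Proof.
move=> cef; have [_ [u u01 E]] := placeP cef; have cfe : cr f e by rewrite cr_sym.
have ef : f != e by case/andP: cfe.
by rewrite E (@place_uniq f e u (place e f)) //; move: u01 => /andP[u0 u1]; rewrite !ltW.
Qed.

Lemma place_cr e f t u : e != f -> 0 < t < 1 -> 0 < u < 1 -> gam e t = gam f u ->
  cr e f /\ t = place e f.
Proof.
move=> ef t01 u01 E; have cef : cr e f.
  by rewrite /cr ef; apply/asboolP; exists t; split=> //; exists u.
by split=> //; apply: place_uniq E => //; move: t01 => /andP[t0 t1]; rewrite !ltW.
Qed.

Lemma place_third e f h t : cr e f -> gam e (place e f) = gam h t -> h = e \/ h = f.
Proof.
move=> cef E; have [->|he] := eqVneq h e; first by left.
have [->|hf] := eqVneq h f; first by right.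
have ef : e != f by case/andP: cef.
case: drawing => _ _ _ _ [_ third]; exfalso.
apply: (third _ _ _ _ _ _ (gam e (place e f)) (oedge_adj e) (oedge_adj f) (oedge_adj h)).
- exact: neq_same_edge.
- by apply: neq_same_edge; rewrite eq_sym.
- by apply: neq_same_edge; rewrite eq_sym.
- exact: gam_int (place_itv cef).
- by rewrite gam_place //; apply: gam_int; apply: place_itv; rewrite cr_sym.
- by rewrite E; apply: gam_pts.
Qed.

Lemma place_inj e f h : cr e f -> cr e h -> place e f = place e h -> f = h.
Proof.
move=> cef ceh E; have := gam_place ceh; rewrite -E => /(place_third cef)[he|->//].
by rewrite he cr_irr in ceh.
Qed.

Lemma cr_disj e f b : cr e f -> vtx e b <> vtx f b.
Proof.
move=> cef E; have ef : e != f by case/andP: cef.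
have := place_itv cef; rewrite -(@place_uniq e f (if b then 0 else 1) (if b then 0 else 1)) //.
- by case: b {E}; rewrite ltxx ?andbF.
- by case: (b); rewrite lexx ler01.
by rewrite !gam_end E.
Qed.

Lemma cr_crosses e f : cr e f ->
  crosses arc (vtx e true) (vtx e false) (vtx f true) (vtx f false).
Proof.
move=> cef; split; first by apply: neq_same_edge; case/andP: cef.
exists (gam e (place e f)); split; first exact: gam_int (place_itv cef).
by rewrite gam_place //; apply: gam_int; apply: place_itv; rewrite cr_sym.
Qed.

(** The colour of the common end [w] decides at which end of each edge crossing [e] it lies. *)
Lemma fan e f h b : cr e f -> cr e h -> vtx f b = vtx h b \/ vtx f (~~ b) = vtx h (~~ b).
Proof.
move=> cef ceh; have [w hw] := fan_crossing (oedge_adj e).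
have end_w x : cr e x -> w = vtx x (c w).
  move=> cex; have [E|E] := hw _ _ (oedge_adj x) (cr_crosses cex);
  by rewrite {2}E vtx_color.
have E : vtx f (c w) = vtx h (c w) by rewrite -!end_w.
by move: E; case: (c w); case: b; auto.
Qed.

(** The rank of the crossing along [e], a natural number in place of the real parameter. *)
Definition tau e f := #|[pred h | cr e h && (place e h < place e f)]|.

Lemma ltn_tau e f h : cr e f -> cr e h -> (tau e f < tau e h)%N = (place e f < place e h).
Proof.
have mono x y : place e x <= place e y -> (tau e x <= tau e y)%N.
  move=> le; apply: subset_leq_card; apply/fintype.subsetP => z; rewrite !inE => /andP[-> lt].
  exact: lt_le_trans lt le.
move=> cef ceh; case: ltP => [lt|le]; last by rewrite ltnNge mono.
apply: proper_card; apply/properP; split.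
  by apply/fintype.subsetP => z; rewrite !inE => /andP[-> /lt_trans]; apply.
by exists f; rewrite !inE cef ?lt ?ltxx.
Qed.

Lemma tau_inj e f h : cr e f -> cr e h -> tau e f = tau e h -> f = h.
Proof.
move=> cef ceh E; apply: (place_inj cef ceh); apply/eqP; rewrite eq_le !leNgt.
by rewrite -!ltn_tau // E ltnn.
Qed.

Local Notation dart := (dart oedge).
Local Notation valid := (@valid oedge cr).
Local Notation nxt := (nxt cr tau).
Local Notation segment := (segment cr).

Definition par (d : dart) : R :=
  if d.1.2 is Some f then place d.1.1 f else if d.2 then 0 else 1.
Definition start d := gam d.1.1 (par d).

Lemma par_itv d : valid d -> 0 <= par d <= 1.
Proof.
case: d => -[e [f|]] b; rewrite /par /=; last by case: b; rewrite lexx ler01.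
by move=> /place_itv/andP[p0 p1]; rewrite !ltW.
Qed.

(** A crossing lies on no third edge and is no vertex, so darts starting in one point belong to the
    same crossing or the same vertex. *)
Lemma start_node d d' : valid d -> valid d' -> (start d == start d') = same_node vtx d d'.
Proof.
have mixed e f b e' b' : cr e f -> gam e (place e f) <> gam e' (if b' then 0 else 1).
  rewrite gam_end => cef E; have := place_itv cef.
  have [|b'' _ ->] := gam_pos _ E; last by case: b''; rewrite ltxx ?andbF.
  by have /andP[p0 p1] := place_itv cef; rewrite !ltW.
case: d d' => -[e [f|]] b [[e' [f'|]] b']; rewrite /valid /start /par /same_node /= => v v'.
- apply/eqP/orP => [E|].
    have E' : gam e (place e f) = gam f' (place f' e') by rewrite E gam_place.
    case: (place_third v E) (place_third v E') => he [] hf; rewrite he hf ?eqxx; auto.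
      by rewrite he hf cr_irr in v'.
    by rewrite he hf cr_irr in v'.
  by case=> /andP[/eqP<- /eqP<-]; rewrite // gam_place.
- by apply/negP => /eqP; apply: mixed.
- by apply/negP => /eqP/esym; apply: mixed.
rewrite !gam_end; apply/eqP/andP => [/pos_inj E|[/eqP-> /eqP->//]].
have /eqP b_eq : b == b' by rewrite -(vtx_color e b) E vtx_color.
by rewrite -b_eq in E *; rewrite E.
Qed.

Definition lo (s : segment) := par ((val s).1, (val s).2, true).
Definition hi (s : segment) := par ((val s).1, nxt ((val s).1, (val s).2, true), false).
Definition piece (s : segment) (t : R) := gam (val s).1 (lo s + t * (hi s - lo s)).

Lemma hi_le (s : segment) f : cr (val s).1 f -> lo s < place (val s).1 f ->
  hi s <= place (val s).1 f.
Proof.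
case: s => -[e o] v; rewrite /hi /lo /= => cef lt.
have fb : beyond cr tau e o true f.
  by rewrite /beyond cef; case: o v lt => // g v lt; rewrite /before ltn_tau.
case: (nxtP tau_inj) => [g gb gmin|/(_ f)]; last by rewrite fb.
have [->|] := gmin f fb; first by rewrite lexx.
by case/andP: gb => cg _; rewrite /before ltn_tau // => /ltW.
Qed.

Lemma lo_hi s : [/\ 0 <= lo s, lo s < hi s & hi s <= 1].
Proof.
have lo0 : 0 <= lo s by have /andP[] := par_itv (valP s).
case: s lo0 => -[e o] v; rewrite /hi /lo /= => lo0.
case: (nxtP tau_inj) => [g /andP[cg gb] gmin|_]; rewrite /par /=.
  have /andP[g0 g1] := place_itv cg; split=> //; last exact: ltW.
  by case: o v gb {lo0 gmin} => // f cf; rewrite /before ltn_tau.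
by split=> //; case: o v {lo0} => [f cf|_]; [case/andP: (place_itv cf) | rewrite ltr01].
Qed.

Lemma piece_itv s t : 0 < t < 1 -> let x := lo s + t * (hi s - lo s) in
  [/\ lo s < x, x < hi s & 0 < x < 1].
Proof. by have [l0 lh h1] := lo_hi s => /andP[t0 t1] x; split; rewrite /x; nra. Qed.

Lemma piece_closed s t : 0 <= t <= 1 -> lo s <= lo s + t * (hi s - lo s) <= hi s.
Proof. by have [l0 lh h1] := lo_hi s => /andP[t0 t1]; apply/andP; split; nra. Qed.

(** A point of [f] inside a piece would be a crossing strictly between two consecutive cuts, against
    [hi_le]. *)
Lemma piece_other s t f u : 0 < t < 1 -> 0 <= u <= 1 -> (val s).1 != f -> piece s t <> gam f u.
Proof.
move=> t01 u01 ef E; have [x1 x2 x3] := piece_itv s t01.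
set x := lo s + _ in x1 x2 x3; have x01 : 0 <= x <= 1 by lra.
have end_free b : u <> if b then 0 else 1.
  move=> ub; have Ev : gam (val s).1 x = pos (vtx f b) by rewrite -gam_end -ub.
  have [b' _ xE] := gam_pos x01 Ev.
  by move: x3; rewrite xE; case: (b'); rewrite ltxx ?andbF.
have [/(end_free true)//|/(end_free false)//|u01'] := t01_cases u01.
have [cef xE] := place_cr ef x3 u01' E.
by have := hi_le cef; rewrite -xE leNgt x2 => /(_ x1).
Qed.

Lemma piece_ends s b : piece s (if b then 1 else 0) = start (exit_dart tau (s, b)).
Proof.
rewrite /piece /start /exit_dart /hi /lo; case: b => /=; last by rewrite mul0r addr0 -surjective_pairing.
by rewrite mul1r addrC subrK; case: s => -[].
Qed.

Lemma piece_node (x y : segment * bool) : (piece x.1 (if x.2 then 1 else 0) ==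
  piece y.1 (if y.2 then 1 else 0)) = same_node vtx (exit_dart tau x) (exit_dart tau y).
Proof.
by case: x y => [s b] [s' b'] /=; rewrite !piece_ends start_node // exit_dart_valid //; exact: tau_inj.
Qed.

Lemma piece_vertex s t (d : segment * bool) : 0 < t < 1 ->
  piece s t <> piece d.1 (if d.2 then 1 else 0).
Proof.
case: d => s' b t01; rewrite /= piece_ends.
have := exit_dart_valid tau_inj (s', b); move: (exit_dart _ _) => d v E.
have [ed|] := eqVneq (val s).1 d.1.1; last by move=> ed; apply: (piece_other t01 (par_itv v) ed E).
have [x1 x2 x3] := piece_itv s t01.
have xE : lo s + t * (hi s - lo s) = par d.
  by apply: (@gam_inj (val s).1); rewrite ?par_itv //; [lra | rewrite [in RHS]ed].
case: d v ed E xE => -[e [f|]] b' v ed E xE; rewrite /par /= in ed xE; last first.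
  by move: x3; rewrite xE; case: (b'); rewrite ltxx ?andbF.
have ef : (val s).1 != f by rewrite ed; case/andP: v.
apply: (@piece_other s t f (place f e)) => //; last by rewrite E /start /par /= gam_place.
by have cfe : cr f e; [rewrite cr_sym | have /andP[p0 p1] := place_itv cfe; rewrite !ltW].
Qed.

Lemma piece_disj s s' t u : s != s' -> 0 < t < 1 -> 0 <= u <= 1 -> piece s t <> piece s' u.
Proof.
move=> ss t01 u01; have [ed|ed] := eqVneq (val s).1 (val s').1; last first.
  move=> E; apply: (piece_other t01 _ ed E).
  by have := piece_closed s' u01; have [? ? ?] := lo_hi s'; lra.
have [x1 x2 x3] := piece_itv s t01; have := piece_closed s' u01; have [l0 lh h1] := lo_hi s'.
rewrite /piece -ed => x' /gam_inj E; have {}E : lo s + t * (hi s - lo s) = lo s' + u * (hi s' - lo s').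
  apply: E; first by case/andP: x3 => /ltW -> /ltW ->.
  by case/andP: x' => lo_x x_hi; rewrite (le_trans l0 lo_x) (le_trans x_hi h1).
have below (r r' : segment) : (val r).1 = (val r').1 -> lo r < lo r' -> hi r <= lo r'.
  move=> er lt; have [r0 _ _] := lo_hi r; case oE: (val r').2 => [f|]; last first.
    by move: lt; rewrite {2}/lo /par /= oE ltNge r0.
  have lE : lo r' = place (val r).1 f by rewrite /lo /par /= oE er.
  rewrite lE in lt *; apply: hi_le lt; rewrite er.
  by have := valP r'; rewrite [val r']surjective_pairing oE.
have [lt|gt|eq] := ltgtP (lo s) (lo s').
- by have := lt_le_trans x2 (below _ _ ed lt); rewrite E ltNge; case/andP: x' => ->.
- by have := le_lt_trans (below _ _ (esym ed) gt) x1; rewrite E ltNge; case/andP: x' => _ ->.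
case/eqP: ss; apply: val_inj; apply: injective_projections => //.
move: eq (valP s) (valP s') ed; rewrite /lo /par /=.
case: (val s) => e [f|]; case: (val s') => e' [f'|] //= eq v v' ed; subst e'.
- by rewrite (place_inj v v' eq).
- by have := place_itv v; rewrite eq ltxx.
- by have := place_itv v'; rewrite -eq ltxx.
Qed.

Lemma piece_rotation : has_rotation (fun x : segment * bool => piece x.1 (if x.2 then 1 else 0)).
Proof.
have [p0 [p0_sph p0_pos p0_av]] := exists_uncovered gam_continuous gam_inj.
apply: (sphere_rotation (g := piece) (p0 := p0)) => //.
- move=> s; have cl : continuous (fun t => lo s + t * (hi s - lo s)).
    by move=> t; apply: cvgD; [exact: cvg_cst | apply: cvgM; [exact: cvg_id | exact: cvg_cst]].
  by move=> t; apply: continuous_comp; [exact: cl | exact: gam_continuous].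
- by move=> s t; exact: gam_sphere.
- move=> s t; have := p0_av (val s).1 _ (clamp_itv (lo s + t * (hi s - lo s))).
  by rewrite /piece /gam [clamp (clamp _)]clamp_id ?clamp_itv.
- move=> s /=; have [l0 lh h1] := lo_hi s; rewrite /piece mul0r addr0 mul1r addrC subrK.
  move/gam_inj => E; suff E' : lo s = hi s by rewrite E' ltxx in lh.
  by apply: E; rewrite ?l0 ?h1 ?andbT ?(ltW (lt_le_trans lh h1)) ?(ltW (le_lt_trans l0 lh)).
- exact: piece_vertex.
exact: piece_disj.
Qed.
End DrawingDarts.

End Topology.

(** * Edges of the graph as oriented pairs *)

Section Graph.
Variables (V : finType) (adj : rel V) (c : V -> bool).
Hypothesis adj_sym : symmetric adj.
Hypothesis adj_col : forall x y, adj x y -> c x != c y.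

Lemma oedge_of x y : adj x y -> exists e : oedge adj c,
  [set x; y]%SET = [set vtx e true; vtx e false]%SET.
Proof.
move=> xy; have := adj_col xy; case cx: (c x) => cy.
  have h : adj (x, y).1 (x, y).2 && c (x, y).1 by rewrite /= xy cx.
  by exists (exist _ (x, y) h).
have h : adj (y, x).1 (y, x).2 && c (y, x).1.
  by rewrite /= adj_sym xy; case: (c y) cy.
by exists (exist _ (y, x) h); rewrite finset.setUC.
Qed.

Lemma num_edgesE : num_edges adj = #|{: oedge adj c}|.
Proof.
pose ends (e : oedge adj c) := [set vtx e true; vtx e false]%SET.
have ends_inj : injective ends.
  move=> e f E; apply/eqP; apply: contraT => /(neq_same_edge adj_col).
  by rewrite /same_edge -/(ends e) -/(ends f) E eqxx.
rewrite -(card_imset _ ends_inj); apply: eq_card => S.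
rewrite inE; apply/existsP/imsetP => [[x /existsP[y /andP[xy /eqP ->]]]|[e _ ->]].
  by have [e E] := oedge_of xy; exists e.
by exists (vtx e true); apply/existsP; exists (vtx e false); rewrite eqxx andbT oedge_adj.
Qed.

(** There is a third vertex, so by connectedness some edge leaves the set of the two ends of [e].
    The colour of the shared vertex tells which end it is for both edges. *)
Lemma no_isolated_oedge : graph_conn adj -> 3 <= #|V| -> forall e : oedge adj c,
  exists2 e' : oedge adj c, e' != e & exists b, vtx e' b = vtx e b.
Proof.
move=> conn n3 e; pose D := [set vtx e true; vtx e false]%SET.
have [z zD] : exists z, z \notin D.
  apply/existsP; rewrite -[[exists _, _]]negbK negb_exists; apply/negP => /forallP all_in.
  have : #|V| <= #|D|.
    by rewrite -cardsT; apply: subset_leq_card; apply/fintype.subsetP => z _; have := all_in z; rewrite negbK.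
  by rewrite leqNgt; apply/negP; rewrite negbK; apply: leq_trans n3; rewrite ltnS cards2; case: eqP.
have [x [y [xD yD xy]]] : exists x y, [/\ x \in D, y \notin D & adj x y].
  have /connectP[p] := conn (vtx e true) z.
  have : vtx e true \in D by rewrite !inE eqxx.
  elim: p (vtx e true) => [|y p IHp] x xD /=; first by move=> _ zx; rewrite zx xD in zD.
  case/andP=> xy yp zl; have [yD|yD] := boolP (y \in D); first exact: IHp yD yp zl.
  by exists x, y.
have [e' E] := oedge_of xy; exists e'.
  apply: contra yD => /eqP ee; rewrite /D -ee -E !inE eqxx orbT //.
have xe' : x \in [set vtx e' true; vtx e' false]%SET by rewrite -E !inE eqxx.
have ends (f : oedge adj c) : x \in [set vtx f true; vtx f false]%SET -> vtx f (c x) = x.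
  by rewrite !inE => /orP[]/eqP ->; rewrite (vtx_color adj_col).
by exists (c x); rewrite !ends.
Qed.
End Graph.

Theorem theorem16 (R : realType) (V : finType) (adj : rel V) :
  symmetric adj -> irreflexive adj ->
  3 <= #|V| ->
  graph_conn adj -> bipartite adj ->
  simple_fan_crossing R adj ->
  num_edges adj <= 4 * #|V| - 10.
Proof.
move=> adj_sym _ n3 conn [c col] [pos [arc [drawing simple fan_cr]]].
rewrite (num_edgesE adj_sym col).
suff : #|{: oedge adj c}| + 10 <= 4 * #|V| by lia.
apply: (edge_bound_segments (@cr_sym R V adj c arc) (cr_irr arc) (tau_inj col drawing simple)
  (vtx_col col) (piece_node col drawing simple) (piece_rotation col drawing simple)).
- exact: vtx_inj.
- exact: (cr_disj col drawing simple).
- exact: (fan col drawing simple fan_cr).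
- exact: (no_isolated_oedge adj_sym col conn n3).
exact: n3.
Qed.
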